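(* If $Y$ is an exponential length space (everywhere, i.e. off $W_Y=\emptyset$) which is locally isotropic, then $Y$ is (isometric to) a complete Riemannian manifold with constant sectional curvature.
   Context: A complete length space is a metric space in which every pair of points is joined by a length minimizing rectifiable curve whose length is the distance between the points. Exponential length space. A complete length space $Y$ is an exponential length space (everywhere) if there exist a continuous function $y\mapsto R_y>0$ on $Y$ and $n\in\mathbb{N}$ (the exponential dimension) such that for all $y\in Y$ there is a continuous one-to-one and onto function $\exp_y:B_0(R_y)\subset\mathbb{R}^n\to B_y(R_y)$ such that for each fixed $v\in S^{n-1}$, $t\mapsto\exp_y(tv)$, $t\in[0,R_y)$, is a length minimizing curve starting at $y$ and parametrized by arclength. No continuity of $\exp_y$ in $y$ is assumed. If $\inf_y R_y>0$, this number is called the exponential radius. Local isotropy. $Y$ is locally isotropic if there is $R>0$ (the isotropy radius) such that $Y$ has exponential radius greater than $R$ and for all $x\in Y$ there is a continuous function $F_x$ on $[0,\pi]\times[0,R]\times[0,R]$ satisfying a) $F_x(\theta_1,a,b)\le F_x(\theta_2,a,b)$ for all $\theta_1<\theta_2$, b) $F_x(\pi,t,t)\ge t$, c) $F_x(0,0,R)=R$, and $$d_Y(\exp_x(tv),\exp_x(sw))=F_x(d_S(v,w),t,s)\qquad\forall v,w\in S^{n-1},\ \forall s,t\in[0,R),$$ where $d_S(v,w)$ is the angle between $v$ and $w$. *)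

(* Defs.v *)
From HB Require Import structures.
From mathcomp Require Import all_boot all_order all_algebra.
From mathcomp Require Import all_classical all_reals all_analysis.

Set Implicit Arguments.
Unset Strict Implicit.
Unset Printing Implicit Defensive.

Import Order.TTheory GRing.Theory Num.Theory.
Import numFieldTopology.Exports numFieldNormedType.Exports.

Local Open Scope classical_set_scope.
Local Open Scope ring_scope.

(* The norm of the library on ['rV[R]_n] is the sup norm; it induces the usual
   topology, but lengths and angles need the Euclidean structure. *)
Definition edot (R : realType) (n : nat) (u v : 'rV[R]_n) : R :=
  (u *m v^T) 0 0.

Definition enorm (R : realType) (n : nat) (u : 'rV[R]_n) : R :=
  Num.sqrt (edot u u).

Definition eball (R : realType) (n : nat) (r : R) : set 'rV[R]_n :=
  [set u | enorm u < r].

Definition esphere (R : realType) (n : nat) : set 'rV[R]_n :=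
  [set u | enorm u = 1].

(* Only meaningful for unit vectors. *)
Definition angle (R : realType) (n : nat) (v w : 'rV[R]_n) : R :=
  acos (edot v w).

(* [itv_partition a b s] says that [a :: s] is a strictly increasing sequence
   ending at [b]. *)
Definition curve_length (R : realType) (Y : metricType R) (c : R -> Y)
    (a b : R) : \bar R :=
  ereal_sup [set (\sum_(0 <= i < size s)
      mdist (c (nth b (a :: s) i)) (c (nth b s i)))%:E
    | s in [set s : seq R | itv_partition a b s]].

(* Metric (Cauchy) completeness is not part of the notion: "complete" refers
   to the existence of minimizing curves between all pairs of points. *)
Definition complete_length_space (R : realType) (Y : metricType R) : Prop :=
  forall x y : Y, exists (a b : R) (c : R -> Y),
    [/\ a <= b, {within `[a, b], continuous c}, c a = x, c b = y &
        curve_length c a b = (mdist x y)%:E].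

Definition unit_speed_minimizing (R : realType) (Y : metricType R)
    (c : R -> Y) (y : Y) (r : R) : Prop :=
  c 0 = y /\
  forall s t : R, 0 <= s -> s <= t -> t < r ->
    curve_length c s t = (t - s)%:E /\
    curve_length c s t = (mdist (c s) (c t))%:E.

(* [expo y] is only meaningful on the Euclidean ball of radius [rad y]. *)
Record exp_structure (R : realType) (Y : metricType R) := ExpStructure {
  rad : Y -> R ;
  edim : nat ;
  expo : Y -> 'rV[R]_edim -> Y ;
  rad_gt0 : forall y, 0 < rad y ;
  rad_continuous : continuous rad ;
  expo_continuous : forall y, {within eball (rad y), continuous (expo y)} ;
  expo_bij : forall y, set_bij (eball (rad y)) (ball y (rad y)) (expo y) ;
  expo_minimizing : forall y v, esphere v ->
    unit_speed_minimizing (fun t => expo y (t *: v)) y (rad y)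
}.

Arguments expo {R Y} e y v : rename.

Definition isotropy_function (R : realType) (Y : metricType R)
    (E : exp_structure Y) (r : R) (x : Y) (F : R -> R -> R -> R) : Prop :=
  [/\ {within [set p : R * R * R |
                 [/\ 0 <= p.1.1 <= pi, 0 <= p.1.2 <= r & 0 <= p.2 <= r]],
       continuous (fun p : R * R * R => F p.1.1 p.1.2 p.2)},
      forall th1 th2 a b : R, 0 <= th1 -> th1 < th2 -> th2 <= pi ->
        0 <= a <= r -> 0 <= b <= r -> F th1 a b <= F th2 a b,
      forall t : R, 0 <= t <= r -> t <= F pi t t,
      F 0 0 r = r &
      forall (v w : 'rV[R]_(edim E)) (s t : R), esphere v -> esphere w ->
        0 <= s < r -> 0 <= t < r ->
        mdist (expo E x (t *: v)) (expo E x (s *: w)) = F (angle v w) t s].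

(* [inf (range (rad E))] is the exponential radius. *)
Definition locally_isotropic (R : realType) (Y : metricType R)
    (E : exp_structure Y) : Prop :=
  exists r : R, [/\ 0 < r, r < inf (range (rad E)) &
    forall x : Y, exists F : R -> R -> R -> R, isotropy_function E r x F].

Definition basis_vec (R : realType) (m : nat) (i : 'I_m) : 'rV[R]_m :=
  delta_mx 0 i.

Fixpoint Ck_on (R : realType) (m : nat) (W : normedModType R) (k : nat)
    (U : set 'rV[R]_m) (f : 'rV[R]_m -> W) : Prop :=
  (forall x, U x -> {for x, continuous f}) /\
  (if k is k'.+1 then
     forall i : 'I_m,
       (forall x, U x -> derivable f x (basis_vec R i)) /\
       Ck_on k' U (fun x => 'D_(basis_vec R i) f x)
   else True).

Definition smooth_on (R : realType) (m : nat) (W : normedModType R)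
    (U : set 'rV[R]_m) (f : 'rV[R]_m -> W) : Prop :=
  forall k : nat, Ck_on k U f.

Section curvature.
Variables (R : realType) (m : nat).
Implicit Types (g : 'rV[R]_m -> 'M[R]_m) (x u v : 'rV[R]_m).
Implicit Types (i j k l : 'I_m).

Definition pderiv i (f : 'rV[R]_m -> R) x : R := 'D_(basis_vec R i) f x.

Definition metric_at g x u v : R := (u *m g x *m v^T) 0 0.

(* [christoffel g k i j] is Gamma^k_{ij} *)
Definition christoffel g k i j x : R :=
  2^-1 * \sum_l invmx (g x) k l *
    (pderiv i (fun z => g z j l) x + pderiv j (fun z => g z i l) x
     - pderiv l (fun z => g z i j) x).

(* R^l_{ijk}, with the convention R(d_i, d_j) d_k = \sum_l R^l_{ijk} d_l and
   R(X, Y) = [nabla_X, nabla_Y] - nabla_[X, Y] *)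
Definition riemann g l i j k x : R :=
  pderiv i (christoffel g l j k) x - pderiv j (christoffel g l i k) x
  + \sum_p (christoffel g l i p x * christoffel g p j k x
            - christoffel g l j p x * christoffel g p i k x).

(* [curvature_op g x u v w] is R(u, v) w *)
Definition curvature_op g x u v (w : 'rV[R]_m) : 'rV[R]_m :=
  \row_l \sum_i \sum_j \sum_k u 0 i * v 0 j * w 0 k * riemann g l i j k x.

Definition sectional_curvature g x u v : R :=
  metric_at g x (curvature_op g x u v v) u /
  (metric_at g x u u * metric_at g x v v - metric_at g x u v ^+ 2).

End curvature.

Record chart (M : topologicalType) (R : realType) (m : nat) := Chart {
  cdom : set M ;
  ccod : set 'rV[R]_m ;
  cmap : M -> 'rV[R]_m ;
  cinv : 'rV[R]_m -> M ;
  cdom_open : open cdom ;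
  ccod_open : open ccod ;
  cmap_cod : forall p, cdom p -> ccod (cmap p) ;
  cinv_dom : forall x, ccod x -> cdom (cinv x) ;
  cmapK : forall p, cdom p -> cinv (cmap p) = p ;
  cinvK : forall x, ccod x -> cmap (cinv x) = x ;
  cmap_continuous : {within cdom, continuous cmap} ;
  cinv_continuous : {within ccod, continuous cinv}
}.

Definition overlap (M : topologicalType) (R : realType) (m : nat)
    (c c' : chart M R m) : set 'rV[R]_m :=
  [set x | ccod c x /\ cdom c' (cinv c x)].

Definition transition (M : topologicalType) (R : realType) (m : nat)
    (c c' : chart M R m) : 'rV[R]_m -> 'rV[R]_m :=
  fun x => cmap c' (cinv c x).

(* A smooth atlas together with the coordinate expressions [gmat a] of the
   metric tensor. With row vectors, the differential of [f] at [x] is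
   [u |-> u *m 'J f x], so [gmat_compat] says that transition maps are
   isometric for the metric tensors. Connectedness is not required: points of
   different components are at distance [+oo] for [rdist] below. *)
Record riemannian_manifold (R : realType) (m : nat) := RiemannianManifold {
  carrier :> topologicalType ;
  carrier_hausdorff : hausdorff_space carrier ;
  carrier_second_countable : @second_countable carrier ;
  atlas_idx : Type ;
  atlas : atlas_idx -> chart carrier R m ;
  atlas_cover : forall p : carrier, exists a, cdom (atlas a) p ;
  atlas_smooth : forall a b,
    smooth_on (overlap (atlas a) (atlas b)) (transition (atlas a) (atlas b)) ;
  gmat : atlas_idx -> 'rV[R]_m -> 'M[R]_m ;
  gmat_smooth : forall a, smooth_on (ccod (atlas a)) (gmat a) ;
  gmat_sym : forall a x, ccod (atlas a) x -> (gmat a x)^T = gmat a x ;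
  gmat_pos : forall a x u, ccod (atlas a) x -> u != 0 ->
    0 < metric_at (gmat a) x u u ;
  gmat_compat : forall a b x, overlap (atlas a) (atlas b) x ->
    let tau := transition (atlas a) (atlas b) in
    gmat a x = 'J tau x *m gmat b (tau x) *m ('J tau x)^T
}.

(* A C^1 curve over [[0, 1]] inside the image of a chart; as C^1 functions on
   [[0, 1]] extend to the line, regularity is asked on the whole line. *)
Definition chart_curve (R : realType) (m : nat) (M : riemannian_manifold R m)
    (a : atlas_idx M) (c : R -> 'rV[R]_m) : Prop :=
  [/\ forall t : R, derivable c t 1, continuous (derive1 c) &
      forall t : R, 0 <= t <= 1 -> ccod (atlas a) (c t)].

Definition chart_curve_length (R : realType) (m : nat)
    (M : riemannian_manifold R m) (a : atlas_idx M) (c : R -> 'rV[R]_m) : R :=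
  (\int[lebesgue_measure]_(t in `[0%R, 1%R])
     Num.sqrt (metric_at (gmat a) (c t) (derive1 c t) (derive1 c t)))%R.

(* [curve_of_length p q L]: some piecewise C^1 curve from [p] to [q] has length
   [L]. By compactness, every piecewise C^1 curve is a finite concatenation of
   C^1 curves each lying in a chart domain. *)
Inductive curve_of_length (R : realType) (m : nat)
    (M : riemannian_manifold R m) : M -> M -> R -> Prop :=
| curve_nil (p : M) : curve_of_length p p 0
| curve_cons (a : atlas_idx M) (c : R -> 'rV[R]_m) (q : M) (L : R) :
    chart_curve a c ->
    curve_of_length (cinv (atlas a) (c 1)) q L ->
    curve_of_length (cinv (atlas a) (c 0)) q (chart_curve_length a c + L).

Definition rdist (R : realType) (m : nat) (M : riemannian_manifold R m)
    (p q : M) : \bar R :=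
  ereal_inf [set L%:E | L in [set L : R | curve_of_length p q L]].

Definition complete_manifold (R : realType) (m : nat)
    (M : riemannian_manifold R m) : Prop :=
  forall u : nat -> M,
    (forall e : R, 0 < e -> exists N : nat, forall i j : nat,
      (N <= i)%N -> (N <= j)%N -> (rdist (u i) (u j) < e%:E)%E) ->
    exists p : M, u @ \oo --> p.

Definition constant_sectional_curvature (R : realType) (m : nat)
    (M : riemannian_manifold R m) : Prop :=
  exists kappa : R, forall (a : atlas_idx M) (x u v : 'rV[R]_m),
    ccod (atlas a) x -> row_free (col_mx u v) ->
    sectional_curvature (gmat a) x u v = kappa.

Definition isometric_to_manifold (R : realType) (m : nat) (Y : metricType R)
    (M : riemannian_manifold R m) : Prop :=
  exists f : Y -> M, bijective f /\
    forall x y : Y, rdist (f x) (f y) = (mdist x y)%:E.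

(* Main.v *)
(* Write [F th a b] for the distance between the ends of two geodesics of
   lengths [a] and [b] leaving a point at angle [th].  For a nearby pair of
   points, the linear reflection of the directions at their midpoint induces a
   local isometry exchanging them, so a single function [F] serves at all points.
   Geodesics do not branch: a branch point would, seen from a point before it,
   spread to a whole range of directions.  Comparing [F] with the midpoint
   convexity of the distance and with its own reflections, the directional
   derivative [G] of the distance satisfies d'Alembert's equation, hence is the
   cosine: this is the first variation formula.  It yields a sine law for small
   triangles, the derivative of [F] in the angle, and for some functions [P], [s]
   with [P' = s] the law of cosines
     P (F th a b) = P (a - b) + s a * s b * (1 - cos th).
   At [th = pi] this reads [P (a + b) - P (a - b) = 2 * s a * s b], whose
   solutions satisfy [s'' = - k * s] for a constant [k].

   Stereographic coordinates at each point then carry the metric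
   [4 |dx|^2 / (1 + k |x|^2)^2] of constant curvature [k]; coordinates are
   determined rationally by the distances to finitely many points, so
   transition maps are rational.  The Riemannian distance agrees with the given
   one infinitesimally, hence globally because there are midpoints. *)
Require Import Defs.
From HB Require Import structures.
From mathcomp Require Import all_boot all_order all_algebra.
From mathcomp Require Import all_classical all_reals all_analysis.
From mathcomp Require Import ring lra.

Set Implicit Arguments.
Unset Strict Implicit.
Unset Printing Implicit Defensive.

Import Order.TTheory GRing.Theory Num.Theory.
Import numFieldTopology.Exports numFieldNormedType.Exports.

Local Open Scope classical_set_scope.
Local Open Scope ring_scope.

(** * Unit vectors and angles *)

(** The hypotheses give no regularity: the maps [expo E y] at different points are unrelated, and
    the function of the angle is only continuous and weakly increasing. Derivatives have to be
    produced. Convexity makes difference quotients monotone, so that one-sided derivatives exist as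
    infima; subadditivity of chords does the same for the length of circles; differential
    inequalities are integrated by a growth argument that asks for a single good increment to the
    right of each point.

    The radii [rho / 8], [rho / 32], [rho / 64], [rho / 256] have no geometric meaning: each leaves
    room for the sides, and sums of sides, of the triangles in use. Small radii suffice, since
    midpoints link the local statements.

    In dimension one only the angles 0 and pi occur, so the values in between are chosen freely and
    the law of cosines is elementary. In dimension zero all points are isolated. Completeness and
    countability rest on charts of the same size everywhere. *)

Section Sphere.
Variables (R : realType) (n : nat).
Implicit Types (u v w : 'rV[R]_n) (s t : R).

Lemma edotE u v : edot u v = \sum_i u 0 i * v 0 i.
Proof. by rewrite /edot mxE; apply: eq_bigr => i _; rewrite !mxE. Qed.

Lemma edotC u v : edot u v = edot v u.
Proof. by rewrite !edotE; apply: eq_bigr => i _; rewrite mulrC. Qed.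

Lemma edotDl u v w : edot (u + v) w = edot u w + edot v w.
Proof. by rewrite /edot mulmxDl mxE. Qed.

Lemma edotDr u v w : edot w (u + v) = edot w u + edot w v.
Proof. by rewrite edotC edotDl !(edotC w). Qed.

Lemma edotZl t u v : edot (t *: u) v = t * edot u v.
Proof. by rewrite /edot -scalemxAl mxE. Qed.

Lemma edotZr t u v : edot u (t *: v) = t * edot u v.
Proof. by rewrite edotC edotZl edotC. Qed.

Lemma edotNl u v : edot (- u) v = - edot u v.
Proof. by rewrite /edot mulNmx mxE. Qed.

Lemma edotNr u v : edot u (- v) = - edot u v.
Proof. by rewrite edotC edotNl edotC. Qed.

Lemma edotBl u v w : edot (u - v) w = edot u w - edot v w.
Proof. by rewrite edotDl edotNl. Qed.

Lemma edotBr u v w : edot w (u - v) = edot w u - edot w v.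
Proof. by rewrite edotDr edotNr. Qed.

Definition edot_lin := (edotDl, edotDr, edotBl, edotBr, edotNl, edotNr, edotZl, edotZr).

Lemma edot_ge0 u : 0 <= edot u u.
Proof. by rewrite edotE; apply: sumr_ge0 => i _; rewrite -expr2 sqr_ge0. Qed.

Lemma edot_eq0 u : edot u u = 0 -> u = 0.
Proof.
rewrite edotE => /eqP; rewrite psumr_eq0 => [/allP u0|i _]; last first.
  by rewrite -expr2 sqr_ge0.
apply/rowP => i; rewrite mxE; apply/eqP.
by have /u0 := mem_index_enum i; rewrite -expr2 sqrf_eq0.
Qed.

Lemma edot0l u : edot 0 u = 0.
Proof. by rewrite -(scale0r u) edotZl mul0r. Qed.

Lemma cauchy_schwarz u v : edot u v ^+ 2 <= edot u u * edot v v.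
Proof.
have [v0|v0] := eqVneq (edot v v) 0.
  by rewrite (edot_eq0 v0) edotC edot0l expr0n /= edot0l mulr0.
have vp : 0 < edot v v by rewrite lt_neqAle eq_sym v0 edot_ge0.
have := edot_ge0 (edot v v *: u - edot u v *: v).
rewrite !edot_lin (edotC v u) => h.
have : 0 <= edot v v * (edot u u * edot v v - edot u v ^+ 2) by nra.
by rewrite pmulr_rge0 // subr_ge0.
Qed.

Lemma enormZ t u : enorm (t *: u) = `|t| * enorm u.
Proof.
by rewrite /enorm !edot_lin mulrA -expr2 sqrtrM ?sqr_ge0 // sqrtr_sqr.
Qed.

Lemma enorm_ge0 u : 0 <= enorm u.
Proof. exact: sqrtr_ge0. Qed.

Lemma sqr_enorm u : enorm u ^+ 2 = edot u u.
Proof. by rewrite sqr_sqrtr // edot_ge0. Qed.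

Lemma enorm_eq0 u : enorm u = 0 -> u = 0.
Proof. by move=> u0; apply: edot_eq0; rewrite -sqr_enorm u0 expr0n. Qed.

Lemma esphereP v : esphere v <-> edot v v = 1.
Proof.
rewrite /esphere /=; split=> [h|h]; first by rewrite -sqr_enorm h expr1n.
by rewrite /enorm h sqrtr1.
Qed.

Lemma esphereN v : esphere v -> esphere (- v).
Proof. by move=> /esphereP h; apply/esphereP; rewrite !edot_lin h opprK. Qed.

Lemma enorm_sphere t v : esphere v -> enorm (t *: v) = `|t|.
Proof. by move=> h; rewrite enormZ h mulr1. Qed.

Lemma esphere_normalize u : enorm u != 0 -> esphere ((enorm u)^-1 *: u).
Proof. by move=> u0; rewrite /esphere /= enormZ ger0_norm ?invr_ge0 ?enorm_ge0 // mulVf. Qed.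

Lemma polar v0 u : esphere v0 -> exists2 v, esphere v & u = enorm u *: v.
Proof.
move=> h0; have [u0|u0] := eqVneq (enorm u) 0.
  by exists v0 => //; rewrite u0 scale0r (enorm_eq0 u0).
exists ((enorm u)^-1 *: u); last by rewrite scalerA divff // scale1r.
exact: esphere_normalize.
Qed.

Lemma edot_unit_itv v w : esphere v -> esphere w -> -1 <= edot v w <= 1.
Proof.
move=> /esphereP hv /esphereP hw; have := cauchy_schwarz v w.
by rewrite hv hw mulr1 -ler_norml => h; rewrite -(@ler_pXn2r _ 2) ?nnegrE // expr1n real_normK ?num_real.
Qed.

Lemma angle_ge0 v w : esphere v -> esphere w -> 0 <= angle v w.
Proof. by move=> hv hw; apply: acos_ge0; exact: edot_unit_itv. Qed.

Lemma angle_lepi v w : esphere v -> esphere w -> angle v w <= pi.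
Proof. by move=> hv hw; apply: acos_lepi; exact: edot_unit_itv. Qed.

Lemma cos_angle v w : esphere v -> esphere w -> cos (angle v w) = edot v w.
Proof. by move=> hv hw; apply: acosK; rewrite in_itv /=; exact: edot_unit_itv. Qed.

Lemma angleC v w : angle v w = angle w v.
Proof. by rewrite /angle edotC. Qed.

Lemma anglexx v : esphere v -> angle v v = 0.
Proof. by move=> /esphereP h; rewrite /angle h acos1. Qed.

Lemma angleNl v w : esphere v -> esphere w -> angle (- v) w = pi - angle v w.
Proof. by move=> hv hw; rewrite /angle edotNl acosN ?edot_unit_itv. Qed.

Lemma angleNr v w : esphere v -> esphere w -> angle v (- w) = pi - angle v w.
Proof. by move=> hv hw; rewrite angleC angleNl // angleC. Qed.

Lemma angleN v : esphere v -> angle v (- v) = pi.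
Proof. by move=> hv; rewrite angleNr // anglexx // subr0. Qed.

Lemma angle_eq0 v w : esphere v -> esphere w -> angle v w = 0 -> v = w.
Proof.
move=> hv hw h; apply/eqP; rewrite -subr_eq0; apply/eqP/edot_eq0.
have := cos_angle hv hw; rewrite h cos0 !edot_lin (edotC w v) => <-.
by move/esphereP: hv => ->; move/esphereP: hw => ->; ring.
Qed.

Lemma angle_eqpi v w : esphere v -> esphere w -> angle v w = pi -> w = - v.
Proof.
move=> hv hw h; apply/esym/angle_eq0 => //; first exact: esphereN.
by rewrite angleNl // h subrr.
Qed.

Lemma angle_gt0 v w : esphere v -> esphere w -> v != w -> 0 < angle v w.
Proof.
move=> hv hw vw; rewrite lt_neqAle angle_ge0 // andbT eq_sym.
by apply: contra_neq vw; exact: angle_eq0.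
Qed.

(** Cauchy-Schwarz for the components of [u] and [w] orthogonal to [v], whose norms are the sines of
    the two angles. This is the spherical triangle inequality before the inverse cosine is taken. *)
Lemma edot_angle_ge u v w : esphere u -> esphere v -> esphere w ->
  cos (angle u v + angle v w) <= edot u w.
Proof.
move=> hu hv hw; rewrite cosD !cos_angle //.
set a := edot u v; set b := edot v w.
have su : 0 <= sin (angle u v) by apply: sin_ge0_pi; rewrite angle_ge0 // angle_lepi.
have sv : 0 <= sin (angle v w) by apply: sin_ge0_pi; rewrite angle_ge0 // angle_lepi.
have := cauchy_schwarz (u - a *: v) (w - b *: v).
rewrite !edot_lin (edotC v u) (edotC w v) -/a -/b.
move/esphereP: hu (hu) => -> hu; move/esphereP: hv (hv) => -> hv; move/esphereP: hw (hw) => -> hw.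
have e1 : sin (angle u v) ^+ 2 = 1 - a ^+ 2 by rewrite sin2cos2 cos_angle.
have e2 : sin (angle v w) ^+ 2 = 1 - b ^+ 2 by rewrite sin2cos2 cos_angle.
set X := edot u w; move: su sv e1 e2; set p := sin _; set q := sin _ => p0 q0 e1 e2 h.
have {}h : (X - a * b) ^+ 2 <= (p * q) ^+ 2.
  rewrite [in leRHS]exprMn e1 e2; apply: le_trans (le_trans h _); rewrite le_eqVlt; apply/orP; left; apply/eqP; ring.
rewrite lerBlDr -lerBlDl; have pq : 0 <= p * q by exact: mulr_ge0.
have := ler_norm (- (X - a * b)); rewrite normrN => h1.
have : `|X - a * b| <= p * q by rewrite -(@ler_pXn2r _ 2) ?nnegrE // real_normK ?num_real.
lra.
Qed.

Lemma angle_le_cos v w t : esphere v -> esphere w -> 0 <= t <= pi ->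
  cos t <= edot v w -> angle v w <= t.
Proof.
move=> hv hw t0; rewrite -cos_angle // leNgt => h; rewrite leNgt; apply: contra h.
rewrite -ltr_cos // in_itv //= angle_ge0 // angle_lepi //.
Qed.

Lemma angle_triangle v u w : esphere u -> esphere v -> esphere w ->
  angle u w <= angle u v + angle v w.
Proof.
(* Past pi the cosine no longer decreases, but there the bound exceeds every angle. *)
move=> hu hv hw; have [h|h] := lerP (angle u v + angle v w) pi; last first.
  by apply: le_trans (ltW h); exact: angle_lepi.
apply: angle_le_cos => //; last exact: edot_angle_ge.
by rewrite h addr_ge0 // angle_ge0.
Qed.

Definition gcircle v w t : 'rV[R]_n := cos t *: v + sin t *: w.

Section GreatCircle.
Variables (v f : 'rV[R]_n).
Hypotheses (hv : esphere v) (hf : esphere f) (vf : edot v f = 0).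

Lemma edot_gcircle s t : edot (gcircle v f s) (gcircle v f t) = cos (s - t).
Proof.
rewrite /gcircle !edot_lin (edotC f v) vf cosB.
by move/esphereP: hv => ->; move/esphereP: hf => ->; ring.
Qed.

Lemma gcircle_sphere t : esphere (gcircle v f t).
Proof. by apply/esphereP; rewrite edot_gcircle subrr cos0. Qed.

Lemma angle_gcircle s t : `|s - t| <= pi ->
  angle (gcircle v f s) (gcircle v f t) = `|s - t|.
Proof.
move=> h; rewrite /angle edot_gcircle -cos_norm cosK // in_itv /= h andbT.
exact: normr_ge0.
Qed.

Lemma gcircle0 : gcircle v f 0 = v.
Proof. by rewrite /gcircle cos0 sin0 scale1r scale0r addr0. Qed.

Lemma gcirclepi : gcircle v f pi = - v.
Proof. by rewrite /gcircle cospi sinpi scaleN1r scale0r addr0. Qed.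

End GreatCircle.

Lemma sphere_ex : (0 < n)%N -> exists v : 'rV[R]_n, esphere v.
Proof.
move=> n0; exists (delta_mx 0 (Ordinal n0)); apply/esphereP; rewrite edotE (bigD1 (Ordinal n0)) //=.
by rewrite big1 => [|i /negbTE ni]; rewrite !mxE ?eqxx /= ?ni ?mulr0 ?mulr1 ?addr0.
Qed.

Lemma sphere_perp v : (1 < n)%N -> esphere v -> exists2 f, esphere f & edot v f = 0.
Proof.
move=> n1 /esphereP hv.
have [i vi] : exists i, v 0 i != 0.
  apply: contrapT => h; have v0 : v = 0.
    by apply/rowP => i; rewrite mxE; apply: contrapT => /eqP vi; apply: h; exists i.
  by move: hv; rewrite v0 edot0l => /esym/eqP; rewrite oner_eq0.
have [j ji] : exists j, j != i.
  have : (1 < #|'I_n|)%N by rewrite card_ord.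
  by rewrite (cardD1 i) inE add1n ltnS => /card_gt0P[j]; rewrite !inE andbT; exists j.
(* A quarter turn in the plane of the coordinates [i] and [j], applied to the projection of [v]; it
   is nonzero because [v 0 i] is. *)
pose f := v 0 i *: delta_mx 0 j - v 0 j *: delta_mx 0 i : 'rV[R]_n.
have dE k u : edot u (delta_mx 0 k) = u 0 k.
  rewrite edotE (bigD1 k) //= big1 ?addr0 => [|l lk]; rewrite mxE eqxx /=.
    by rewrite eqxx mulr1.
  by rewrite (negbTE lk) mulr0.
have f0 : enorm f != 0.
  apply/eqP => /enorm_eq0 /rowP /(_ j); rewrite !mxE !eqxx /= (negbTE ji) mulr1 mulr0 subr0.
  by apply/eqP.
exists ((enorm f)^-1 *: f).
  exact: esphere_normalize.
have vf : edot v f = 0 by rewrite /f !edot_lin !dE mulrC subrr.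
by rewrite edotZr vf mulr0.
Qed.

(** Gram-Schmidt, dividing by the sine of the angle. When the sine vanishes, [w] is [v] or [- v] and
    any orthogonal direction serves. *)
Lemma great_circle v w : (1 < n)%N -> esphere v -> esphere w ->
  exists f, [/\ esphere f, edot v f = 0 & w = gcircle v f (angle v w)].
Proof.
move=> n1 hv hw; have [e|e] := eqVneq (sin (angle v w)) 0.
  have [f hf vf] := sphere_perp n1 hv; exists f; split=> //.
  have [a0|a0] := eqVneq (angle v w) 0; first by rewrite a0 gcircle0; exact/esym/angle_eq0.
  have [api|api] := eqVneq (angle v w) pi; first by rewrite api gcirclepi; exact: angle_eqpi.
  have : 0 < sin (angle v w).
    apply: sin_gt0_pi; rewrite !lt_neqAle eq_sym a0 api /=.
    by rewrite angle_ge0 // angle_lepi.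
  by rewrite e ltxx.
set s := sin (angle v w) in e; set c := edot v w.
exists (s^-1 *: (w - c *: v)); split.
- apply/esphereP; rewrite !edot_lin (edotC w v) -/c.
  have s2 : s ^+ 2 = 1 - c ^+ 2 by rewrite sin2cos2 cos_angle.
  move/esphereP: hv => ->; move/esphereP: hw => ->.
  by transitivity (s^-1 * (s^-1 * s ^+ 2)); [rewrite s2; ring | field].
- by rewrite !edot_lin -/c; move/esphereP: hv => ->; ring.
- by rewrite /gcircle -/s cos_angle // -/c scalerA divff // scale1r addrC subrK.
Qed.

Lemma sphere_at_angle v t : (1 < n)%N -> esphere v -> 0 <= t <= pi ->
  exists2 w, esphere w & angle v w = t.
Proof.
move=> n1 hv /andP[t0 t1]; have [f hf vf] := sphere_perp n1 hv.
exists (gcircle v f t); first exact: gcircle_sphere.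
by rewrite -{1}(gcircle0 v f) angle_gcircle // sub0r normrN ger0_norm.
Qed.

(** The half-turn about the line of [b]: it fixes [b] and negates the orthogonal complement, hence
    reverses the parameter of great circles starting at [b]. *)
Definition line_refl b v : 'rV[R]_n := (2 * edot v b) *: b - v.

Section LineRefl.
Variable b : 'rV[R]_n.
Hypothesis hb : esphere b.

Lemma edot_line_refl u v : edot (line_refl b u) (line_refl b v) = edot u v.
Proof.
rewrite /line_refl !edot_lin (edotC b v); move/esphereP: hb => ->; ring.
Qed.

Lemma line_refl_sphere v : esphere v -> esphere (line_refl b v).
Proof. by move=> /esphereP hv; apply/esphereP; rewrite edot_line_refl. Qed.

Lemma angle_line_refl u v : angle (line_refl b u) (line_refl b v) = angle u v.
Proof. by rewrite /angle edot_line_refl. Qed.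

Lemma line_reflK : involutive (line_refl b).
Proof.
move=> v; rewrite /line_refl !edot_lin; move/esphereP: hb => ->.
by rewrite opprB addrCA -scalerBl [X in X *: _](_ : _ = 0) ?scale0r ?addr0 //; ring.
Qed.

Lemma line_refl_fix v : esphere v -> line_refl b v = v -> v = b \/ v = - b.
Proof.
move=> hv h; have {h}vE : v = edot v b *: b.
  have v2 : v + v = (2 * edot v b) *: b by rewrite -{1}h /line_refl subrK.
  have -> : edot v b *: b = 2^-1 *: (v + v) by rewrite v2 scalerA mulKf // pnatr_eq0.
  by rewrite -mulr2n -[v *+ 2]scaler_nat scalerA mulVf ?scale1r // pnatr_eq0.
have : edot v b ^+ 2 = 1.
  move/esphereP: hv => <-; rewrite [X in _ = edot X X]vE !edot_lin; move/esphereP: hb => ->.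
  by ring.
move/eqP; rewrite sqrf_eq1 => /orP[] /eqP e; rewrite vE e ?scale1r ?scaleN1r; [left|right] => //.
Qed.

Lemma line_refl_gcircle f t : edot b f = 0 -> line_refl b (gcircle b f t) = gcircle b f (- t).
Proof.
move=> bf; rewrite /line_refl /gcircle !edot_lin (edotC f b) bf; move/esphereP: hb => ->.
rewrite cosN sinN mulr1 mulr0 addr0 scaleNr opprD addrA -scalerBl; congr (_ *: _ + _); ring.
Qed.

End LineRefl.

End Sphere.

(** * Real functions on an interval *)

Section RealFunctions.
Variable R : realType.
Implicit Types (f : R -> R) (a b c s t y : R).

(** Continuity of the restriction to [[a, b]], spelled out so that values outside the interval are
    irrelevant: angles live in [[0, pi]], radii in a bounded range. *)
Definition econt a b f := forall t, a <= t <= b -> forall eta, 0 < eta ->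
  exists2 d, 0 < d & forall t', a <= t' <= b -> `|t' - t| < d -> `|f t' - f t| < eta.

Lemma econtN a b f : econt a b f -> econt a b (fun t => - f t).
Proof.
move=> h t tab eta eta0; have [d d0 hd] := h t tab eta eta0.
by exists d => // t' t'ab /(hd _ t'ab); rewrite -opprD normrN.
Qed.

Lemma econtD a b f g : econt a b f -> econt a b g -> econt a b (fun t => f t + g t).
Proof.
move=> hf hg t tab eta eta0; have e2 : 0 < eta / 2 by lra.
have [d d0 hd] := hf t tab _ e2; have [d' d'0 hd'] := hg t tab _ e2.
exists (Num.min d d'); first by rewrite lt_min d0.
move=> t' t'ab; rewrite lt_min => /andP[/(hd _ t'ab) h1 /(hd' _ t'ab) h2].
rewrite [X in `|X|](_ : _ = (f t' - f t) + (g t' - g t)); last by ring.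
by apply: le_lt_trans (ler_normD _ _) _; lra.
Qed.

Lemma econt_lip a b k f : 0 <= k ->
  (forall t t', a <= t <= b -> a <= t' <= b -> `|f t' - f t| <= k * `|t' - t|) -> econt a b f.
Proof.
move=> k0 h t tab eta eta0; exists (eta / (k + 1)); first by rewrite divr_gt0 //; lra.
move=> t' t'ab; rewrite ltr_pdivlMr; last by lra.
move=> h1; apply: le_lt_trans (h _ _ tab t'ab) _; have := normr_ge0 (t' - t); nra.
Qed.

Lemma econt_continuous a b f : continuous f -> econt a b f.
Proof.
move=> cf t tab eta eta0; have /cvgrPdist_lt /(_ eta eta0) := cf t.
rewrite near_simpl => /nbhs_ballP[d /= d0 hd]; exists d => // t' _ td; rewrite distrC; apply: hd.
by rewrite /ball /= distrC.
Qed.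

Lemma econt_sub a b a' b' f : econt a b f -> a <= a' -> b' <= b -> econt a' b' f.
Proof.
move=> h aa bb t /andP[t1 t2] eta eta0.
have [|d d0 hd] := h t _ eta eta0; first by lra.
by exists d => // t' /andP[t3 t4]; apply: hd; lra.
Qed.

(* Both [growth_le] and [econt_ivt] look at the supremum of this set. *)
Lemma econt_sup a b f y : a <= b -> econt a b f -> f a <= y ->
  exists c, [/\ a <= c <= b, f c <= y &
    forall t, c < t <= b -> y < f t].
Proof.
move=> ab cf fa; pose S := [set t | a <= t <= b /\ f t <= y].
have Sa : S a by split=> //; lra.
have ubS : ubound S b by move=> t [/andP[]].
have hs : has_sup S by split; [exists a | exists b].
set c := sup S.
have ac : a <= c by apply: ub_le_sup => //; exists b.
have cb : c <= b by apply: ge_sup => //; exists a.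
exists c; split; first by rewrite ac.
  rewrite leNgt; apply/negP => yc.
  have [||d d0 hd] := cf c _ (f c - y); [by rewrite ac| by lra |].
  have [t [tab ft] ct] := sup_adherent d0 hs.
  have tc : t <= c by apply: ub_le_sup => //; exists b.
  have {}ct : `|t - c| < d by rewrite distrC ger0_norm; rewrite -/c in ct; lra.
  by have := hd t tab ct; rewrite ltr_norml => /andP[h1 h2]; lra.
move=> t /andP[ct tb]; rewrite ltNge; apply/negP => ft.
have : t <= c by apply: ub_le_sup; [exists b | split=> //; lra].
lra.
Qed.

Lemma econt_inf a b f y : a <= b -> econt a b f -> y <= f b ->
  exists c, [/\ a <= c <= b, y <= f c & forall t, a <= t < c -> f t < y].
Proof.
move=> ab cf fb; pose g t := - f (- t).
have [|||c [cab gc hc]] := @econt_sup (- b) (- a) g (- y).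
- lra.
- move=> t tab eta eta0; have [||d d0 hd] := cf (- t) _ eta => //; first by lra.
  exists d => // t' t'ab td; rewrite /g -opprD normrN; apply: hd; first by lra.
  by rewrite -opprD normrN.
- by rewrite /g opprK; lra.
exists (- c); rewrite /g in gc hc; split; [lra | lra |] => t tac.
by have := hc (- t) ltac:(lra); rewrite opprK; lra.
Qed.

(** A mean value inequality that needs, to the right of each point, only one point reached with
    slope at most [eta]. At the last point where [f t - eta * t] is at most its initial value, the
    hypothesis would yield a later one, unless that point is [b]. *)
Lemma growth_le a b eta f : a <= b -> econt a b f ->
  (forall t, a <= t < b -> exists2 t', t < t' <= b & f t' <= f t + eta * (t' - t)) ->
  f b <= f a + eta * (b - a).
Proof.
move=> ab cf h; pose g t := f t + - eta * t.
have cg : econt a b g.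
  apply: econtD => //; apply: (@econt_lip _ _ `|eta|) => // t t' _ _.
  by rewrite -mulrBr normrM normrN.
have [c [/andP[ac cb] gc hc]] := econt_sup ab cg (lexx (g a)).
have [e|ne] := eqVneq c b; first by move: gc; rewrite /g e; lra.
have [|t' /andP[ct tb] ft] := h c.
  by rewrite ac lt_neqAle ne.
have : g a < g t' by apply: hc; rewrite ct.
rewrite /g in gc *; lra.
Qed.

Lemma growth_ge a b eta f : a <= b -> econt a b f ->
  (forall t, a <= t < b -> exists2 t', t < t' <= b & f t + eta * (t' - t) <= f t') ->
  f a + eta * (b - a) <= f b.
Proof.
move=> ab cf h; suff : - f b <= - f a + - eta * (b - a) by lra.
apply: (@growth_le a b (- eta) (fun t => - f t)) => //; first exact: econtN.
by move=> t /h[t' tt' ft]; exists t' => //; lra.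
Qed.

Lemma econt_ivt a b f y : a <= b -> econt a b f -> f a <= y <= f b ->
  exists2 c, a <= c <= b & f c = y.
Proof.
move=> ab cf /andP[fa fb]; have [c [/andP[ac cb] fc hc]] := econt_sup ab cf fa.
exists c; rewrite ?ac //; apply/eqP; rewrite eq_le fc /= leNgt; apply/negP => yc.
have cb' : c < b by rewrite lt_neqAle cb andbT; apply: contraTneq fb => <-; rewrite -ltNge.
have [||d d0 hd] := cf c _ (y - f c); [by rewrite ac| by lra |].
pose t := Num.min b (c + d / 2).
have ct : c < t by rewrite lt_min cb' /=; lra.
have tb : t <= b by rewrite ge_min lexx.
have td : t <= c + d / 2 by rewrite ge_min lexx orbT.
have := hc t; rewrite ct tb => /(_ isT) yt.
have /hd : a <= t <= b by lra.
rewrite gtr0_norm; last by lra.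
move=> /(_ ltac:(lra)); rewrite ltr_norml => /andP[_]; lra.
Qed.

(* The supremum [M] of the excess over the chord satisfies [M <= M / 2], by
   midpoint convexity with respect to the nearer end point. *)
Lemma midconvex_chord s B f : 0 < s ->
  (forall t, 0 <= t <= s -> f t <= B) ->
  (forall x y, 0 <= x <= s -> 0 <= y <= s -> f ((x + y) / 2) <= (f x + f y) / 2) ->
  forall t, 0 <= t <= s -> f t <= f 0 + t / s * (f s - f 0).
Proof.
move=> s0 bf mf; pose g t := f t - (f 0 + t / s * (f s - f 0)).
have g0 : g 0 = 0 by rewrite /g mul0r mul0r addr0 subrr.
have gs : g s = 0 by rewrite /g divff ?gt_eqF //; ring.
have mg x y : 0 <= x <= s -> 0 <= y <= s -> g ((x + y) / 2) <= (g x + g y) / 2.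
  move=> hx hy; have := mf x y hx hy; rewrite /g !mulrDl; lra.
pose C := `|B| + `|f 0| + `|f s|.
have C0 : 0 <= C by rewrite !addr_ge0.
have bg k t : 0 <= t <= s -> g t <= 2 * C / 2 ^+ k.
  elim: k t => [|k IH] t ht.
    rewrite expr0 divr1 /g.
    have ts : 0 <= t / s <= 1.
      by rewrite divr_ge0 ?(ltW s0) //=; [rewrite ler_pdivrMr // mul1r|]; case/andP: ht.
    have := bf t ht; have := ler_norm B; have := ler_norm (- f 0); have := ler_norm (- f s).
    have := normr_ge0 (f s); have := normr_ge0 (f 0); have := normr_ge0 B.
    rewrite /C !normrN; move: ts; set r := t / s => /andP[r0 r1]; nra.
  have e : 2 * C / 2 ^+ k.+1 = (2 * C / 2 ^+ k) / 2.
    by rewrite exprS; field; rewrite expf_neq0 // pnatr_eq0.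
  rewrite e; have [ts|ts] := lerP t (s / 2).
    have := @mg 0 (2 * t); rewrite g0 add0r (_ : 2 * t / 2 = t); last by field.
    move=> /(_ ltac:(lra) ltac:(lra)); have := IH (2 * t) ltac:(lra); lra.
  have := @mg s (2 * t - s); rewrite gs add0r (_ : (s + (2 * t - s)) / 2 = t); last by field.
  move=> /(_ ltac:(lra) ltac:(lra)); have := IH (2 * t - s) ltac:(lra); lra.
move=> t ht; rewrite -subr_le0 -/(g t) leNgt; apply/negP => gt0.
have [k hk] : exists k : nat, 2 * C / g t < k%:R.
  by exists (Num.bound (2 * C / g t)); apply/archi_boundP; rewrite divr_ge0 ?mulr_ge0 // ltW.
have hk2 : k%:R <= 2 ^+ k :> R.
  by rewrite -natrX ler_nat ltnW // ltn_expl.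
have := bg k t ht; rewrite ler_pdivlMr ?exprn_gt0 //.
rewrite ltr_pdivrMr // in hk; nra.
Qed.

(* If [x |-> |x - phi|] maps the level set [f = y], a compact subinterval of
   [(0, b)], into itself for all [phi] near [psi > 0], then the level set is not
   bounded away from one of the ends. *)
Lemma level_shift_absurd b f y psi nu th1 : econt 0 b f ->
  (forall t t', 0 <= t -> t <= t' -> t' <= b -> f t <= f t') ->
  f 0 < y -> y < f b -> 0 <= th1 <= b -> f th1 = y -> 0 < psi <= b -> 0 < nu ->
  (forall th phi, 0 <= th <= b -> f th = y -> psi <= phi <= psi + nu ->
     `|th - phi| <= b -> f `|th - phi| = y) -> False.
Proof.
move=> cf fm f0 fb /andP[th10 th1b] fth1 /andP[psi0 psib] nu0 rule.
have cf1 : econt 0 th1 f by exact: econt_sub cf _ _.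
have cf2 : econt th1 b f by exact: econt_sub cf _ _.
have [|||a1 [/andP[a10 a1th] fa1 la1]] := @econt_inf 0 th1 f y => //; first by rewrite fth1.
have [|||a2 [/andP[tha2 a2b] fa2 ra2]] := @econt_sup th1 b f y => //; first by rewrite fth1.
have {}fa1 : f a1 = y by apply/eqP; rewrite eq_le fa1 andbT -fth1 fm.
have {}fa2 : f a2 = y by apply/eqP; rewrite eq_le fa2 -fth1 fm.
have a2b' : a2 < b by rewrite lt_neqAle a2b andbT; apply: contraTneq fb => <-; rewrite fa2 ltxx.
have a10' : 0 < a1 by rewrite lt_neqAle a10 andbT; apply: contraTneq f0 => ->; rewrite fa1 ltxx.
clear cf cf1 cf2 fb f0 fth1.
have psipsi : psi <= psi <= psi + nu by rewrite lexx lerDl ltW.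
have below t : 0 <= t -> t < a1 -> f t = y -> False.
  by move=> t0 ta /eqP; rewrite lt_eqF // la1 // t0.
have above t : a2 < t -> t <= b -> f t = y -> False.
  by move=> t0 ta /eqP; rewrite gt_eqF // ra2 // t0.
(* [a1] and [a2] are the ends of the level set. Every position of [psi] produces a point of the
   level set outside [[a1, a2]]: [a1 - psi], or 0, or a point above [a2] after two reflections. *)
have [c1|c1] := ltrP psi a1.
  have E : `|a1 - psi| = a1 - psi by rewrite gtr0_norm // subr_gt0.
  have := rule a1 psi; rewrite E => h; apply: (below (a1 - psi)); [lra|lra|].
  by apply: h => //; lra.
have [c2|c2] := lerP psi a2.
  have fpsi : f psi = y by apply/eqP; rewrite eq_le -{1}fa2 -fa1 !fm // ltW.
  have := rule psi psi; rewrite subrr normr0 => h; apply: (below 0) => //.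
  by apply: h => //; lra.
(* Reflecting [a2] with [psi] gives [psi - a2]; reflecting this with [psi + nu'] gives [a2 + nu'],
   which is still at most [b]. *)
have E : `|a2 - psi| = psi - a2 by rewrite distrC gtr0_norm // subr_gt0.
have fth2 : f (psi - a2) = y by rewrite -E; apply: rule => //; rewrite ?E; lra.
pose nu' := Num.min nu (b - a2).
have n1' : nu' <= nu by rewrite ge_min lexx.
have n2' : nu' <= b - a2 by rewrite ge_min lexx orbT.
have n0' : 0 < nu' by rewrite lt_min nu0 subr_gt0.
have E2 : `|psi - a2 - (psi + nu')| = a2 + nu' by rewrite distrC gtr0_norm; lra.
have := rule (psi - a2) (psi + nu'); rewrite E2 => h; apply: (above (a2 + nu')); [lra|lra|].
by apply: h => //; lra.
Qed.

End RealFunctions.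

Section RealFunctions2.
Variable R : realType.
Implicit Types (f g G : R -> R) (a b c s t x y : R).

(** A monotone function can only fail to be continuous by jumping. Approximate midpoint convexity
    around a point just to the right of an interior jump is violated, because one neighbour lies
    below the jump and the other is barely higher. At the two ends a jump is excluded by
    hypothesis. *)
Lemma approx_midconvex_cont b g : 0 < b ->
  (forall t t', 0 <= t -> t <= t' -> t' <= b -> g t <= g t') ->
  (forall eta, 0 < eta -> exists2 x0, 0 < x0 & forall x c, 0 < x < x0 -> x <= c <= b - x ->
     g c - eta <= (g (c + x) + g (c - x)) / 2) ->
  (forall eta, 0 < eta -> exists2 x, 0 < x <= b & g x - g 0 < eta) ->
  (forall eta, 0 < eta -> exists2 x, 0 < x <= b & g b - g (b - x) < eta) ->
  econt 0 b g.
Proof.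
move=> b0 gm gc gl gr.
have key c eta : 0 < c < b -> 0 < eta ->
    exists x, [/\ 0 < x, x <= c, c <= b - x & g (c + x) - g (c - x) < eta].
  move=> /andP[c0 cb] eta0; apply: contrapT => hno.
  have jump x : 0 < x -> x <= c -> c <= b - x -> eta <= g (c + x) - g (c - x).
    by move=> x0 xc cx; rewrite leNgt; apply/negP => h; apply: hno; exists x.
  pose S := [set g t | t in [set t | c < t <= b]].
  have hS : has_inf S.
    split; first by exists (g b), b => //=; rewrite cb lexx.
    by exists (g c) => _ [t /= /andP[ct tb] <-]; apply: gm => //; exact: ltW.
  have e8 : 0 < eta / 8 by rewrite divr_gt0.
  have [_ [t0 /= /andP[ct0 t0b] <-] gt0] := inf_adherent e8 hS.
  have infS t : c < t -> t <= b -> inf S <= g t.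
    by move=> ct tb; apply: ge_inf; [exact: hS.2 | exists t => //=; rewrite ct tb].
  have [x0 x00 hx0] := gc _ e8.
  pose y := Num.min (x0 / 4) (Num.min ((t0 - c) / 4) (c / 4)).
  have y1 : y <= x0 / 4 by rewrite ge_min lexx.
  have y2 : y <= (t0 - c) / 4 by rewrite !ge_min lexx orbT.
  have y3 : y <= c / 4 by rewrite !ge_min lexx !orbT.
  have y0 : 0 < y by rewrite !lt_min !divr_gt0 ?subr_gt0.
  (* The points [c - y], [c + y], [c + 3 * y] straddle the jump: the left value falls short of the
     middle one by [eta], the right one exceeds it by less than [eta / 8]. *)
  have := @hx0 (2 * y) (c + y) ltac:(clear -y0 y1 x00; lra) ltac:(clear -y0 y2 y3 t0b c0; lra).
  rewrite (_ : c + y + 2 * y = c + 3 * y); last by clear; ring.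
  rewrite (_ : c + y - 2 * y = c - y); last by clear; ring.
  have h1 := infS (c + y) ltac:(clear -y0; lra) ltac:(clear -y2 t0b y0; lra).
  have h2 : g (c + 3 * y) <= g t0 by apply: gm; clear -c0 y0 y2 t0b; lra.
  have h3 : g (c + y) <= g (c + 3 * y) by apply: gm; clear -c0 y0 y2 t0b; lra.
  have := @jump y y0 ltac:(clear -y0 y3; lra) ltac:(clear -y0 y2 t0b; lra).
  clear -h1 h2 h3 gt0 eta0; lra.
move=> c /andP[c0 cb] eta eta0.
have [e|ne] := eqVneq c 0.
  have [x /andP[x0 xb] hx] := gl _ eta0; exists x => // t' /andP[t0 tb]; rewrite e subr0 ger0_norm // => tx.
  rewrite ger0_norm; last by rewrite subr_ge0 gm.
  have : g t' <= g x by apply: gm => //; exact: ltW.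
  clear -hx; lra.
have [e|ne'] := eqVneq c b.
  have [x /andP[x0 xb] hx] := gr _ eta0; exists x => // t' /andP[t0 tb]; rewrite e distrC ger0_norm ?subr_ge0 // => tx.
  rewrite distrC ger0_norm; last by rewrite subr_ge0 gm.
  have : g (b - x) <= g t' by apply: gm; clear -xb tx tb; lra.
  clear -hx; lra.
have [|x [x0 xc cx hx]] := key c eta _ eta0.
  by rewrite !lt_neqAle eq_sym ne ne' c0.
exists x => // t' /andP[t0 tb]; rewrite ltr_norml => /andP[t1 t2].
have h1 : g (c - x) <= g t' by apply: gm; clear -xc t1 tb; lra.
have h2 : g t' <= g (c + x) by apply: gm; clear -t0 cx t2; lra.
have h3 : g (c - x) <= g c by apply: gm; clear -xc cb x0; lra.
have h4 : g c <= g (c + x) by apply: gm; clear -c0 cx x0; lra.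
rewrite ltr_norml; clear -h1 h2 h3 h4 hx; lra.
Qed.

(** Oddness about [pi / 2] gives the value 0 there; halving the angle determines [G] at all
    [pi / 2 / 2 ^ k], the sign of the root being known by monotonicity; the equation then propagates
    to multiples. Monotonicity squeezes [G] at the remaining angles between values of the cosine. *)
Lemma dalembert_cos G :
  (forall t t', 0 <= t -> t <= t' -> t' <= pi -> G t' <= G t) ->
  G 0 = 1 -> (forall t, 0 <= t <= pi -> G (pi - t) = - G t) ->
  (forall x t, 0 < x < pi / 2 -> x <= t <= pi - x -> G (t + x) + G (t - x) = 2 * G x * G t) ->
  forall t, 0 <= t <= pi -> G t = cos t.
Proof.
move=> Gm G0 Go GD; have p0 : 0 < (pi : R) := pi_gt0 R.
have Gh : G (pi / 2) = 0.
  by have := Go (pi / 2); rewrite (_ : pi - pi / 2 = pi / 2); [move=> /(_ ltac:(move: p0; clear; lra)); clear; lra | field].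
pose a k : R := pi / 2 / 2 ^+ k.
have a_gt0 k : 0 < a k by rewrite !divr_gt0 // exprn_gt0.
have aS k : 2 * a k.+1 = a k by rewrite /a exprS; field; rewrite expf_neq0 // pnatr_eq0.
have a_le k : a k <= pi / 2.
  by rewrite /a ler_pdivrMr ?exprn_gt0 // ler_peMr ?divr_ge0 ?pi_ge0 // exprn_ege1 // ler1n.
have Ga k : G (a k) = cos (a k).
  elim: k => [|k IH]; first by rewrite /a expr0 divr1 Gh cos_pihalf.
  have h1 := a_gt0 k.+1; have h2 := aS k; have h3 := a_le k.
  have h4 : a k.+1 < pi / 2 by clear -h1 h2 h3; lra.
  have := GD (a k.+1) (a k.+1); rewrite subrr G0 (_ : a k.+1 + a k.+1 = a k) ?IH; last by clear -h2; lra.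
  move=> /(_ ltac:(clear -h1 h4; lra) ltac:(clear -h1 h4; lra)).
  have -> : cos (a k) = 2 * cos (a k.+1) ^+ 2 - 1.
    by rewrite -h2 mulr_natl cos_mulr2n mulr_natl.
  move=> E.
  have g0 : 0 <= G (a k.+1) by rewrite -Gh; apply: Gm; clear -h1 h4 p0; lra.
  have c0 : 0 <= cos (a k.+1) by apply: cos_ge0_pihalf; clear -h1 h4 p0; lra.
  apply/eqP; rewrite -(@eqrXn2 _ 2) //; apply/eqP; move: E; rewrite expr2 mulr2n; clear; lra.
(* [0 < k] because the functional equation asks for a step strictly below [pi / 2]. *)
have Gja k j : (0 < k)%N -> j%:R * a k <= pi -> G (j%:R * a k) = cos (j%:R * a k).
  move=> k0; have h1 := a_gt0 k.
  have h4 : a k < pi / 2.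
    by case: k k0 h1 => // k _ h1; have := aS k; have := a_le k; clear -h1; lra.
  elim/ltn_ind: j => -[|[|j]] IH hj; first by rewrite mul0r G0 cos0.
    by rewrite mul1r Ga.
  have e1 : j.+2%:R * a k = j.+1%:R * a k + a k by rewrite -natr1 mulrDl mul1r.
  have e2 : j%:R * a k = j.+1%:R * a k - a k by rewrite -natr1 mulrDl mul1r addrK.
  have hj1 : a k <= j.+1%:R * a k by rewrite ler_peMl ?(ltW h1) // ler1n.
  have := GD (a k) (j.+1%:R * a k); rewrite -e1 -e2 h1 h4 hj1 => /(_ isT) /=.
  have ja i : (i <= j.+2)%N -> i%:R * a k <= pi.
    by move=> ij; apply: le_trans hj; rewrite ler_wpM2r ?(ltW h1) ?ler_nat.
  rewrite lerBrDr -e1 => /(_ hj); rewrite Ga (IH j) ?(IH j.+1) ?ja ?leqnSn ?(leqW (leqnSn j)) //.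
  rewrite e1 e2 cosB cosD; clear; lra.
move=> t /andP[t0 tpi]; have [->|tp] := eqVneq t pi.
  by have := Go 0; rewrite subr0 G0 cospi lexx pi_ge0 => ->.
have tpi' : t < pi by rewrite lt_neqAle tp.
suff h eta : 0 < eta -> `|G t - cos t| <= eta.
  apply/eqP; rewrite -subr_eq0 -normr_le0; apply/ler_addgt0Pr => eta /h; by rewrite add0r.
move=> eta0; have [|c c0 hc] := econt_continuous (a := 0) (b := pi) (@continuous_cos R) (_ : 0 <= t <= pi) eta0.
  by rewrite t0.
have [k k0 hk] : exists2 k, (0 < k)%N & a k < Num.min c (pi - t).
  pose M := Num.min c (pi - t); have M0 : 0 < M by rewrite lt_min c0 subr_gt0.
  exists (Num.bound (pi / 2 / M)).+1 => //.
  rewrite /a ltr_pdivrMr ?exprn_gt0 // -/M [M * _]mulrC -ltr_pdivrMr //.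
  have q0 : 0 <= pi / 2 / M by rewrite ltW // divr_gt0 // divr_gt0.
  apply: lt_le_trans (archi_boundP q0) _.
  by rewrite -natrX ler_nat (leq_trans (leqnSn _)) // ltnW // ltn_expl.
move: hk; rewrite lt_min => /andP[hk1 hk2].
have h1 := a_gt0 k; pose j := Num.truncn (t / a k).
have /andP[j1 j2] : j%:R <= t / a k < j.+1%:R.
  by apply: truncn_itv; rewrite divr_ge0 // ltW.
rewrite ler_pdivlMr // in j1; rewrite ltr_pdivrMr // in j2.
have e1 : j.+1%:R * a k = j%:R * a k + a k by rewrite -natr1 mulrDl mul1r.
have ja0 : 0 <= j%:R * a k by rewrite mulr_ge0 // ltW.
have G1 := Gm (j%:R * a k) t ja0 j1 tpi; have G2 := Gm t (j.+1%:R * a k) t0 (ltW j2).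
have jpi : j.+1%:R * a k <= pi by rewrite e1; clear -j1 hk2; lra.
rewrite Gja // in G1; last by apply: le_trans j1 tpi.
rewrite Gja // in G2; have {}G2 := G2 jpi.
have c1 : `|cos (j%:R * a k) - cos t| < eta.
  by apply: hc; [rewrite ja0 (le_trans j1) // ltW | rewrite distrC ger0_norm ?subr_ge0 // ; rewrite e1 in j2; clear -j2 hk1; lra].
have c2 : `|cos (j.+1%:R * a k) - cos t| < eta.
  apply: hc; first by rewrite jpi e1 addr_ge0 // ltW.
  by rewrite gtr0_norm ?subr_gt0 // e1; clear -j1 hk1; lra.
move: c1 c2; rewrite !ltr_norml ler_norml; clear -G1 G2; lra.
Qed.

End RealFunctions2.

(** * Isotropic exponential maps *)

(* All points share the same function [F]; it only depends on the angle and the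
   two radii.  [e p] is an exponential map at [p], but not necessarily the one
   given in an [exp_structure]. *)
Record isotropic_space (R : realType) (Y : metricType R) (n : nat) (rho : R)
    (F : R -> R -> R -> R) (e : Y -> 'rV[R]_n -> Y) : Prop := IsotropicSpace {
  iso_dist : forall p v w s t, esphere v -> esphere w -> 0 <= s < rho -> 0 <= t < rho ->
    mdist (e p (s *: v)) (e p (t *: w)) = F (angle v w) s t ;
  iso_center : forall p, e p 0 = p ;
  iso_onto : forall p y, mdist p y < rho -> exists2 v, esphere v & y = e p (mdist p y *: v) ;
  iso_mono : forall th1 th2 s t, 0 <= th1 -> th1 <= th2 -> th2 <= pi ->
    0 <= s < rho -> 0 <= t < rho -> F th1 s t <= F th2 s t ;
  iso_cont : forall s t, 0 <= s < rho -> 0 <= t < rho -> econt 0 pi (fun th => F th s t) ;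
  iso_F0 : forall s t, 0 <= s < rho -> 0 <= t < rho -> F 0 s t = `|s - t| ;
  iso_Fpi : forall s t, 0 <= s -> 0 <= t -> s + t < rho -> F pi s t = s + t ;
  iso_Fgt0 : forall th t, 0 < th <= pi -> 0 < t < rho -> 0 < F th t t
}.

Section Isotropic.
Variables (R : realType) (Y : metricType R) (n : nat) (rho : R).
Variables (F : R -> R -> R -> R) (e : Y -> 'rV[R]_n -> Y) (o : Y).
Hypotheses (H : isotropic_space rho F e) (n1 : (1 < n)%N).
Implicit Types (p q x y z m : Y) (u v w : 'rV[R]_n) (s t L : R).
Local Notation d := (@mdist R Y).

Local Ltac sclear := clear - R Y n rho F e o H n1.

Lemma iso_angles th : 0 <= th <= pi ->
  exists v w : 'rV[R]_n, [/\ esphere v, esphere w & angle v w = th].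
Proof.
move=> hth; have [v hv] := sphere_ex R (ltnW n1).
by have [w hw vw] := sphere_at_angle n1 hv hth; exists v, w.
Qed.

Lemma angle_itv v w : esphere v -> esphere w -> 0 <= angle v w <= pi.
Proof. by move=> hv hw; rewrite angle_ge0 // angle_lepi. Qed.

Lemma dist_center p v t : esphere v -> 0 <= t < rho -> d p (e p (t *: v)) = t.
Proof.
move=> hv ht; rewrite -{1}(iso_center H p) -(scale0r v) (iso_dist H) ?anglexx //; last by lra.
by rewrite (iso_F0 H) //; [rewrite sub0r normrN ger0_norm //; lra | lra].
Qed.

Lemma iso_Fsym th s t : 0 <= th <= pi -> 0 <= s < rho -> 0 <= t < rho -> F th s t = F th t s.
Proof.
move=> /iso_angles[v [w [hv hw <-]]] hs ht.
by rewrite -(iso_dist H o hv hw hs ht) metric_sym (iso_dist H) // angleC.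
Qed.

Lemma iso_Fge th s t : 0 <= th <= pi -> 0 <= s < rho -> 0 <= t < rho -> `|s - t| <= F th s t.
Proof.
by move=> hth hs ht; rewrite -(iso_F0 H hs ht); apply: (iso_mono H) => //; lra.
Qed.

Lemma iso_Fle th s t : 0 <= th <= pi -> 0 <= s < rho -> 0 <= t < rho -> F th s t <= s + t.
Proof.
move=> /iso_angles[v [w [hv hw <-]]] hs ht; rewrite -(iso_dist H o hv hw hs ht).
apply: le_trans (metric_triangle _ o _) _; rewrite (metric_sym _ o) !dist_center //.
Qed.

Lemma iso_Flip th s t t' : 0 <= th <= pi -> 0 <= s < rho -> 0 <= t < rho -> 0 <= t' < rho ->
  `|F th s t - F th s t'| <= `|t - t'|.
Proof.
move=> /iso_angles[v [w [hv hw <-]]] hs ht ht'.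
have E r : 0 <= r < rho -> F (angle v w) s r = d (e o (s *: v)) (e o (r *: w)).
  by move=> hr; rewrite (iso_dist H).
rewrite !E // -(iso_F0 H ht ht') -(anglexx hw) -(iso_dist H o hw hw ht ht').
rewrite ler_norml; apply/andP; split.
  have := metric_triangle (e o (s *: v)) (e o (t *: w)) (e o (t' *: w)); lra.
have := metric_triangle (e o (s *: v)) (e o (t' *: w)) (e o (t *: w)).
by rewrite (metric_sym (e o (t' *: w))); lra.
Qed.

Lemma iso_F_lt th1 th2 s t : 0 <= th1 <= pi -> 0 <= th2 <= pi -> 0 <= s < rho -> 0 <= t < rho ->
  F th1 s t < F th2 s t -> th1 < th2.
Proof.
move=> h1 h2 hs ht; rewrite !ltNge; apply: contra => h.
by apply: (iso_mono H) => //; lra.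
Qed.

Lemma dist_opp p v s t : esphere v -> 0 <= s -> 0 <= t -> s + t < rho ->
  d (e p (s *: v)) (e p (t *: - v)) = s + t.
Proof.
move=> hv s0 t0 st; rewrite (iso_dist H) ?angleN ?(iso_Fpi H) //; [exact: esphereN|lra|lra].
Qed.

Lemma iso_dir_inj p v w t : esphere v -> esphere w -> 0 < t < rho ->
  e p (t *: v) = e p (t *: w) -> v = w.
Proof.
move=> hv hw ht E; apply/eqP; apply: contra_eqT (mdistxx (e p (t *: v))) => vw.
rewrite {2}E (iso_dist H) //; [|lra|lra].
by rewrite gt_eqF // (iso_Fgt0 H) // angle_gt0 ?angle_lepi.
Qed.

Lemma iso_small_chord t eta : 0 <= t < rho -> 0 < eta ->
  exists2 k, 0 < k <= pi & F k t t < eta.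
Proof.
move=> ht eta0; have [|c c0 hc] := iso_cont H ht ht (_ : 0 <= 0 <= pi) eta0; first by rewrite lexx pi_ge0.
pose k := Num.min (c / 2) pi; have kc : k <= c / 2 by rewrite ge_min lexx.
have kpi : k <= pi by rewrite ge_min lexx orbT.
have k0 : 0 < k by rewrite lt_min pi_gt0 andbT; lra.
exists k; first by rewrite k0.
have := hc k ltac:(lra); rewrite subr0 gtr0_norm // => /(_ ltac:(lra)).
rewrite (iso_F0 H ht ht) subrr normr0 subr0; apply: le_lt_trans; exact: ler_norm.
Qed.

(* Suppose that [F th0 eps eps = 2 * eps]: geodesics branch at [o].  Seen from
   [x], the geodesics through [o] then end in a whole cap of directions. *)
Section Branching.
Variables (th0 eps : R) (e0 w0 : 'rV[R]_n).
Hypotheses (hth0 : 0 <= th0 < pi) (eps0 : 0 < eps) (eps_rho : 2 * eps < rho).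
Hypotheses (Fth0 : F th0 eps eps = 2 * eps) (he0 : esphere e0) (hw0 : esphere w0).
Let x := e o (eps *: e0).
Hypothesis oE : o = e x (eps *: w0).

Local Ltac bclear := clear - R Y n rho F e o H n1 th0 eps e0 w0 hth0 eps0 eps_rho Fth0 he0 hw0 x oE.

Lemma branching_eps : 0 <= eps < rho. Proof. by move: eps0 eps_rho; lra. Qed.
Lemma branching_2eps : 0 <= 2 * eps < rho. Proof. by move: eps0 eps_rho; lra. Qed.

(** From [th0] on, the function is squeezed between [F th0 eps eps] and the triangle bound, both
    equal to [2 * eps]. *)
Lemma branching_dist_add u : esphere u -> th0 <= angle e0 u -> d x (e o (eps *: u)) = 2 * eps.
Proof.
have he := branching_eps; have h2e := branching_2eps.
move=> hu hth; rewrite /x (iso_dist H) //; apply/eqP; rewrite eq_le; apply/andP; split.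
  by have := iso_Fle (angle_itv he0 hu) he he; bclear; lra.
rewrite -Fth0; apply: (iso_mono H) => //; [by case/andP: hth0|exact: angle_lepi].
Qed.

Lemma branching_dir u : esphere u -> th0 <= angle e0 u ->
  exists w, [/\ esphere w, e o (eps *: u) = e x ((2 * eps) *: w) & F (angle w0 w) eps (2 * eps) = eps].
Proof.
have he := branching_eps; have h2e := branching_2eps.
move=> hu hth; have dxy := branching_dist_add hu hth.
have [|w hw] := iso_onto H (p := x) (y := e o (eps *: u)); first by rewrite dxy.
rewrite dxy => E; exists w; split=> //.
by rewrite -(iso_dist H x hw0 hw) // -oE -E dist_center.
Qed.

(** The strict inequalities leave room for a whole neighbourhood of directions. The end opposite to
    [x] is seen from [x] in a direction [w1]. If [w1] is [w0], any other end of the cap is seen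
    under a larger angle [b]. Otherwise [w1] is turned slightly toward [w0]: the new point is still
    at distance [eps] from [o], because [F] is squeezed there, and close to the opposite end. *)
Lemma branching_cap_interior : exists u' w' b,
  [/\ esphere u', esphere w', e o (eps *: u') = e x ((2 * eps) *: w') &
  [/\ th0 < angle e0 u', angle w0 w' < b, b <= pi & F b eps (2 * eps) = eps]].
Proof.
have he := branching_eps; have h2e := branching_2eps.
have he0N := esphereN he0; case/andP: hth0 => th00 th0pi.
have th0N : th0 <= angle e0 (- e0) by rewrite angleN // ltW.
have [w1 [hw1 y1E Fw1]] := branching_dir he0N th0N.
have [a0|a0] := eqVneq (angle w0 w1) 0.
  have [|u hu uth] := sphere_at_angle n1 he0 (t := th0); first by rewrite th00 ltW.
  have [|w [hw wE Fw]] := branching_dir hu; first by rewrite uth.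
  exists (- e0), w1, (angle w0 w); split=> //; split=> //.
  - by rewrite angleN.
  - rewrite a0; apply: angle_gt0 => //; apply/negP => /eqP w0w.
    have w01 : w0 = w1 by exact: angle_eq0.
    have /(iso_dir_inj hu he0N) E : e o (eps *: u) = e o (eps *: - e0).
      by rewrite wE y1E -w0w w01.
    have {}E : u = - e0 by apply: E; rewrite eps0; case/andP: he.
    by move: th0pi; rewrite -uth E angleN // ltxx.
  - exact: angle_lepi.
have b0 : 0 < angle w0 w1 by rewrite lt_neqAle eq_sym a0 angle_ge0.
have := angle_itv hw0 hw1; set b := angle w0 w1 in a0 b0 Fw1 * => /andP[_ bpi].
have pth : 0 <= pi - th0 <= pi by rewrite subr_ge0 (ltW th0pi) gerBl.
have [|k1 /andP[k10 k1pi] Fk1] := iso_small_chord h2e (eta := F (pi - th0) eps eps).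
  by apply: (iso_Fgt0 H); rewrite ?subr_gt0 ?th0pi ?gerBl ?eps0 //; case/andP: he.
pose k := Num.min k1 (b / 2).
have kk1 : k <= k1 by rewrite ge_min lexx.
have kb : k <= b / 2 by rewrite ge_min lexx orbT.
have k0 : 0 < k by rewrite lt_min k10 divr_gt0.
have bk : 0 <= b - k <= b by move: k0 kb; bclear; lra.
have [f [hf w0f w1E]] := great_circle n1 hw0 hw1; rewrite -/b in w1E.
pose w' := gcircle w0 f (b - k).
have hw' : esphere w' by exact: gcircle_sphere.
have w0w' : angle w0 w' = b - k.
  have E : `|0 - (b - k)| = b - k by rewrite sub0r normrN ger0_norm //; case/andP: bk.
  by rewrite -{1}(gcircle0 w0 f) angle_gcircle // E //; move: bk bpi; bclear; lra.
have w'w1 : angle w' w1 = k.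
  have E : `|b - k - b| = k by rewrite distrC gtr0_norm; move: k0; bclear; lra.
  by rewrite w1E angle_gcircle // E // (le_trans kk1).
have doy : d o (e x ((2 * eps) *: w')) = eps.
  rewrite {1}oE (iso_dist H) // w0w'; apply/eqP; rewrite eq_le; apply/andP; split.
    by rewrite -[leRHS]Fw1; apply: (iso_mono H) => //; case/andP: bk.
  have bkpi : 0 <= b - k <= pi by move: bk bpi; bclear; lra.
  have := iso_Fge bkpi he h2e; rewrite distrC gtr0_norm; move: eps0; bclear; lra.
have [|u' hu'] := iso_onto H (p := o) (y := e x ((2 * eps) *: w')).
  by rewrite doy; case/andP: he.
rewrite doy => u'E; exists u', w', b; split=> //; split=> //; last first.
  by rewrite w0w'; move: k0; bclear; lra.
have : F (angle u' (- e0)) eps eps < F (pi - th0) eps eps.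
  rewrite -(iso_dist H o) // -u'E y1E (iso_dist H) // w'w1; apply: le_lt_trans Fk1.
  by apply: (iso_mono H) => //; exact: ltW.
move/iso_F_lt => /(_ (angle_itv hu' he0N) pth he he).
rewrite angleNr // angleC; bclear; lra.
Qed.

Lemma branching_sphere_overlap : exists u' k nu, [/\ esphere u', 0 < angle e0 u', 0 < k <= pi, 0 < nu &
  forall wp u, esphere wp -> angle w0 wp <= k -> esphere u -> angle u u' <= nu ->
    d (e x (eps *: wp)) (e o (eps *: u)) = eps].
Proof.
have he := branching_eps; have h2e := branching_2eps.
have [u' [w' [b [hu' hw' hE [hu'th w'b hb Fb]]]]] := branching_cap_interior.
pose k := (b - angle w0 w') / 3; have /andP[hwb _] := angle_itv hw0 hw'.
have k0 : 0 < k by rewrite /k; move: w'b; bclear; lra.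
have kpi : k <= pi by rewrite /k; have := pi_ge0 R; move: hb hwb; bclear; lra.
have [|nu1 /andP[nu10 nu1pi] Fnu1] := iso_small_chord he (eta := F k (2 * eps) (2 * eps)).
  by apply: (iso_Fgt0 H); rewrite ?k0 //; move: eps0 eps_rho; bclear; lra.
pose nu := Num.min nu1 (angle e0 u' - th0).
have nn1 : nu <= nu1 by rewrite ge_min lexx.
have nu2 : nu <= angle e0 u' - th0 by rewrite ge_min lexx orbT.
exists u', k, nu; split=> //.
- by apply: le_lt_trans hu'th; case/andP: hth0.
- by rewrite k0.
- by rewrite lt_min nu10 subr_gt0.
move=> wp u hwp wpk hu uu'.
have tri := angle_triangle he0 hu hu'.
have [|w [hw wE Fw]] := branching_dir hu; first by move: tri uu' nu2; bclear; lra.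
have ww' : angle w w' < k.
  apply: (@iso_F_lt _ _ (2 * eps) (2 * eps)) => //; [exact: angle_itv|by rewrite ltW|].
  rewrite -(iso_dist H x) // -wE -hE (iso_dist H) //; apply: le_lt_trans Fnu1.
  by apply: (iso_mono H) => //; [exact: angle_ge0|exact: le_trans uu' nn1].
have wpw : angle wp w <= b.
  have := angle_triangle (v := w0) hwp hw0 hw; rewrite (angleC wp w0).
  have := angle_triangle (v := w') hw0 hw' hw; rewrite (angleC w' w).
  by move: wpk ww' w'b; rewrite /k; bclear; lra.
rewrite wE (iso_dist H) //; apply/eqP; rewrite eq_le; apply/andP; split.
  by rewrite -[leRHS]Fb; apply: (iso_mono H) => //; exact: angle_ge0.
have := iso_Fge (angle_itv hwp hw) he h2e.
by rewrite distrC gtr0_norm; move: eps0; bclear; lra.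
Qed.

(** [level_shift_absurd] is applied to the angles [th] for which a point at distance [tau] from [o]
    is at distance [eps] from [x]. As [tau] is small, such a point is seen from [x] in a direction
    close to [w0], so it is at distance [eps] from all ends in directions near [u']. On the great
    circle through [e0] and [u'] this makes [|th - phi|] an angle of the same kind, for all [phi]
    slightly above the angle of [u']. *)
Lemma branching_absurd : False.
Proof.
have he := branching_eps; have h2e := branching_2eps.
have [u' [k [nu [hu' psi0 /andP[k0 kpi] nu0 star]]]] := branching_sphere_overlap.
case/andP: (he) => he1 he2.
have eta0 : 0 < F k eps eps by apply: (iso_Fgt0 H); rewrite ?k0 ?eps0.
have [|k1 /andP[k10 k1pi]] := iso_small_chord he (eta := Num.min (F k eps eps) eps).
  by rewrite lt_min eta0.
rewrite lt_min => /andP[Fk1 Fk1e].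
pose tau := F k1 eps eps; have tau0 : 0 < tau by apply: (iso_Fgt0 H); rewrite ?k10 ?eps0.
rewrite -/tau in Fk1 Fk1e.
have ht : 0 <= tau < rho by rewrite (ltW tau0) (lt_trans Fk1e).
have [|wp hwp wpE] := sphere_at_angle n1 hw0 (t := k1); first by rewrite (ltW k10).
have dop : d o (e x (eps *: wp)) = tau by rewrite {1}oE (iso_dist H) // wpE.
have [|q1 hq1] := iso_onto H (p := o) (y := e x (eps *: wp)).
  by rewrite dop; case/andP: ht.
rewrite dop => q1E; have hth1 := angle_itv hq1 he0.
have fth1 : F (angle q1 e0) tau eps = eps.
  by rewrite -(iso_dist H o) // -q1E -/x metric_sym dist_center.
have [g [hg e0g u'E]] := great_circle n1 he0 hu'.
have /andP[_ psipi] := angle_itv he0 hu'.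
apply: (@level_shift_absurd _ pi (fun th => F th tau eps) eps (angle e0 u') nu (angle q1 e0)) => //.
- exact: (iso_cont H).
- by move=> *; apply: (iso_mono H).
- by rewrite (iso_F0 H) // distrC gtr0_norm; move: tau0 Fk1e; bclear; lra.
- by rewrite (iso_Fpi H) //; [move: tau0; bclear; lra|exact: ltW|move: eps_rho; move: Fk1e; bclear; lra].
- by rewrite psi0.
move=> th phi /andP[th0' thpi] fth hphi thphi; pose u := gcircle e0 g phi; pose q := gcircle e0 g th.
have hu : esphere u by exact: gcircle_sphere.
have hq : esphere q by exact: gcircle_sphere.
have qe0 : angle q e0 = th.
  by rewrite -{1}(gcircle0 e0 g) angle_gcircle // subr0 ger0_norm.
have dxp : d x (e o (tau *: q)) = eps by rewrite metric_sym /x (iso_dist H) // qe0.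
have [|wq hwq] := iso_onto H (p := x) (y := e o (tau *: q)); first by rewrite dxp.
rewrite dxp => wqE.
have wqk : angle w0 wq <= k.
  apply/ltW/(@iso_F_lt _ _ eps eps) => //; [exact: angle_itv|by rewrite (ltW k0)|].
  by rewrite -(iso_dist H x) // -oE -wqE dist_center.
have uu' : angle u u' <= nu.
  have [nupi|nupi] := lerP pi nu; first by apply: le_trans nupi; exact: angle_lepi.
  have E : `|phi - angle e0 u'| = phi - angle e0 u' by rewrite ger0_norm // subr_ge0; case/andP: hphi.
  by rewrite {1}u'E angle_gcircle // E; move: hphi nupi; bclear; lra.
have := star wq u hwq wqk hu uu'.
by rewrite -wqE (iso_dist H) // angle_gcircle.
Qed.

End Branching.

Lemma nonbranching_diag th t : 0 <= th < pi -> 0 < t -> 2 * t < rho -> F th t t < 2 * t.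
Proof.
move=> hth t0 t2; have ht : 0 <= t < rho by lra.
have hth' : 0 <= th <= pi by move: hth; sclear; lra.
have := iso_Fle hth' ht ht; rewrite le_eqVlt => /orP[/eqP E|]; last by sclear; lra.
have [e0 he0] := sphere_ex R (ltnW n1).
have dxo : d (e o (t *: e0)) o = t by rewrite metric_sym dist_center.
have [|w0 hw0] := iso_onto H (p := e o (t *: e0)) (y := o); first by rewrite dxo; case/andP: ht.
rewrite dxo => oE; exfalso; apply: (branching_absurd hth t0 t2 _ he0 hw0 oE).
by rewrite E; sclear; ring.
Qed.

(** The longer side is cut down to the length of the shorter one, at the cost of the difference of
    the lengths. *)
Lemma nonbranching th s t : 0 <= th < pi -> 0 < s -> 0 < t -> s + t < rho -> F th s t < s + t.
Proof.
move=> hth s0 t0 st; have hth' : 0 <= th <= pi by move: hth; sclear; lra.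
wlog : s t s0 t0 st / s <= t => [hw|le_st].
  have [|/ltW ts] := lerP s t; first exact: hw.
  by rewrite iso_Fsym // 1?[s + t]addrC; [apply: hw => //; rewrite addrC| |]; move: s0 t0 st; sclear; lra.
have hs : 0 <= s < rho by move: s0 t0 st; sclear; lra.
have ht : 0 <= t < rho by move: s0 t0 st; sclear; lra.
have := nonbranching_diag hth s0 ltac:(move: s0 st le_st; sclear; lra).
have := iso_Flip hth' hs ht hs; rewrite (ger0_norm (_ : 0 <= t - s)) ?subr_ge0 // ler_norml.
sclear; lra.
Qed.

Lemma nonbranching_pi th s t : 0 <= th <= pi -> 0 < s -> 0 < t -> s + t < rho ->
  F th s t = s + t -> th = pi.
Proof.
move=> /andP[th0 thpi] s0 t0 st E; apply/eqP; rewrite eq_le thpi leNgt; apply/negP => h.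
by have := @nonbranching th s t; rewrite th0 h E ltxx => /(_ isT s0 t0 st).
Qed.

Lemma dist_add x m y : 0 < d x m -> 0 < d m y -> d x m + d m y < rho -> d x y = d x m + d m y ->
  exists2 u, esphere u & x = e m (d x m *: u) /\ y = e m (d m y *: - u).
Proof.
move=> xm my xmy E; have dmx : d m x = d x m by rewrite metric_sym.
have [|u hu] := iso_onto H (p := m) (y := x); first by rewrite dmx; move: xmy my; sclear; lra.
have [|v hv] := iso_onto H (p := m) (y := y); first by move: xmy xm; sclear; lra.
rewrite dmx => yE xE; exists u => //; split=> //.
have uv : angle u v = pi.
  apply: (@nonbranching_pi _ (d x m) (d m y)) => //; first exact: angle_itv.
  by rewrite -(iso_dist H m) // -?xE -?yE //; move: xm my xmy; sclear; lra.
by rewrite -(angle_eqpi hu hv uv).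
Qed.

(** Geodesics extend uniquely. In the case of equality the point [z] at distance [s] lies between
    [o] and two points at distance [t] from [o]; both are seen from [z] opposite to [o], so they
    coincide, and with them the directions at [o]. *)
Lemma iso_F_gt_sub th s t : 0 < th <= pi -> 0 < s -> 0 < t -> s < rho -> t < rho -> `|s - t| < F th s t.
Proof.
move=> hth s0 t0 sr tr; have hth' : 0 <= th <= pi by move: hth; sclear; lra.
wlog : s t s0 t0 sr tr / s <= t => [hw|].
  have [|/ltW ts] := leP s t; first exact: hw.
  by rewrite distrC iso_Fsym ?(ltW s0) ?(ltW t0) //; exact: hw.
have hs : 0 <= s < rho by rewrite (ltW s0).
have ht : 0 <= t < rho by rewrite (ltW t0).
rewrite le_eqVlt => /orP[/eqP <-|st].
  by rewrite subrr normr0 (iso_Fgt0 H) // s0.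
rewrite lt_neqAle iso_Fge // andbT distrC gtr0_norm ?subr_gt0 //; apply/eqP => E.
have [v [w [hv hw vw]]] := iso_angles hth'.
pose z := e o (s *: w); have doz : d o z = s by rewrite dist_center.
have zy u : esphere u -> d z (e o (t *: u)) = t - s ->
    exists2 a, esphere a & o = e z (s *: a) /\ e o (t *: u) = e z ((t - s) *: - a).
  move=> hu zu; have [] := @dist_add o z (e o (t *: u)); rewrite ?doz ?zu ?subr_gt0 //.
  - by rewrite addrC subrK.
  - by rewrite addrC subrK dist_center.
  by move=> a ha h; exists a.
have [|a1 ha1 [oE1 yE1]] := zy w hw.
  by rewrite (iso_dist H) // anglexx // (iso_F0 H) // distrC gtr0_norm ?subr_gt0.
have [|a2 ha2 [oE2 yE2]] := zy v hv.
  by rewrite (iso_dist H) // angleC vw.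
have a12 : a1 = a2 by apply: (@iso_dir_inj z _ _ s ha1 ha2); rewrite ?s0 // -oE1.
have : v = w by apply: (@iso_dir_inj o _ _ t hv hw); rewrite ?t0 // yE1 yE2 a12.
by move=> vw'; move: hth; rewrite -vw vw' anglexx // ltxx.
Qed.

End Isotropic.

(** * Convexity of the distance and the first variation formula *)

Section FirstVariation.
Variables (R : realType) (Y : metricType R) (n : nat) (rho : R).
Variables (F : R -> R -> R -> R) (e : Y -> 'rV[R]_n -> Y) (o : Y).
Hypotheses (H : isotropic_space rho F e) (n1 : (1 < n)%N).
Implicit Types (p q x y z m : Y) (u v w : 'rV[R]_n) (s t L : R).
Local Notation d := (@mdist R Y).
Local Notation Fle := (iso_Fle o H n1).
Local Notation Flip := (iso_Flip o H n1).
Local Notation Fsym := (iso_Fsym o H n1).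
Local Ltac sclear := clear - R Y n rho F e o H n1.

Lemma itv_opp (th : R) : 0 <= th <= pi -> 0 <= pi - th <= pi.
Proof. by case/andP => a b; rewrite subr_ge0 b gerBl. Qed.

Lemma dist_ray p v s t : esphere v -> 0 <= s < rho -> 0 <= t < rho ->
  d (e p (s *: v)) (e p (t *: v)) = `|s - t|.
Proof. by move=> hv hs ht; rewrite (iso_dist H) // anglexx // (iso_F0 H). Qed.

Lemma two_sided p v s t : esphere v -> 0 < s -> 0 < t -> s + t < rho ->
  d (e p (s *: - v)) (e p (t *: v)) = s + t.
Proof.
by move=> hv s0 t0 st; rewrite metric_sym (dist_opp H) 1?addrC // ltW.
Qed.

Lemma mid_unique x m y s w : esphere w -> y = e x ((2 * s) *: w) -> 0 < s -> 2 * s < rho ->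
  d x m = s -> d m y = s -> m = e x (s *: w).
Proof.
move=> hw yE s0 s2 xm my; have [|u hu mE] := iso_onto H (p := x) (y := m).
  by rewrite xm; move: s0 s2; sclear; lra.
rewrite xm in mE; suff uw : u = w by rewrite mE uw.
apply/eqP; apply: contra_eqT my => uw; rewrite yE mE (iso_dist H) //.
- rewrite gt_eqF //; apply: le_lt_trans (_ : `|s - 2 * s| < _).
    by rewrite distrC gtr0_norm; move: s0; sclear; lra.
  apply: (iso_F_gt_sub o H n1); [|move: s0 s2; sclear; lra..].
  by rewrite angle_gt0 // angle_lepi.
- by move: s0 s2; sclear; lra.
- by move: s0 s2; sclear; lra.
Qed.

Lemma between_unique x m y s t u : esphere u -> y = e x ((s + t) *: u) -> 0 < s -> 0 < t ->
  s + t < rho -> d x m = s -> d m y = t -> m = e x (s *: u).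
Proof.
move=> hu yE s0 t0 st xm my; have [|w hw mE] := iso_onto H (p := x) (y := m).
  by rewrite xm; move: s0 t0 st; sclear; lra.
rewrite xm in mE; suff uw : w = u by rewrite mE uw.
apply/eqP; apply: contra_eqT my => uw; rewrite yE mE (iso_dist H) //.
- rewrite gt_eqF //; apply: le_lt_trans (_ : `|s - (s + t)| < _).
    by rewrite distrC gtr0_norm; move: t0; sclear; lra.
  apply: (iso_F_gt_sub o H n1); [|move: s0 t0 st; sclear; lra..].
  by rewrite angle_gt0 // angle_lepi.
- by move: s0 t0 st; sclear; lra.
- by move: s0 t0 st; sclear; lra.
Qed.

(* Triangle inequality through [y] for [q] and a point antipodal to it. *)
Lemma iso_F_add_opp th L L' s : 0 <= th <= pi -> 0 <= L -> 0 <= L' -> L + L' < rho ->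
  0 <= s < rho -> L + L' <= F th L s + F (pi - th) L' s.
Proof.
move=> hth L0 L'0 LL hs; have [v [w [hv hw vw]]] := iso_angles n1 hth.
have hL : 0 <= L < rho by move: L0 L'0 LL; sclear; lra.
have hL' : 0 <= L' < rho by move: L0 L'0 LL; sclear; lra.
rewrite -(dist_opp H o hv L0 L'0 LL); apply: le_trans (metric_triangle _ (e o (s *: w)) _) _.
have hvN := esphereN hv.
by rewrite (metric_sym (e o (s *: w))) !(iso_dist H) // angleNl // vw.
Qed.

(** By isotropy at [m], the distance from [q] to [y] is that from [x] to the point opposite to [q],
    which is at distance [2 * d m q] from [q]. The claim is the triangle inequality through [x]. *)
Lemma dist_mid_le q x m y s : d x m = s -> d m y = s -> d x y = 2 * s -> 2 * s < rho ->
  2 * d m q < rho -> 2 * d m q <= d q x + d q y.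
Proof.
move=> xm my xy s2 mq; have [s0|s0] := leP s 0.
  have E z z' : d z z' = s -> z = z'.
    move=> zz; apply: (@mdist_positivity R Y); apply/eqP.
    by rewrite eq_le mdist_ge0 andbT zz.
  by rewrite -(E x m) // -(E x y) ?xm // ?(E m y my) ?(metric_sym q) ?(E x m xm) // mulr2n mulrDl mul1r.
have [||||u hu [xE yE]] := @dist_add _ _ _ _ _ _ o H n1 x m y; rewrite ?xm ?my //.
- by move: s2; sclear; lra.
- by rewrite xy mulr2n mulrDl mul1r.
rewrite xm in xE; rewrite my in yE.
have mq0 : 0 <= d m q := mdist_ge0 _ _.
have hmq : 0 <= d m q < rho by move: mq mq0; sclear; lra.
have hs : 0 <= s < rho by move: s0 s2; sclear; lra.
have [|w hw qE] := iso_onto H (p := m) (y := q); first by case/andP: hmq.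
have huN := esphereN hu.
have E1 : d q x = F (angle w u) (d m q) s by rewrite {1}qE xE (iso_dist H).
have E2 : d q y = F (pi - angle w u) (d m q) s by rewrite {1}qE yE (iso_dist H) // angleNr.
rewrite E1 E2.
have := @iso_F_add_opp (angle w u) (d m q) (d m q) s (angle_itv hw hu) mq0 mq0 _ hs.
have -> : d m q + d m q = 2 * d m q by ring.
by move=> h; exact: h.
Qed.

Local Notation r1 := (rho / 8).

(** Midpoint convexity along the ray gives the chord inequality on [[0, s']]. The bound [rho / 8]
    keeps twice every distance involved below [rho]. *)
Lemma iso_F_convex th L s s' : 0 <= th <= pi -> 0 <= L < r1 -> 0 < s -> s <= s' -> s' < r1 ->
  s' * (F th L s - L) <= s * (F th L s' - L).
Proof.
move=> hth hL s0 ss' s'r; have [v [w [hv hw vw]]] := iso_angles n1 hth.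
have rho0 : 0 < rho by move: hL; sclear; lra.
have hLr : 0 <= L < rho by move: hL rho0; sclear; lra.
pose f t := d (e o (L *: v)) (e o (t *: w)).
have ht t : 0 <= t <= s' -> 0 <= t < rho by move: s'r rho0; sclear; lra.
have fE t : 0 <= t <= s' -> f t = F th L t by move=> /ht ht'; rewrite /f (iso_dist H) // vw.
have f0 : f 0 = L.
  by rewrite /f scale0r (iso_center H) metric_sym (dist_center H).
have s'0 : 0 < s' by exact: lt_le_trans ss'.
have := @midconvex_chord R s' (L + s') f s'0 _ _ s; rewrite f0 !fE ?lexx ?(ltW s0) ?(ltW s'0) ?ss' //.
move=> h; have {h} : F th L s <= L + s / s' * (F th L s' - L).
  apply: h => //.
  - move=> t hts; rewrite fE //; apply: le_trans (Fle hth hLr (ht _ hts)) _.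
    by rewrite lerD2l; case/andP: hts.
  move=> x y hx hy; have hm : 0 <= (x + y) / 2 <= s' by move: hx hy; sclear; lra.
  have E : d (e o (((x + y) / 2) *: w)) (e o (L *: v)) = f ((x + y) / 2) by rewrite metric_sym.
  have := @dist_mid_le (e o (L *: v)) (e o (x *: w)) (e o (((x + y) / 2) *: w)) (e o (y *: w)) (`|x - y| / 2).
  rewrite !dist_ray ?ht // E -/(f x) -/(f y) => h.
  have {h}: 2 * f ((x + y) / 2) <= f x + f y.
    have E1 : x - (x + y) / 2 = (x - y) / 2 by field.
    have E2 : (x + y) / 2 - y = (x - y) / 2 by field.
    have E3 : `|(x - y) / 2| = `|x - y| / 2 by rewrite normrM [`|2^-1|]ger0_norm // invr_ge0.
    apply: h; rewrite ?E1 ?E2 ?E3 //; first by sclear; lra.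
      suff : `|x - y| <= s' by move: s'r rho0; sclear; lra.
      by rewrite ler_norml; move: hx hy; sclear; lra.
    rewrite fE //; have := Fle hth hLr (ht _ hm); move: hm hL s'r rho0; sclear; lra.
  by sclear; lra.
have : 0 < s' by exact: lt_le_trans ss'.
move=> s'_gt0; rewrite -lerBlDl mulrAC ler_pdivlMr //; by rewrite [X in X <= _]mulrC.
Qed.

Definition quot th L s := (F th L s - L) / s.

Lemma quotE th L s : s != 0 -> F th L s = L + s * quot th L s.
Proof. by move=> s0; rewrite /quot; field. Qed.

Lemma quot_mono_s th L s s' : 0 <= th <= pi -> 0 <= L < r1 -> 0 < s -> s <= s' -> s' < r1 ->
  quot th L s <= quot th L s'.
Proof.
move=> hth hL s0 ss' s'r; have s'0 : 0 < s' by exact: lt_le_trans ss'.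
rewrite /quot ler_pdivrMr // mulrAC ler_pdivlMr // mulrC [leRHS]mulrC.
exact: iso_F_convex.
Qed.

Lemma r1_lt L : 0 <= L < r1 -> 0 <= L < rho.
Proof. by sclear; lra. Qed.

Lemma quot_mono_th th th' L s : 0 <= th -> th <= th' -> th' <= pi -> 0 <= L < r1 -> 0 < s < r1 ->
  quot th L s <= quot th' L s.
Proof.
move=> h1 h2 h3 hL /andP[s0 sr]; rewrite /quot ler_pM2r ?invr_gt0 // lerD2r.
by apply: (iso_mono H) => //; apply: r1_lt; rewrite // (ltW s0).
Qed.

(** The point at distance [L'] lies on the ray to the point at distance [L], so the triangle
    inequality applies. This allows slopes belonging to different base points to be compared. *)
Lemma quot_anti_L th L L' s : 0 <= th <= pi -> 0 <= L' -> L' <= L -> L < r1 -> 0 < s < r1 ->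
  quot th L s <= quot th L' s.
Proof.
move=> hth L'0 LL Lr /andP[s0 sr]; rewrite /quot ler_pM2r ?invr_gt0 //.
have [v [w [hv hw vw]]] := iso_angles n1 hth.
have hL : 0 <= L < rho by apply: r1_lt; rewrite Lr (le_trans L'0).
have hL' : 0 <= L' < rho by apply: r1_lt; rewrite L'0 (le_lt_trans LL).
have hs : 0 <= s < rho by apply: r1_lt; rewrite (ltW s0).
have := metric_triangle (e o (L *: v)) (e o (L' *: v)) (e o (s *: w)).
rewrite !(iso_dist H) // anglexx // (iso_F0 H) // vw ger0_norm ?subr_ge0 //; sclear; lra.
Qed.

Lemma quot_bound th L s : 0 <= th <= pi -> 0 <= L < r1 -> 0 < s < r1 -> -1 <= quot th L s <= 1.
Proof.
move=> hth hL /andP[s0 sr]; have hs : 0 <= s < rho by apply: r1_lt; rewrite (ltW s0).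
rewrite /quot ler_pdivlMr // ler_pdivrMr //.
have := Fle hth (r1_lt hL) hs; have := iso_Fge H hth (r1_lt hL) hs.
by rewrite ler_norml; sclear; lra.
Qed.

Lemma quot_opp_ge0 th L s : 0 <= th <= pi -> 0 <= L < r1 -> 0 < s < r1 ->
  0 <= quot th L s + quot (pi - th) L s.
Proof.
move=> hth hL /andP[s0 sr]; rewrite /quot -mulrDl divr_ge0 ?(ltW s0) //.
have [L0 Lr] := andP hL; have := @iso_F_add_opp th L L s hth L0 L0.
move=> /(_ ltac:(move: hL; sclear; lra) ltac:(apply: r1_lt; rewrite (ltW s0) sr; exact: isT)); sclear; lra.
Qed.

(** The right derivative of [F th L] at 0: the quotients increase with [s], so their infimum is
    their limit, and it exists without any differentiability. *)
Definition slope th L := inf [set quot th L s | s in [set s | 0 < s < r1]].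

Section Slope.
Variable L : R.
Hypothesis hL : 0 < L < r1.

Lemma ltr_r1 : 0 <= L < r1.
Proof. by case/andP: hL => /ltW -> ->. Qed.

Lemma slope_has_inf th : 0 <= th <= pi -> has_inf [set quot th L s | s in [set s | 0 < s < r1]].
Proof.
move=> hth; split; first by exists (quot th L L), L.
by exists (-1) => _ [s /= hs <-]; have /andP[] := quot_bound hth ltr_r1 hs.
Qed.

Lemma slope_le th s : 0 <= th <= pi -> 0 < s < r1 -> slope th L <= quot th L s.
Proof. by move=> hth hs; apply: ge_inf; [exact: (slope_has_inf hth).2 | exists s]. Qed.

Lemma slope_lim th eta : 0 <= th <= pi -> 0 < eta ->
  exists2 s0, 0 < s0 < r1 & forall s, 0 < s <= s0 -> quot th L s < slope th L + eta.
Proof.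
move=> hth eta0; have [_ [s0 /= hs0 <-] h] := inf_adherent eta0 (slope_has_inf hth).
exists s0 => // s /andP[s_gt0 ss0]; apply: le_lt_trans h.
by case/andP: hs0 => _ sr; apply: quot_mono_s => //; exact: ltr_r1.
Qed.

Lemma slope_ge th b : 0 <= th <= pi -> (forall s, 0 < s < r1 -> b <= quot th L s) -> b <= slope th L.
Proof.
move=> hth h; apply: lb_le_inf; first by have [] := slope_has_inf hth.
by move=> _ [s /= hs <-]; exact: h.
Qed.

Lemma slope_bound th : 0 <= th <= pi -> -1 <= slope th L <= 1.
Proof.
move=> hth; apply/andP; split.
  by apply: slope_ge => // s /(quot_bound hth ltr_r1) /andP[].
apply: le_trans (slope_le hth hL) _.
by have /andP[] := quot_bound hth ltr_r1 hL.
Qed.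

Lemma slope_mono th th' : 0 <= th -> th <= th' -> th' <= pi -> slope th L <= slope th' L.
Proof.
move=> h1 h2 h3; apply: slope_ge => [|s hs]; first by rewrite h3 (le_trans h1).
apply: le_trans (slope_le _ hs) (quot_mono_th h1 h2 h3 ltr_r1 hs).
by rewrite h1 (le_trans h2).
Qed.

Lemma slope_opp_ge0 th : 0 <= th <= pi -> 0 <= slope th L + slope (pi - th) L.
Proof.
move=> hth; rewrite -lerBlDr sub0r; apply: slope_ge => // s hs.
rewrite lerNl; apply: slope_ge; first exact: itv_opp.
move=> s' hs'; pose m := Num.min s s'.
have ms : m <= s by rewrite ge_min lexx.
have ms' : m <= s' by rewrite ge_min lexx orbT.
have m0 : 0 < m by rewrite lt_min; case/andP: hs => ->; case/andP: hs' => ->.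
have mr : m < r1 by apply: le_lt_trans ms _; case/andP: hs.
have := @quot_opp_ge0 th L m hth ltr_r1; rewrite m0 mr => /(_ isT).
have := @quot_mono_s th L m s hth ltr_r1 m0 ms; have := @quot_mono_s (pi - th) L m s' (itv_opp hth) ltr_r1 m0 ms'.
case/andP: hs => _ ->; case/andP: hs' => _ -> => /(_ isT) h1 /(_ isT) h2 h3.
by move: h1 h2 h3; sclear; lra.
Qed.

Lemma slope0 : slope 0 L = -1.
Proof.
have h0 : 0 <= (0 : R) <= pi by rewrite lexx pi_ge0.
apply/eqP; rewrite eq_le; apply/andP; split; last by have /andP[] := slope_bound h0.
apply: le_trans (slope_le h0 hL) _; rewrite /quot (iso_F0 H) ?(r1_lt ltr_r1) //.
rewrite subrr normr0 sub0r mulNr divff //; case/andP: hL => L0 _; by rewrite gt_eqF.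
Qed.

Lemma slopepi : slope pi L = 1.
Proof.
have hp : 0 <= (pi : R) <= pi by rewrite lexx pi_ge0.
apply/eqP; rewrite eq_le; apply/andP; split; first by have /andP[] := slope_bound hp.
have := slope_opp_ge0 hp; rewrite subrr slope0; sclear; lra.
Qed.

End Slope.

Lemma slope_anti th L L' : 0 <= th <= pi -> 0 < L' -> L' <= L -> L < r1 -> slope th L <= slope th L'.
Proof.
move=> hth L'0 LL Lr; have hL : 0 < L < r1 by rewrite Lr (lt_le_trans L'0).
have hL' : 0 < L' < r1 by rewrite L'0 (le_lt_trans LL).
apply: slope_ge => // s hs; apply: le_trans (slope_le hL hth hs) _.
by apply: quot_anti_L => //; exact: ltW.
Qed.

End FirstVariation.

(** * The slope of the distance is minus the cosine of the angle *)

Section SlopeIsCos.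
Variables (R : realType) (Y : metricType R) (n : nat) (rho : R).
Variables (F : R -> R -> R -> R) (e : Y -> 'rV[R]_n -> Y) (o : Y).
Hypotheses (H : isotropic_space rho F e) (n1 : (1 < n)%N).
Implicit Types (p q m : Y) (u v w : 'rV[R]_n) (s t L : R).
Local Notation d := (@mdist R Y).
Local Notation Fle := (iso_Fle o H n1).
Local Notation Flip := (iso_Flip o H n1).
Local Notation Fsym := (iso_Fsym o H n1).
Local Notation r1 := (rho / 8).
Local Notation quot := (quot F).
Local Notation slope := (slope rho F).
Local Ltac sclear := clear - R Y n rho F e o H n1.

(* [N = e o (h *: b)] is the midpoint of two points at distance [eps] from [o]
   whose directions make the angle [x] with [b]. *)
Lemma bisector_mid (x eps : R) : 0 < x < pi / 2 -> 0 < eps < r1 ->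
  exists h, [/\ 0 < h <= eps,
    forall th L, x <= th <= pi - x -> 0 < L < r1 ->
      2 * F th L h <= F (th + x) L eps + F (th - x) L eps,
    forall L, 0 < L < r1 -> F 0 L h <= F x L eps &
    forall L, 0 < L < r1 -> F pi L h <= F (pi - x) L eps].
Proof.
move=> /andP[x0 xpi] /andP[eps0 epsr].
have rho0 : 0 < rho by move: eps0 epsr; sclear; lra.
have he : 0 <= eps < rho by move: eps0 epsr; sclear; lra.
have p0 := pi_gt0 R.
have [b hb] := sphere_ex R (ltnW n1); have [f hf bf] := sphere_perp n1 hb.
pose u1 := gcircle b f x; pose u2 := gcircle b f (- x).
have hu1 : esphere u1 by exact: gcircle_sphere.
have hu2 : esphere u2 by exact: gcircle_sphere.
have hbN := esphereN hb.
have bu1 : angle b u1 = x.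
  have E : `|0 - x| = x by rewrite sub0r normrN gtr0_norm.
  by rewrite -{1}(gcircle0 b f) angle_gcircle // E //; move: xpi x0; sclear; lra.
have bu2 : angle b u2 = x.
  have E : `|0 - - x| = x by rewrite opprK add0r gtr0_norm.
  by rewrite -{1}(gcircle0 b f) angle_gcircle // E //; move: xpi x0; sclear; lra.
have u12 : angle u1 u2 = 2 * x.
  have E : `|x - - x| = 2 * x by rewrite opprK gtr0_norm; move: x0; sclear; lra.
  by rewrite angle_gcircle // E //; move: xpi; sclear; lra.
pose y1 := e o (eps *: u1); pose y2 := e o (eps *: u2).
have dy : d y1 y2 = F (2 * x) eps eps by rewrite (iso_dist H) // u12.
pose s := d y1 y2 / 2; have dy2 : d y1 y2 = 2 * s by rewrite /s; field.
have h2x : 0 <= 2 * x <= pi by move: x0 xpi; sclear; lra.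
have s0 : 0 < s.
  by rewrite divr_gt0 // dy (iso_Fgt0 H) ?eps0; [|move: x0 xpi; sclear; lra|case/andP: he].
have se : 2 * s < 2 * eps.
  have -> : 2 * eps = eps + eps by ring.
  rewrite -dy2 dy; apply: (nonbranching o H n1) => //.
  - by move: x0 xpi; sclear; lra.
  - by move: epsr eps0 rho0; sclear; lra.
have [|w hw y2E] := iso_onto H (p := y1) (y := y2).
  by rewrite dy2; move: se epsr rho0; sclear; lra.
rewrite dy2 in y2E; pose N := e y1 (s *: w).
have hs : 0 <= s < rho by move: s0 se epsr rho0; sclear; lra.
have h2s : 0 <= 2 * s < rho by move: s0 se epsr rho0; sclear; lra.
have N1 : d y1 N = s by rewrite (dist_center H).
have N2 : d N y2 = s.
  by rewrite y2E (dist_ray H) // distrC gtr0_norm; move: s0; sclear; lra.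
have uniq m : d y1 m = s -> d m y2 = s -> m = N.
  by move=> *; apply: (mid_unique o H n1 hw y2E) => //; case/andP: h2s.
have midq q : 2 * d N q < rho -> 2 * d N q <= d q y1 + d q y2.
  by apply: (dist_mid_le o H n1 N1 N2 dy2); case/andP: h2s.
have oy1 : d o y1 = eps by rewrite (dist_center H).
have oy2 : d o y2 = eps by rewrite (dist_center H).
pose h := d o N; have h_le : h <= eps.
  have : d N o <= s + eps by rewrite -N1 -oy1 (metric_sym N) addrC; exact: metric_triangle.
  move=> No; have := midq o; rewrite oy1 oy2 => hh.
  rewrite /h metric_sym; have {hh} : 2 * d N o <= eps + eps.
    by apply: hh; move: No se epsr rho0; sclear; lra.
  by sclear; lra.
have h_gt0 : 0 < h.
  rewrite mdist_gt0; apply/eqP => oN.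
  by move: oy1 se; rewrite oN metric_sym N1 => ->; rewrite ltxx.
have [|w' hw'] := iso_onto H (p := o) (y := N); first by apply: le_lt_trans h_le _; case/andP: he.
rewrite -/h => NE.
have hh : 0 <= h < rho by rewrite (ltW h_gt0); apply: le_lt_trans h_le _; case/andP: he.
(* The half-turn about [b] exchanges [u1] and [u2]. By isotropy it maps the direction of the
   midpoint to that of a midpoint, which is unique; so this direction is [b] or [- b]. *)
pose A := line_refl b; have hA : esphere (A w') by exact: line_refl_sphere.
have A1 : A u1 = u2 by exact: line_refl_gcircle.
have A2 : A u2 = u1 by rewrite -A1; exact: line_reflK.
have E1 : F (angle w' u1) h eps = s by rewrite -(iso_dist H o) // -NE metric_sym.
have E2 : F (angle w' u2) h eps = s by rewrite -(iso_dist H o) // -NE.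
have NA : e o (h *: A w') = N.
  apply: uniq.
    by rewrite metric_sym (iso_dist H) // -A2 angle_line_refl.
  by rewrite (iso_dist H) // -A1 angle_line_refl.
have Aw' : A w' = w'.
  by apply: (iso_dir_inj H (p := o) (t := h)); rewrite ?h_gt0 ?NA //; case/andP: hh.
have w'b : w' = b.
  have [//|w'b] := line_refl_fix hb hw' Aw'; exfalso.
  (* If the direction were [- b], the point at distance [h] in the direction [b] would be at least
     as close to both ends, hence a midpoint as well. *)
  have Fx : F x h eps <= s.
    rewrite -E1 w'b angleNl // bu1; apply: (iso_mono H) => //; try exact: ltW.
      by move: x0 xpi; sclear; lra.
    by rewrite gerBl ltW.
  have d1 : d y1 (e o (h *: b)) <= s by rewrite metric_sym (iso_dist H) // bu1.
  have d2 : d (e o (h *: b)) y2 <= s by rewrite (iso_dist H) // bu2.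
  have tri := metric_triangle y1 (e o (h *: b)) y2.
  have Nb : e o (h *: b) = N by apply: uniq; move: d1 d2 tri; rewrite dy2; sclear; lra.
  have E : b = - b.
    apply: (iso_dir_inj H (p := o) (t := h)) => //; last by rewrite Nb NE w'b.
    by rewrite h_gt0; case/andP: hh.
  by have := angleN hb; rewrite -E anglexx // => /eqP; rewrite lt_eqF.
rewrite w'b in NE.
have key L v : 0 < L < r1 -> esphere v ->
    2 * F (angle v b) L h <= F (angle v u1) L eps + F (angle v u2) L eps.
  move=> hL hv; have hLr : 0 <= L < rho by move: hL rho0; sclear; lra.
  have E : d (e o (L *: v)) N = F (angle v b) L h by rewrite NE (iso_dist H).
  have := midq (e o (L *: v)); rewrite (metric_sym N) E !(iso_dist H) // => hq; apply: hq.
  have := Fle (angle_itv hv hb) hLr hh; move: h_le epsr hL rho0; sclear; lra.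
exists h; split; first by rewrite h_gt0.
- move=> th L hth hL; pose v := gcircle b f (- th).
  have hv : esphere v by exact: gcircle_sphere.
  have := key L v hL hv.
  have -> : angle v b = th.
    have E : `|- th - 0| = th by rewrite subr0 normrN ger0_norm //; move: hth x0; sclear; lra.
    by rewrite -[X in angle _ X](gcircle0 b f) angle_gcircle // E //; move: hth x0; sclear; lra.
  have -> : angle v u1 = th + x.
    have E : `|- th - x| = th + x by rewrite -opprD normrN ger0_norm //; move: hth x0; sclear; lra.
    by rewrite angle_gcircle // E //; move: hth; sclear; lra.
  have -> : angle v u2 = th - x.
    have E : `|- th - - x| = th - x by rewrite -opprD normrN ger0_norm //; move: hth; sclear; lra.
    by rewrite angle_gcircle // E //; move: hth x0; sclear; lra.
  by [].
- by move=> L hL; have := key L b hL hb; rewrite anglexx // bu1 bu2; sclear; lra.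
- move=> L hL; have := key L (- b) hL hbN.
  by rewrite !angleNl // anglexx // bu1 bu2 subr0; sclear; lra.
Qed.

Section FixedRadius.
Variable L : R.
Hypothesis hL : 0 < L < r1.
Local Notation g := (fun th => slope th L).
Local Ltac tclear := clear - R Y n rho F e o H n1 L hL.

Lemma half_pi_itv (x th : R) : 0 < x < pi / 2 -> x <= th <= pi - x ->
  [/\ 0 <= x <= pi, 0 <= th <= pi, 0 <= th + x <= pi & 0 <= th - x <= pi].
Proof. by tclear; move=> *; split; lra. Qed.

Lemma quot_itv_self : 0 <= L < r1.
Proof. by case/andP: hL => /ltW -> ->. Qed.

(** The bisector inequality divided by [eps]. The triangle inequality gives
    [h >= - eps * quot x L L], so replacing [h] by [eps] costs at most [1 + quot x L L], which tends
    to 0 with [x]. *)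
Lemma slope_approx_midconvex x th : 0 < x < pi / 2 -> x <= th <= pi - x ->
  g th - (1 + quot x L L) <= (g (th + x) + g (th - x)) / 2.
Proof.
move=> hx hth; have [hx' hth' hp hm] := half_pi_itv hx hth.
have hL' := quot_itv_self.
apply/ler_addgt0Pr => eta eta0.
have [s1 hs1 h1] := slope_lim o H n1 hL hp eta0.
have [s2 hs2 h2] := slope_lim o H n1 hL hm eta0.
pose eps := Num.min L (Num.min s1 s2).
have eL : eps <= L by rewrite ge_min lexx.
have es1 : eps <= s1 by rewrite !ge_min lexx orbT.
have es2 : eps <= s2 by rewrite !ge_min lexx !orbT.
have eps0 : 0 < eps.
  by rewrite !lt_min; case/andP: hL => -> _; case/andP: hs1 => -> _; case/andP: hs2.
have er : eps < r1 by apply: le_lt_trans eL _; case/andP: hL.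
have [|h [/andP[h0 he] hbis h0L _]] := @bisector_mid x eps hx; first by rewrite eps0.
have Q1 := h1 eps ltac:(by rewrite eps0); have Q2 := h2 eps ltac:(by rewrite eps0).
have hh : 0 < h < r1 by rewrite h0 (le_lt_trans he).
have gh := slope_le o H n1 hL hth' hh.
have Qx : quot x L eps <= quot x L L.
  by apply: (quot_mono_s o H n1) => //; case/andP: hL.
have := hbis th L hth hL; have := h0L L hL.
have hLr := r1_lt hL'; have hhr : 0 <= h < rho by apply: r1_lt; rewrite (ltW h0); case/andP: hh.
rewrite (iso_F0 H) // => hl; have {hl} : L - h <= F x L eps by apply: le_trans hl; exact: ler_norm.
rewrite !(@quotE _ F _ L eps) ?gt_eqF // (@quotE _ F _ L h) ?gt_eqF // => hl hb.
have /andP[gb1 gb2] := slope_bound o H n1 hL hth'.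
set q := quot x L L in Qx *; set qe := quot x L eps in Qx hl.
have hq : eps * (- q) <= h by move: hl (ler_wpM2l (ltW eps0) Qx); tclear; lra.
have hg : h * slope th L <= h * quot th L h by rewrite ler_wpM2l // ltW.
have a1 : eps * quot (th + x) L eps <= eps * (slope (th + x) L + eta) by rewrite ler_wpM2l // ltW.
have a2 : eps * quot (th - x) L eps <= eps * (slope (th - x) L + eta) by rewrite ler_wpM2l // ltW.
have a3 : (eps - h) * slope th L <= (eps - h) * 1 by rewrite ler_wpM2l // subr_ge0.
rewrite -(ler_pM2l eps0); move: hq hg a1 a2 a3 hb; tclear; lra.
Qed.

Lemma quot_small eta : 0 < eta -> exists2 x0, 0 < x0 <= pi & forall x, 0 <= x <= x0 -> 1 + quot x L L < eta.
Proof.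
move=> eta0; have L0 : 0 < L by case/andP: hL.
have [k hk Fk] := iso_small_chord H (r1_lt quot_itv_self) (mulr_gt0 L0 eta0).
exists k => // x /andP[x0 xk]; have hLr := r1_lt quot_itv_self.
have : F x L L <= F k L L by apply: (iso_mono H) => //; case/andP: hk.
move=> Fx; have -> : 1 + quot x L L = F x L L / L by rewrite /quot; field; rewrite gt_eqF.
by rewrite ltr_pdivrMr // mulrC; apply: le_lt_trans Fx _.
Qed.

Lemma slope_cont : econt 0 pi g.
Proof.
have p0 := pi_gt0 R; have L0 : 0 < L by case/andP: hL.
apply: approx_midconvex_cont => //.
- by move=> *; apply: (slope_mono o H n1).
- move=> eta eta0; have [k hk hq] := quot_small eta0.
  exists (Num.min k (pi / 2)); first by rewrite lt_min divr_gt0 // andbT; case/andP: hk.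
  move=> x c /andP[x0]; rewrite lt_min => /andP[xk xpi] hc.
  have := @slope_approx_midconvex x c; rewrite x0 xpi => /(_ isT hc).
  have := hq x ltac:(by rewrite !ltW); move: hk; tclear; lra.
- move=> eta eta0; have [k hk hq] := quot_small eta0; exists k => //.
  have hk' : 0 <= k <= pi by case/andP: hk => /ltW -> ->.
  rewrite (slope0 o H n1 hL); have := slope_le o H n1 hL hk' hL.
  have := hq k ltac:(rewrite lexx andbT; case/andP: hk'; done); tclear; lra.
- move=> eta eta0; have [k hk hq] := quot_small eta0; exists k => //.
  have hk' : 0 <= k <= pi by case/andP: hk => /ltW -> ->.
  rewrite (slopepi o H n1 hL); have := slope_le o H n1 hL hk' hL.
  have := slope_opp_ge0 o H n1 hL hk'.
  have := hq k ltac:(rewrite lexx andbT; case/andP: hk'; done); tclear; lra.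
Qed.

Lemma slope_ivt th c : 0 <= th <= pi -> -1 <= c <= g th -> exists2 th', 0 <= th' <= th & g th' = c.
Proof.
move=> /andP[th0 thpi] /andP[c1 cth]; apply: econt_ivt => //.
  by apply: econt_sub slope_cont _ _.
by rewrite (slope0 o H n1 hL) c1.
Qed.

(* The distance to [q] has no kink along a geodesic leaving [o]: otherwise an
   angle [th'] separating the two one-sided slopes would bound the directions
   to [q] just before [o], hence also at [o]. *)
Lemma slope_no_kink th : 0 <= th <= pi -> g (pi - th) < 0 -> g th <= - g (pi - th).
Proof.
move=> hth gm; rewrite leNgt; apply/negP => gp.
have hL' := quot_itv_self; have L0 : 0 < L by case/andP: hL.
have Lr : L < r1 by case/andP: hL.
have rho0 : 0 < rho by move: L0 Lr; tclear; lra.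
pose c := (g th - g (pi - th)) / 2.
have hthN := itv_opp hth.
have /andP[b1 b2] := slope_bound o H n1 hL hthN.
have cdm : - g (pi - th) < c by move: gp; rewrite /c; tclear; lra.
have cdp : c < g th by move: gp; rewrite /c; tclear; lra.
have [|th' /andP[th'0 th'th] gth'] := @slope_ivt th c hth.
  by rewrite (ltW cdp) andbT; move: cdm gm; tclear; lra.
have hth' : 0 <= th' <= pi by rewrite th'0; apply: le_trans th'th _; case/andP: hth.
suff key s : 0 < s < r1 -> F th L s <= F th' L s.
  move: cdp; rewrite -gth' ltNge => /negP; apply; apply: (slope_ge o H n1 hL) => // s hs.
  apply: le_trans (slope_le o H n1 hL hth hs) _; rewrite /quot ler_pM2r ?lerD2r ?key //.
  by rewrite invr_gt0; case/andP: hs.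
move=> /andP[s0 sr].
have e3 : 0 < - g (pi - th) by rewrite oppr_gt0.
have [t1 /andP[t10 t1r] ht1] := slope_lim o H n1 hL hthN e3.
apply/ler_addgt0Pr => eta eta0.
pose t := Num.min (Num.min t1 (L / 2)) (eta / 2).
have tt1 : t <= t1 by rewrite !ge_min lexx.
have tL : t <= L / 2 by rewrite !ge_min lexx orbT.
have teta : t <= eta / 2 by rewrite !ge_min lexx !orbT.
have t0 : 0 < t by rewrite !lt_min t10 !divr_gt0.
have tr : t < r1 by apply: le_lt_trans tt1 _.
have [w [u [hw hu wu]]] := iso_angles n1 hth; have huN := esphereN hu.
have hLr := r1_lt hL'; have htr : 0 <= t < rho by apply: r1_lt; rewrite (ltW t0).
have hsr : 0 <= s < rho by apply: r1_lt; rewrite (ltW s0).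
pose q := e o (L *: w); pose z := e o (t *: - u); pose y := e o (s *: u).
pose Lt := d q z.
have LtE : Lt = F (pi - th) L t by rewrite /Lt (iso_dist H) // angleNr // wu.
have qt : quot (pi - th) L t < 0 by have := ht1 t; rewrite t0 tt1 subrr => /(_ isT).
have LtL : Lt < L.
  by rewrite LtE (@quotE _ F _ L t) ?gt_eqF // gtrDl pmulr_rlt0.
have Lt0 : 0 < Lt.
  have := iso_Fge H hthN hLr htr; rewrite -LtE ger0_norm; move: tL L0; tclear; lra.
have hLt : 0 < Lt < r1 by rewrite Lt0 (lt_trans LtL).
have ts0 : 0 < t + s by exact: addr_gt0.
have hts : 0 <= t + s < rho by move: tr sr t0 s0 rho0; tclear; lra.
have dzy : d z y = t + s by apply: (two_sided H) => //; case/andP: hts.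
have [|u' hu'] := iso_onto H (p := z) (y := y); first by rewrite dzy; case/andP: hts.
rewrite dzy => yE.
have dzo : d z o = t by rewrite metric_sym (dist_center H).
have doy : d o y = s by rewrite (dist_center H).
have oE : o = e z (t *: u').
  by apply: (between_unique o H n1 hu' yE) => //; case/andP: hts.
have [|w' hw'] := iso_onto H (p := z) (y := q).
  by rewrite metric_sym -/Lt; apply: lt_trans LtL _; case/andP: hLr.
rewrite (metric_sym z) -/Lt => qE.
have hLtr : 0 <= Lt < rho by rewrite (ltW Lt0) (lt_trans LtL) //; case/andP: hLr.
pose G := angle w' u'; have hG : 0 <= G <= pi by exact: angle_itv.
have FG : F G Lt t = L.
  by rewrite -(iso_dist H z) // -qE -oE metric_sym (dist_center H).
(* Seen from [z], just before [o], the quotient at [o] is [(L - Lt) / t = - quot (pi - th) L t]. It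
   dominates the slope at distance [Lt], which dominates the slope at the larger distance [L]. *)
have gG : g G < g th'.
  apply: le_lt_trans (_ : - g (pi - th) < _); last by rewrite gth'.
  apply: le_trans (_ : slope G Lt <= _).
    by apply: (slope_anti o H n1) => //; exact: ltW.
  apply: le_trans (slope_le o H n1 hLt hG _ : _ <= quot G Lt t) _; first by rewrite t0.
  apply: le_trans (_ : - quot (pi - th) L t <= _).
    by rewrite /quot FG -LtE -mulNr opprB.
  by rewrite lerN2; apply: (slope_le o H n1 hL) => //; rewrite t0.
have Gth' : G <= th'.
  rewrite leNgt; apply/negP => h; move: gG; rewrite ltNge => /negP; apply.
  by apply: (slope_mono o H n1 hL) => //; [exact: ltW|case/andP: hG].
have <- : d q y = F th L s by rewrite (iso_dist H) // wu.
(* Seen from [z], the angle between [q] and [y] is [G], at most [th']. Replacing [Lt] by [L] and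
   [t + s] by [s] costs at most [t] each, hence the choice of [eta / 2] as a bound for [t]. *)
have -> : d q y = F G Lt (t + s).
  by rewrite {1}qE {1}yE (iso_dist H).
apply: le_trans (_ : F th' Lt (t + s) <= _).
  by apply: (iso_mono H) => //; [case/andP: hG|case/andP: hth'].
have a1 := Flip hth' hLtr hts hsr.
have a2 := Flip hth' hsr hLtr hLr.
have Ltlow : L - t <= Lt.
  by have := iso_Fge H hthN hLr htr; rewrite -LtE ger0_norm //; move: tL L0; tclear; lra.
move: a1 a2; rewrite (Fsym hth' hsr hLtr) (Fsym hth' hsr hLr).
have -> : t + s - s = t by ring.
rewrite (gtr0_norm t0) [`|Lt - L|]distrC (gtr0_norm (_ : 0 < L - Lt)) ?subr_gt0 //.
by rewrite !ler_norml; move: Ltlow teta; tclear; lra.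
Qed.

(** Convexity gives one inequality and the absence of kinks the other, as soon as one of the two
    slopes is negative. If neither is, the intermediate value theorem provides a smaller angle of
    slope [- eta], and monotonicity transfers the bound. *)
Lemma slope_opp th : 0 <= th <= pi -> g (pi - th) = - g th.
Proof.
move=> hth; have hthN := itv_opp hth.
have hK t : pi - (pi - t) = t :> R by ring.
have nonneg t : 0 <= t <= pi -> 0 <= g t -> 0 <= g (pi - t) -> g (pi - t) <= 0.
  move=> ht g1 g2; apply/ler_addgt0Pr => eta eta0; rewrite add0r.
  have /andP[_ b2] := slope_bound o H n1 hL (itv_opp ht).
  have [e1|e1] := leP 1 eta; first exact: le_trans e1.
  have [|t' /andP[t'0 t't] gt'] := @slope_ivt t (- eta) ht.
    by move: e1 g1 eta0; tclear; lra.
  have ht' : 0 <= t' <= pi by rewrite t'0; apply: le_trans t't _; case/andP: ht.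
  have := slope_no_kink (itv_opp ht'); rewrite hK gt' opprK oppr_lt0 => /(_ eta0).
  apply: le_trans; apply: (slope_mono o H n1 hL); last by case/andP: (itv_opp ht').
    by case/andP: (itv_opp ht).
  by rewrite lerD2l lerN2.
apply/eqP; rewrite eq_le; apply/andP; split; last first.
  by have := slope_opp_ge0 o H n1 hL hth; tclear; lra.
have [g1|g1] := ltP (g th) 0.
  by have := slope_no_kink hthN; rewrite hK; apply.
have [g2|g2] := ltP (g (pi - th)) 0.
  by have := slope_no_kink hth g2; tclear; lra.
have := nonneg _ hth g1 g2; have := nonneg _ hthN g2; rewrite hK => /(_ g1).
by move: g1 g2; tclear; lra.
Qed.

(** The bisector inequality in the limit. Now that opposite slopes are opposite, the bounds for [h]
    coming from angles [x] and [pi - x] agree to first order, so that [h / eps] tends to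
    [- slope x L]. *)
Lemma slope_dalembert_le x th : 0 < x < pi / 2 -> x <= th <= pi - x ->
  - g x * g th <= (g (th + x) + g (th - x)) / 2.
Proof.
move=> hx hth; have [hx' hth' hp hm] := half_pi_itv hx hth.
have hL' := quot_itv_self; have hLr := r1_lt hL'.
apply/ler_addgt0Pr => eta0' eta00; pose eta := eta0' / 2; have eta0 : 0 < eta by rewrite divr_gt0.
have hxN := itv_opp hx'.
have [s1 hs1 h1] := slope_lim o H n1 hL hp eta0.
have [s2 hs2 h2] := slope_lim o H n1 hL hm eta0.
have [s3 hs3 h3] := slope_lim o H n1 hL hx' eta0.
have [s4 hs4 h4] := slope_lim o H n1 hL hxN eta0.
pose eps := Num.min (Num.min L (Num.min s1 s2)) (Num.min s3 s4).
have eL : eps <= L by rewrite !ge_min lexx.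
have es1 : eps <= s1 by rewrite !ge_min lexx ?orbT.
have es2 : eps <= s2 by rewrite !ge_min lexx ?orbT.
have es3 : eps <= s3 by rewrite !ge_min lexx ?orbT.
have es4 : eps <= s4 by rewrite !ge_min lexx ?orbT.
have eps0 : 0 < eps.
  rewrite !lt_min; case/andP: hL => -> _; case/andP: hs1 => -> _; case/andP: hs2 => -> _.
  by case/andP: hs3 => -> _; case/andP: hs4 => -> _.
have er : eps < r1 by apply: le_lt_trans eL _; case/andP: hL.
have [|h [/andP[h0 he] hbis h0L hpL]] := @bisector_mid x eps hx; first by rewrite eps0.
have Q1 := h1 eps ltac:(by rewrite eps0); have Q2 := h2 eps ltac:(by rewrite eps0).
have Q3 := h3 eps ltac:(by rewrite eps0); have Q4 := h4 eps ltac:(by rewrite eps0).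
have hh : 0 < h < r1 by rewrite h0 (le_lt_trans he).
have gh := slope_le o H n1 hL hth' hh.
have hhr : 0 <= h < rho by apply: r1_lt; rewrite (ltW h0); case/andP: hh.
have hb := hbis th L hth hL.
have hl : L - h <= F x L eps.
  by apply: le_trans (h0L L hL); rewrite (iso_F0 H) // ler_norm.
have hu : L + h <= F (pi - x) L eps.
  apply: le_trans (hpL L hL); rewrite (iso_Fpi H) //; [by case/andP: hL'|exact: ltW|].
  by move: hL' hh; tclear; lra.
rewrite !(@quotE _ F _ L eps) ?gt_eqF // (@quotE _ F _ L h) ?gt_eqF // in hb hl hu.
rewrite (slope_opp hx') in Q4.
have /andP[gb1 gb2] := slope_bound o H n1 hL hth'.
have a1 : eps * quot (th + x) L eps <= eps * (slope (th + x) L + eta) by rewrite ler_wpM2l // ltW.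
have a2 : eps * quot (th - x) L eps <= eps * (slope (th - x) L + eta) by rewrite ler_wpM2l // ltW.
have a3 : eps * quot x L eps <= eps * (slope x L + eta) by rewrite ler_wpM2l // ltW.
have a4 : eps * quot (pi - x) L eps <= eps * (- slope x L + eta) by rewrite ler_wpM2l // ltW.
have hg : h * slope th L <= h * quot th L h by rewrite ler_wpM2l // ltW.
have close : `|h + eps * slope x L| <= eps * eta.
  by rewrite ler_norml; move: a3 a4 hl hu; tclear; lra.
have a5 : - (h + eps * slope x L) * slope th L <= eps * eta.
  apply: le_trans (ler_norm _) _; rewrite normrM normrN -[leRHS]mulr1.
  by apply: ler_pM => //; rewrite ler_norml gb1.
rewrite -(ler_pM2l eps0); move: hb a1 a2 a5 hg; rewrite /eta; tclear; lra.
Qed.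

Lemma slope_cos th : 0 <= th <= pi -> slope th L = - cos th.
Proof.
move=> hth; apply/eqP; rewrite -eqr_oppLR; apply/eqP.
apply: (@dalembert_cos _ (fun th => - slope th L)) => //.
- by move=> *; rewrite lerN2; apply: (slope_mono o H n1).
- by rewrite (slope0 o H n1 hL) opprK.
- by move=> t ht; rewrite slope_opp // opprK.
move=> x t hx ht; have [hx' ht' hp hm] := half_pi_itv hx ht.
have h1 := slope_dalembert_le hx ht.
(* The inequality at [pi - t] is the reverse inequality at [t]. *)
have h2 : x <= pi - t <= pi - x by move: ht; tclear; lra.
have := slope_dalembert_le hx h2; rewrite slope_opp //.
have -> : pi - t + x = pi - (t - x) by ring.
have -> : pi - t - x = pi - (t + x) by ring.
by rewrite !slope_opp //; move: h1; tclear; lra.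
Qed.

End FixedRadius.

Lemma first_variation_ge th L s : 0 <= th <= pi -> 0 < L < r1 -> 0 <= s < r1 -> L - s * cos th <= F th L s.
Proof.
move=> hth hL /andP[]; rewrite le_eqVlt => /orP[/eqP <-|s0] sr.
  have hLr := r1_lt (quot_itv_self hL).
  have r0 : 0 <= (0 : R) < rho by rewrite lexx; case/andP: hLr; exact: le_lt_trans.
  rewrite mul0r subr0; have := iso_Fge H hth hLr r0; rewrite subr0; apply: le_trans.
  exact: ler_norm.
rewrite (@quotE _ F _ L s) ?gt_eqF // -mulrN lerD2l ler_wpM2l ?(ltW s0) //.
by rewrite -(slope_cos hL hth); apply: (slope_le o H n1) => //; rewrite s0.
Qed.

(** One [s0] serves all smaller angles, because the quotient increases with the angle. This
    uniformity is needed for directions that vary with [s]. *)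
Lemma first_variation_lt th L eta : 0 <= th <= pi -> 0 < L < r1 -> 0 < eta ->
  exists2 s0, 0 < s0 < r1 & forall th' s, 0 <= th' <= th -> 0 < s <= s0 -> F th' L s < L + s * (- cos th + eta).
Proof.
move=> hth hL eta0; have [s0 hs0 hs] := slope_lim o H n1 hL hth eta0.
exists s0 => // th' s /andP[th'0 th'th] /andP[s_gt0 ss0].
rewrite (@quotE _ F _ L s) ?gt_eqF // ltrD2l ltr_pM2l // -(slope_cos hL hth).
apply: le_lt_trans (hs s _); last by rewrite s_gt0.
apply: (quot_mono_th H) => //; [by case/andP: hth|exact: quot_itv_self hL|].
by rewrite s_gt0; apply: le_lt_trans ss0 _; case/andP: hs0.
Qed.

End SlopeIsCos.

(** * The sine law *)

Section SineLaw.
Variables (R : realType) (Y : metricType R) (n : nat) (rho : R).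
Variables (F : R -> R -> R -> R) (e : Y -> 'rV[R]_n -> Y) (o : Y).
Hypotheses (H : isotropic_space rho F e) (n1 : (1 < n)%N).
Implicit Types (p q m x y : Y) (u v w : 'rV[R]_n) (s t L : R).
Local Notation d := (@mdist R Y).
Local Notation Fle := (iso_Fle o H n1).
Local Notation Flip := (iso_Flip o H n1).
Local Notation Fsym := (iso_Fsym o H n1).
Local Notation r1 := (rho / 8).
Local Ltac sclear := clear - R Y n rho F e o H n1.

(** A chosen direction from [p] to [y]; for [y = p] every unit vector qualifies, and 0 is the
    default for points out of reach. *)
Definition dir p y := xget 0 [set u | esphere u /\ y = e p (d p y *: u)].

Lemma dirP p y : d p y < rho -> esphere (dir p y) /\ y = e p (d p y *: dir p y).
Proof.
move=> py; have [u hu yE] := iso_onto H py.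
by rewrite /dir; case: xgetP => [w -> //|/(_ u) []].
Qed.

Definition ang p y z := angle (dir p y) (dir p z).

Lemma angC p y z : ang p y z = ang p z y.
Proof. exact: angleC. Qed.

Lemma ang_itv p y z : d p y < rho -> d p z < rho -> 0 <= ang p y z <= pi.
Proof. by move=> /dirP[h1 _] /dirP[h2 _]; exact: angle_itv. Qed.

Lemma dist_ang p y z : d p y < rho -> d p z < rho -> d y z = F (ang p y z) (d p y) (d p z).
Proof.
move=> py pz; have [h1 E1] := dirP py; have [h2 E2] := dirP pz.
by rewrite {1}E1 {1}E2 (iso_dist H) // ?mdist_ge0.
Qed.

Lemma dist_dir p y u t : d p y < rho -> esphere u -> 0 <= t < rho ->
  d y (e p (t *: u)) = F (angle (dir p y) u) (d p y) t.
Proof.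
move=> py hu ht; have [hv E] := dirP py.
by rewrite [in LHS]E (iso_dist H) // mdist_ge0.
Qed.

Definition side p q := 0 < d p q < r1.

Lemma sideC p q : side p q -> side q p.
Proof. by rewrite /side metric_sym. Qed.

Lemma side_rho p q : side p q -> 0 <= d p q < rho.
Proof. by rewrite /side; sclear; lra. Qed.

Lemma side_r1 p q : side p q -> 0 <= d p q < r1.
Proof. by rewrite /side; sclear; lra. Qed.

Lemma rho_gt0 p q : side p q -> 0 < rho.
Proof. by rewrite /side; sclear; lra. Qed.

(** Nondegeneracy at [x] makes the triangle inequalities between the three sides strict; an angle 0
    or pi at [p] would turn one of them into an equality. *)
Lemma ang_interior x p q : side x p -> side x q -> side p q ->
  0 < ang x p q < pi -> 0 < ang p x q < pi.
Proof.
move=> xp xq pq /andP[th0 thpi].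
have [xp0 xpr] := andP (side_rho xp); have [xq0 xqr] := andP (side_rho xq).
have [pq0 pqr] := andP (side_rho pq).
have a0 : 0 < d x p by case/andP: xp. have b0 : 0 < d x q by case/andP: xq.
have LE := dist_ang xpr xqr.
have px : d p x < rho by rewrite metric_sym.
have bE := dist_ang px pqr; rewrite (metric_sym p x) in bE.
have sub : `|d x p - d x q| < d p q.
  by rewrite LE; apply: (iso_F_gt_sub o H n1) => //; rewrite th0 ltW.
have add : d p q < d x p + d x q.
  rewrite LE; apply: (nonbranching o H n1) => //; first by rewrite ltW.
  by move: (side_r1 xp) (side_r1 xq); sclear; lra.
have /andP[al0 alpi] := ang_itv px pqr.
rewrite !lt_neqAle al0 alpi !andbT; apply/andP; split; apply/eqP => E.
- move: bE; rewrite -E (iso_F0 H) ?xp0 ?pq0 // => bE.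
  have : `|d x p - d p q| < d x q.
    by move: sub add; rewrite !ltr_norml; sclear; lra.
  by rewrite -bE ltxx.
- move: bE; rewrite E (iso_Fpi H) //; last by move: (side_r1 xp) (side_r1 pq); sclear; lra.
  by move: sub; rewrite ltr_norml; sclear; lra.
Qed.

Lemma small_chord_lt a eta : 0 <= a < rho -> 0 < eta ->
  exists2 k, 0 < k <= pi & forall t, 0 <= t <= k -> F t a a < eta.
Proof.
move=> ha eta0; have [k hk Fk] := iso_small_chord H ha eta0; exists k => // t /andP[t0 tk].
by apply: le_lt_trans Fk; apply: (iso_mono H) => //; case/andP: hk.
Qed.

Section Triangle.
Variables x p q : Y.
Hypotheses (xp : side x p) (xq : side x q) (pq : side p q).
Hypothesis hth : 0 < ang x p q < pi.
Local Notation th := (ang x p q).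
Local Notation a := (d x p).
Local Notation b := (d x q).
Local Notation al := (ang p x q).
Local Ltac tclear := clear - R Y n rho F e o H n1 x p q xp xq pq hth.

(* Moving from [p] at a right angle to [p x] and away from [q] changes [d x]
   only to second order; the cosine of the angle to [p q] is [- sin al]. *)
Lemma rotate_ge eta d0 : 0 < eta -> 0 < d0 ->
  exists del, [/\ 0 < del < d0, th + del <= pi &
    d p q + (sin al - eta) * F del a a <= F (th + del) a b].
Proof.
move=> eta0 d00.
have hal := ang_interior xp xq pq hth; have sal := sin_gt0_pi hal.
have [xp0 xpr] := andP (side_rho xp); have [xq0 xqr] := andP (side_rho xq).
have [pq0 pqr] := andP (side_rho pq); have rho0 := rho_gt0 xp.
have ha := side_rho xp; have hb := side_rho xq; have hL := side_rho pq.
have px : d p x < rho by rewrite metric_sym.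
have [he1 xE] := dirP px; have [hk qE] := dirP pqr.
have [hv pE] := dirP xpr; have [hw qE'] := dirP xqr.
have [f [hf e1f kE]] := great_circle n1 he1 hk; rewrite -/(ang p x q) in kE.
(* On this great circle [x] has parameter 0 and [q] has parameter [al], so the negative sign points
   away from [q]. *)
pose u := gcircle (dir p x) f (- (pi / 2)); have hu : esphere u by exact: gcircle_sphere.
have cku : cos (angle (dir p q) u) = - sin al.
  by rewrite cos_angle // {1}kE edot_gcircle // opprK cosDpihalf.
have ceu : cos (angle (dir p x) u) = 0.
  rewrite cos_angle // -{1}(gcircle0 (dir p x) f) edot_gcircle // opprK add0r; exact: cos_pihalf.
pose c := Num.min (Num.min (eta / 2) (sin al / 2)) (1 / 2).
have c1 : c <= eta / 2 by rewrite !ge_min lexx.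
have c2 : c <= sin al / 2 by rewrite !ge_min lexx orbT.
have c3 : c <= 1 / 2 by rewrite !ge_min lexx orbT.
have c0 : 0 < c by rewrite !lt_min !divr_gt0.
have [s0 hs0 FV] := first_variation_lt o H n1 (angle_itv he1 hu) xp c0.
pose k := Num.min (d0 / 2) (pi - th).
have hk0 : 0 < k <= pi.
  rewrite lt_min divr_gt0 // subr_gt0; case/andP: hth => h1 ->; rewrite ge_min gerBl (ltW h1) orbT.
  by [].
have Fk0 : 0 < F k a a by apply: (iso_Fgt0 H) => //; case/andP: xp => -> _.
pose eps := Num.min s0 (F k a a / 2).
have es0 : eps <= s0 by rewrite ge_min lexx.
have eFk : eps <= F k a a / 2 by rewrite ge_min lexx orbT.
have eps0 : 0 < eps by rewrite lt_min divr_gt0 // andbT; case/andP: hs0.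
have er : eps < r1 by apply: le_lt_trans es0 _; case/andP: hs0.
have her : 0 <= eps < rho by rewrite ltW //=; move: er rho0; tclear; lra.
pose y := e p (eps *: u).
have dqy : d p q + eps * sin al <= d q y.
  have -> : d q y = F (angle (dir p q) u) (d p q) eps by exact: dist_dir.
  have := first_variation_ge o H n1 (angle_itv hk hu) pq (s := eps); rewrite cku mulrN opprK; apply.
  by rewrite ltW.
have dxyE : d x y = F (angle (dir p x) u) a eps.
  by rewrite (metric_sym x p); exact: dist_dir.
have dxy1 : a <= d x y.
  rewrite dxyE; have := first_variation_ge o H n1 (angle_itv he1 hu) xp (s := eps).
  by rewrite ceu mulr0 subr0; apply; rewrite ltW.
have dxy2 : d x y < a + eps * c.
  rewrite dxyE; have := FV (angle (dir p x) u) eps; rewrite ceu oppr0 add0r; apply.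
    by rewrite angle_ge0 // lexx.
  by rewrite eps0.
have dxyr : d x y < rho.
  have : eps * c <= eps * 1 by rewrite ler_wpM2l ?(ltW eps0) //; move: c3; tclear; lra.
  by move: dxy2 er (side_r1 xp) rho0; tclear; lra.
(* [y1] is the point of the circle of radius [a] about [x] in the direction of [y]. It is within
   [eps * c] of [y], so the chord [F del a a] equals [eps] up to a factor between [1 - c] and
   [1 + c]. *)
have [hv' yE] := dirP dxyr; pose y1 := e x (a *: dir x y).
have hxy : 0 <= d x y < rho by rewrite mdist_ge0.
have dyy1 : d y y1 <= eps * c.
  rewrite {1}yE (dist_ray H) // ger0_norm ?subr_ge0 //; move: dxy2; tclear; lra.
have dpyE : d p y = eps by rewrite (dist_center H).
pose del := angle (dir x p) (dir x y); have hdel : 0 <= del <= pi by exact: angle_itv.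
have py1 : d p y1 = F del a a by exact: dist_dir.
have b1 : F del a a <= eps * (1 + c).
  rewrite -py1; apply: le_trans (metric_triangle _ y _) _; rewrite dpyE; move: dyy1; tclear; lra.
have b2 : eps * (1 - c) <= F del a a.
  rewrite -py1; have := metric_triangle p y1 y; rewrite dpyE (metric_sym y1); move: dyy1; tclear; lra.
have delk : del < k.
  apply: (iso_F_lt H hdel _ ha ha); first by case/andP: hk0 => /ltW -> ->.
  apply: le_lt_trans b1 _; apply: le_lt_trans (_ : eps * (3 / 2) < _).
    by rewrite ler_wpM2l ?(ltW eps0) //; move: c3; tclear; lra.
  by move: eFk eps0; tclear; lra.
have k1 : k <= d0 / 2 by rewrite ge_min lexx.
have k2 : k <= pi - th by rewrite ge_min lexx orbT.
have del0 : 0 < del.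
  rewrite lt_neqAle eq_sym; case/andP: hdel => -> _; rewrite andbT; apply/eqP => E.
  move: b2; rewrite E (iso_F0 H) // subrr normr0 leNgt => /negP; apply.
  by rewrite mulr_gt0 //; move: c3; tclear; lra.
exists del; split; [by rewrite del0; move: delk k1 d00; tclear; lra|move: delk k2; tclear; lra|].
apply: le_trans (_ : F (angle (dir x y) (dir x q)) a b <= _); last first.
  apply: (iso_mono H) => //; first exact: angle_ge0.
    by rewrite /ang addrC /del (angleC (dir x p) (dir x y)); exact: angle_triangle.
  by move: delk k2; tclear; lra.
have -> : F (angle (dir x y) (dir x q)) a b = d q y1.
  by rewrite (dist_dir xqr) // angleC Fsym // angle_itv.
have := metric_triangle q y1 y; rewrite (metric_sym y1) => tri.
have sle : sin al <= 1 by exact: sin_le1.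
have h1 : (sin al - eta) * F del a a <= (sin al - 2 * c) * F del a a.
  by rewrite ler_wpM2r ?(le_trans _ b2) ?mulr_ge0 ?(ltW eps0) //; move: c1 c3; tclear; lra.
have h2 : (sin al - 2 * c) * F del a a <= (sin al - 2 * c) * (eps * (1 + c)).
  by rewrite ler_wpM2l //; move: c2; tclear; lra.
have h3 : (sin al - 2 * c) * (1 + c) <= sin al - c.
  have : c * (sin al - 1 - 2 * c) <= 0 by rewrite mulr_ge0_le0 ?(ltW c0) //; move: sle c0; tclear; lra.
  by tclear; lra.
have h4 := ler_wpM2l (ltW eps0) h3.
move: h1 h2 h4 tri dqy dyy1; tclear; lra.
Qed.

(** The rotated point [p'] is as far from [x] as [p] is. By the first variation, the direction from
    [p] to [p'] is nearly orthogonal to that of [x], so its cosine with the direction of [q] is at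
    least [- (sin al + c)]. Unlike in [rotate_ge], every small [del] is covered. *)
Lemma rotate_le eta : 0 < eta ->
  exists2 d0, 0 < d0 & forall del, 0 < del < d0 -> th + del <= pi /\
    F (th + del) a b <= d p q + (sin al + eta) * F del a a.
Proof.
move=> eta0.
have hal := ang_interior xp xq pq hth; have sal := sin_gt0_pi hal.
have [xp0 xpr] := andP (side_rho xp); have [xq0 xqr] := andP (side_rho xq).
have [pq0 pqr] := andP (side_rho pq); have rho0 := rho_gt0 xp.
have ha := side_rho xp; have hb := side_rho xq; have hL := side_rho pq.
have px : d p x < rho by rewrite metric_sym.
have [he1 xE] := dirP px; have [hk qE] := dirP pqr.
have [hv pE] := dirP xpr; have [hw qE'] := dirP xqr.
pose c := Num.min (eta / 2) (1 / 2).
have c1 : c <= eta / 2 by rewrite !ge_min lexx.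
have c3 : c <= 1 / 2 by rewrite !ge_min lexx orbT.
have c0 : 0 < c by rewrite !lt_min !divr_gt0.
have acos_itv (z : R) : -1 <= z <= 1 -> 0 <= acos z <= pi by move=> hz; rewrite acos_ge0 // acos_lepi.
have hc : -1 <= c <= 1 by move: c0 c3; tclear; lra.
have c20 : 0 < c / 2 by rewrite divr_gt0.
have [s1 hs1 FV1] := first_variation_lt o H n1 (acos_itv _ hc) xp c20.
(* Capped at 1 to keep [- b0] in the domain of the inverse cosine. *)
pose b0 := Num.min (sin al + c) 1.
have hb0 : -1 <= - b0 <= 1.
  rewrite lerN2 ge_min lexx orbT lerNl (_ : -1 <= b0) //.
  by rewrite le_min; move: sal c0; tclear => *; apply/andP; split; lra.
have [s2 hs2 FV2] := first_variation_lt o H n1 (acos_itv _ hb0) pq c0.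
have s0 : 0 < Num.min s1 s2 by rewrite lt_min; case/andP: hs1 => -> _; case/andP: hs2.
have [k hk' Fk] := small_chord_lt ha s0.
exists (Num.min k (pi - th)).
  by rewrite lt_min subr_gt0; case/andP: hk' => -> _; case/andP: hth.
move=> del /andP[del0]; rewrite lt_min => /andP[delk del_le].
have thdel : th + del <= pi by move: del_le; tclear; lra.
split=> //; have del_le' : del <= pi by move: delk hk'; tclear; lra.
have := Fk del; rewrite (ltW del0) (ltW delk) => /(_ isT); rewrite lt_min => /andP[es1 es2].
set eps := F del a a in es1 es2 *.
have eps0 : 0 < eps by apply: (iso_Fgt0 H); rewrite ?del0 ?del_le' //; case/andP: xp => -> _.
have er : eps < r1 by apply: lt_trans es1 _; case/andP: hs1.
have her : 0 <= eps < rho by rewrite ltW //=; move: er rho0; tclear; lra.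
have [f [hf wf vE]] := great_circle n1 hw hv; rewrite -/(ang x q p) angC in vE.
pose v' := gcircle (dir x q) f (th + del); have hv' : esphere v' by exact: gcircle_sphere.
have [th0 thpi] := andP hth.
have wv' : angle v' (dir x q) = th + del.
  have E : `|th + del - 0| = th + del by rewrite subr0 gtr0_norm // addr_gt0.
  by rewrite -{1}(gcircle0 (dir x q) f) angle_gcircle // E.
have vv' : angle (dir x p) v' = del.
  have E : `|th - (th + del)| = del by rewrite opprD addrA subrr sub0r normrN gtr0_norm.
  by rewrite {1}vE angle_gcircle // E.
pose p' := e x (a *: v').
have pp' : d p p' = eps by rewrite (dist_dir xpr) // vv'.
have pp'r : d p p' < rho by rewrite pp'; case/andP: her.
have [hu p'E] := dirP pp'r; rewrite pp' in p'E.
have hthdel : 0 <= th + del <= pi by rewrite thdel ltW // addr_gt0.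
have -> : F (th + del) a b = d q p' by rewrite (dist_dir xqr) // angleC wv' Fsym.
have -> : d q p' = F (angle (dir p q) (dir p p')) (d p q) eps.
  by rewrite [in LHS]p'E; exact: dist_dir.
set u := dir p p' in hu p'E *.
have aE : F (angle (dir p x) u) a eps = a.
  have : d x p' = a by rewrite (dist_center H).
  by rewrite p'E (dist_dir px) // (metric_sym p x).
have hchi := angle_itv he1 hu.
have chi0 : 0 <= cos (angle (dir p x) u).
  have := first_variation_ge o H n1 hchi xp (s := eps); rewrite aE (ltW eps0) er => /(_ isT) h.
  by rewrite -(pmulr_rge0 _ eps0); move: h; tclear; lra.
have chic : cos (angle (dir p x) u) <= c.
  rewrite leNgt; apply/negP => h.
  have := FV1 (angle (dir p x) u) eps; rewrite aE eps0 (ltW es1) => /(_ _ isT).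
  rewrite acosK; last by rewrite in_itv.
  case/andP: hchi => chi00 _; rewrite chi00 angle_le_cos ?acos_itv //; last first.
    by rewrite acosK ?in_itv // -cos_angle // ltW.
  move=> /(_ isT); rewrite ltrDl pmulr_rgt0 //; move: c0; tclear; lra.
have ku : - b0 <= cos (angle (dir p q) u).
  rewrite cos_angle //; have := edot_angle_ge hk he1 hu.
  rewrite (angleC (dir p q)) -/(ang p x q) cosD => h.
  have h1 : -1 <= cos al by exact: cos_geN1.
  have h2 : sin (angle (dir p x) u) <= 1 by exact: sin_le1.
  have h3 : sin al * sin (angle (dir p x) u) <= sin al by rewrite ler_piMr // ltW.
  have h4 : - cos (angle (dir p x) u) <= cos al * cos (angle (dir p x) u).
    by rewrite -mulN1r ler_wpM2r.
  have h5 : - (sin al + c) <= edot (dir p q) u by move: h h3 h4 chic; tclear; lra.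
  have h6 : -1 <= edot (dir p q) u by have /andP[] := edot_unit_itv hk hu.
  by rewrite lerNl le_min lerNl h5 lerNl h6.
have := FV2 (angle (dir p q) u) eps; rewrite eps0 (ltW es2) angle_ge0 // => /(_ _ isT).
rewrite angle_le_cos ?acos_itv //; last by rewrite acosK ?in_itv // -cos_angle.
move=> /(_ isT) /ltW; rewrite acosK ?in_itv // opprK => h; apply: le_trans h _.
rewrite lerD2l mulrC ler_wpM2r ?(ltW eps0) //.
have : b0 <= sin al + c by rewrite ge_min lexx.
by move: c1; tclear; lra.
Qed.

End Triangle.

Lemma chord_subadd s t a : 0 <= s -> 0 <= t -> s + t <= pi -> 0 <= a < rho ->
  F (s + t) a a <= F s a a + F t a a.
Proof.
move=> s0 t0 st ha; have [v hv] := sphere_ex R (ltnW n1); have [f hf vf] := sphere_perp n1 hv.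
have hg r : esphere (gcircle v f r) by exact: gcircle_sphere.
have E r r' : 0 <= r' - r <= pi -> F (r' - r) a a = d (e o (a *: gcircle v f r)) (e o (a *: gcircle v f r')).
  move=> hr; have Er : `|r - r'| = r' - r by rewrite distrC ger0_norm; case/andP: hr.
  by rewrite (iso_dist H) // angle_gcircle // Er //; case/andP: hr.
have := E 0 s; have := E s (s + t); have := E 0 (s + t); rewrite !subr0 [s + t - s]addrAC subrr add0r.
have sp : s <= pi by move: s0 t0 st; sclear; lra.
have tp : t <= pi by move: s0 t0 st; sclear; lra.
rewrite s0 t0 sp tp st addr_ge0 // => -> // -> // -> //; exact: metric_triangle.
Qed.

Lemma chord_mul k t a : 0 <= t -> k%:R * t <= pi -> 0 <= a < rho -> F (k%:R * t) a a <= k%:R * F t a a.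
Proof.
move=> t0 + ha; elim: k => [|k IH] kt; first by rewrite !mul0r (iso_F0 H) // subrr normr0.
have E z : k.+1%:R * z = k%:R * z + z by rewrite -natr1 mulrDl mul1r.
have kt' : k%:R * t <= pi by move: kt t0; rewrite E; sclear; lra.
rewrite !E in kt *; apply: le_trans (chord_subadd _ _ _ _) _ => //.
  by rewrite mulr_ge0.
by rewrite lerD2r IH.
Qed.

(** The arc [s] consists of [s / t] arcs of size [t], rounded down, and a remainder shorter than
    [t]. *)
Lemma chord_ratio s t a : 0 < t -> t <= s -> s <= pi -> 0 <= a < rho ->
  F s a a <= (s / t + 1) * F t a a.
Proof.
move=> t0 ts spi ha; have s0 : 0 < s by exact: lt_le_trans ts.
pose k := Num.truncn (s / t).
have /andP[k1 k2] : k%:R <= s / t < k.+1%:R by apply: truncn_itv; rewrite divr_ge0 // ltW.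
have kt : k%:R * t <= s by rewrite -ler_pdivlMr.
have kt2 : s - k%:R * t <= t by move: k2; rewrite ltr_pdivrMr // -natr1; sclear; lra.
have kt0 : 0 <= k%:R * t by rewrite mulr_ge0 // ltW.
have := @chord_subadd (k%:R * t) (s - k%:R * t) a kt0; rewrite subr_ge0 kt addrC subrK => /(_ isT spi ha).
have := @chord_mul k t a (ltW t0) (le_trans kt spi) ha.
have : F (s - k%:R * t) a a <= F t a a.
  by apply: (iso_mono H) => //; [rewrite subr_ge0|exact: le_trans spi].
have F0 : 0 <= F t a a.
  have h : 0 <= t <= pi by rewrite ltW // (le_trans ts).
  by have := iso_Fge H h ha ha; rewrite subrr normr0.
have := ler_wpM2r F0 k1; sclear; lra.
Qed.

End SineLaw.

(** * The length of circles, the sine law, and the derivative of [F] in the angle *)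

Section CircleRate.
Variables (R : realType) (Y : metricType R) (n : nat) (rho : R).
Variables (F : R -> R -> R -> R) (e : Y -> 'rV[R]_n -> Y) (o : Y).
Hypotheses (H : isotropic_space rho F e) (n1 : (1 < n)%N) (rho0 : 0 < rho).
Implicit Types (p q : Y) (u v w : 'rV[R]_n) (s t L a b c : R).
Local Notation d := (@mdist R Y).
Local Notation Fle := (iso_Fle o H n1).
Local Notation Flip := (iso_Flip o H n1).
Local Notation Fsym := (iso_Fsym o H n1).
Local Notation ang := (ang e).
Local Notation side := (@side R Y rho).
Local Notation r2 := (rho / 32).
Local Ltac sclear := clear - R Y n rho F e o H n1 rho0.

Lemma r2_rho a : 0 < a < r2 -> 0 <= a < rho.
Proof. by move: rho0; sclear; lra. Qed.

Lemma dir_ray p v t : esphere v -> 0 < t < rho -> dir e p (e p (t *: v)) = v.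
Proof.
move=> hv ht; have ht' : 0 <= t < rho by case/andP: ht => /ltW -> ->.
have dt := dist_center H p hv ht'.
have [|h E] := dirP H (p := p) (y := e p (t *: v)); first by rewrite dt; case/andP: ht.
by rewrite dt in E; apply/esym/(iso_dir_inj H hv h ht E).
Qed.

Lemma triangle_ex th a b : 0 < th < pi -> 0 < a < r2 -> 0 < b < r2 -> exists x p q,
  [/\ side x p, side x q, side p q & [/\ ang x p q = th, d x p = a, d x q = b & d p q = F th a b]].
Proof.
move=> hth ha hb; have har := r2_rho ha; have hbr := r2_rho hb.
have hth' : 0 <= th <= pi by move: hth; sclear; lra.
have [v [w [hv hw vw]]] := iso_angles n1 hth'.
exists o, (e o (a *: v)), (e o (b *: w)).
have pqE : d (e o (a *: v)) (e o (b *: w)) = F th a b by rewrite (iso_dist H) // vw.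
have xp := dist_center H o hv har; have xq := dist_center H o hw hbr.
rewrite /side pqE xp xq; split.
- by move: ha rho0; sclear; lra.
- by move: hb rho0; sclear; lra.
- apply/andP; split; last by have := Fle hth' har hbr; move: ha hb rho0; sclear; lra.
  apply: le_lt_trans (_ : `|a - b| < _); first exact: normr_ge0.
  apply: (iso_F_gt_sub o H n1); [by move: hth; sclear; lra|by case/andP: ha|by case/andP: hb|by case/andP: har|by case/andP: hbr].
split=> //; rewrite /ang !dir_ray // ; [case/andP: hb => ->|case/andP: ha => ->]; rewrite //=; [by case/andP: hbr|by case/andP: har].
Qed.

Lemma chord_ge0 t a : 0 <= t <= pi -> 0 <= a < rho -> 0 <= F t a a.
Proof. by move=> ht ha; have := iso_Fge H ht ha ha; rewrite subrr normr0. Qed.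

(** If chords were not bounded by a multiple of the angle, then by [chord_ratio] all small arcs
    would have chords larger than any given multiple of the arc. By [rotate_ge], [F t a a] would
    grow too fast on [[pi / 4, pi / 2]]. *)
Lemma chord_bounded a : 0 < a < r2 -> exists M, forall t, 0 < t <= pi -> F t a a <= M * t.
Proof.
move=> ha; have har := r2_rho ha; have p0 := pi_gt0 R; have a0 : 0 < a by case/andP: ha.
apply: contrapT => hno.
have sup M : exists2 t, 0 < t <= pi & M * t < F t a a.
  apply: contrapT => h; apply: hno; exists M => t ht; rewrite leNgt; apply/negP => h'.
  by apply: h; exists t.
(* Growth at the rate [K] over an interval of length [pi / 4] would add [4 * a], whereas no chord
   exceeds [2 * a]. *)
pose K := 16 * a / pi; have K0 : 0 < K by rewrite divr_gt0 // mulr_gt0.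
have hpi2 : 0 <= (pi : R) / 2 <= pi by move: p0; sclear; lra.
have hpi4 : 0 <= (pi : R) / 4 <= pi by move: p0; sclear; lra.
have : F (pi / 4) a a + K * (pi / 2 - pi / 4) <= F (pi / 2) a a.
  apply: (@growth_ge _ _ _ K (fun t => F t a a)); first by move: p0; sclear; lra.
    by apply: econt_sub (iso_cont H har har) _ _; [case/andP: hpi4|case/andP: hpi2].
  move=> t /andP[t4 t2]; have hth : 0 < t < pi by move: t4 t2 p0; sclear; lra.
  have [x [p [q [xp xq pq [thE xpE xqE pqE]]]]] := triangle_ex hth ha ha.
  rewrite -thE in hth; have hal := ang_interior o H n1 xp xq pq hth; have s0 := sin_gt0_pi hal.
  set s := sin _ in s0.
  have [t1 /andP[t10 t1pi] Ft1] := sup (4 * K / s).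
  have [||del [/andP[del0 deld] del_le]] := rotate_ge o H n1 xp xq pq hth (eta := s / 2) (d0 := Num.min t1 (pi / 2 - t)).
  - by rewrite divr_gt0.
  - by rewrite lt_min t10 subr_gt0.
  move: deld; rewrite lt_min thE xpE xqE pqE -/s => /andP[delt1 delt2] hF.
  exists (t + del); first by rewrite ltrDl del0; move: delt2; sclear; lra.
  apply: le_trans hF; rewrite lerD2l addrC addKr.
  have hdel : 0 <= del <= pi by rewrite ltW //=; move: delt1 t1pi; sclear; lra.
  have := chord_ratio o H n1 del0 (ltW delt1) t1pi har.
  have F0 := chord_ge0 hdel har.
  have b1 : (t1 / del + 1) * F del a a <= 2 * t1 / del * F del a a.
    rewrite ler_wpM2r // (_ : 2 * t1 / del = t1 / del + t1 / del); last by ring.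
    by rewrite lerD2l ler_pdivlMr // mul1r ltW.
  move=> b2; have {b1}b2 := le_lt_trans (le_refl _) (lt_le_trans Ft1 (le_trans b2 b1)).
  have : 4 * K / s * t1 * del < 2 * t1 * F del a a.
    by rewrite -ltr_pdivlMr // [ltRHS]mulrAC.
  have -> : 4 * K / s * t1 * del = 2 * t1 * (2 * K / s * del) by ring.
  rewrite ltr_pM2l ?mulr_gt0 // => /ltW h3.
  have := ler_wpM2l (ltW s0) h3.
  have -> : s * (2 * K / s * del) = 2 * (K * del) by field; rewrite gt_eqF.
  by sclear; lra.
have := Fle hpi2 har har; have := chord_ge0 hpi4 har.
have E P : 0 < P -> 16 * a / P * (P / 2 - P / 4) = 4 * a by move=> P0; field; rewrite gt_eqF.
rewrite /K E //.
by move: a0; sclear; lra.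
Qed.

(* The length of the circle of radius [a] per unit of angle. *)
Definition rate a := sup [set F t a a / t | t in [set t | 0 < t <= pi]].

Lemma rate_has_sup a : 0 < a < r2 -> has_sup [set F t a a / t | t in [set t | 0 < t <= pi]].
Proof.
move=> ha; have [M hM] := chord_bounded ha; split.
  by exists (F pi a a / pi), pi => //=; rewrite pi_gt0 lexx.
by exists M => _ [t /= ht <-]; have [t0 _] := andP ht; rewrite ler_pdivrMr // hM.
Qed.

Lemma rate_ge a t : 0 < a < r2 -> 0 < t <= pi -> F t a a <= rate a * t.
Proof.
move=> ha ht; have [t0 _] := andP ht; rewrite -ler_pdivrMr //.
by apply: ub_le_sup; [exact: (rate_has_sup ha).2 | exists t].
Qed.

Lemma rate_gt0 a : 0 < a < r2 -> 0 < rate a.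
Proof.
move=> ha; have har := r2_rho ha; have p0 := pi_gt0 R.
have := @rate_ge a pi ha; rewrite p0 lexx => /(_ isT); rewrite (iso_Fpi H).
- by move=> h; rewrite -(pmulr_lgt0 _ p0); apply: lt_le_trans h; move: ha; sclear; lra.
- by case/andP: har.
- by case/andP: har.
- by move: ha rho0; sclear; lra.
Qed.

(** Chords are subadditive in the angle, so the supremum of chord over angle is also its limit at
    0. *)
Lemma rate_lim a eta : 0 < a < r2 -> 0 < eta ->
  exists2 d0, 0 < d0 <= pi & forall t, 0 < t < d0 -> (rate a - eta) * t <= F t a a.
Proof.
move=> ha eta0; have har := r2_rho ha; have s0 := rate_gt0 ha.
have e2 : 0 < eta / 2 by rewrite divr_gt0.
have [_ [t1 /= /andP[t10 t1pi] <-]] := sup_adherent e2 (rate_has_sup ha).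
rewrite -/(rate a) ltr_pdivlMr // => Ft1.
exists (Num.min t1 (eta * t1 / (2 * rate a))).
  by rewrite lt_min t10 divr_gt0 ?mulr_gt0 // ge_min t1pi.
move=> t /andP[t0]; rewrite lt_min => /andP[tt1].
rewrite ltr_pdivlMr ?mulr_gt0 // => tt2.
have := chord_ratio o H n1 t0 (ltW tt1) t1pi har => h.
have {h} h : t * F t1 a a <= (t1 + t) * F t a a.
  have := ler_wpM2l (ltW t0) h; rewrite mulrA.
  by have -> : t * (t1 / t + 1) = t1 + t by field; rewrite gt_eqF.
have h1 := ltr_pM2l t0 ((rate a - eta / 2) * t1) (F t1 a a); rewrite Ft1 in h1.
have h2 : t * ((rate a - eta) * (t1 + t)) <= t * ((rate a - eta / 2) * t1).
  rewrite ler_pM2l //; have : 0 <= eta * t by rewrite mulr_ge0 // ltW.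
  by move: tt2; sclear; lra.
have t1t : 0 < t1 + t by rewrite addr_gt0.
rewrite -(ler_pM2l t1t); move: h h1 h2; sclear; lra.
Qed.

(** The side [F (th + del) a b] is obtained by rotating either [p] or [q] about [x]. Bounding it
    from below by the rotation of [p] and from above by that of [q], then dividing by [del],
    compares the two rates. *)
Lemma sine_law_le x p q : side x p -> side x q -> side p q ->
  d x p < r2 -> d x q < r2 -> 0 < ang x p q < pi ->
  rate (d x p) * sin (ang p x q) <= rate (d x q) * sin (ang q x p).
Proof.
move=> xp xq pq ar br hth.
have hal := ang_interior o H n1 xp xq pq hth; have sa := sin_gt0_pi hal.
have qp := sideC pq; have hth' : 0 < ang x q p < pi by rewrite angC.
have hbe := ang_interior o H n1 xq xp qp hth'; have sb := sin_gt0_pi hbe.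
have ha : 0 < d x p < r2 by case/andP: xp => ->.
have hb : 0 < d x q < r2 by case/andP: xq => ->.
have har := r2_rho ha; have hbr := r2_rho hb.
have ra := rate_gt0 ha; have rb := rate_gt0 hb.
set A := rate (d x p) in ra *; set B := rate (d x q) in rb *.
set sal := sin (ang p x q) in sa *; set sbe := sin (ang q x p) in sb *.
apply/ler_addgt0Pr => eta eta0.
have den0 : 0 < A + 1 + B by rewrite !addr_gt0.
pose c := Num.min sal (eta / (A + 1 + B)).
have c0 : 0 < c by rewrite lt_min sa divr_gt0.
have c1 : c <= sal by rewrite ge_min lexx.
have c2 : c * (A + 1 + B) <= eta by rewrite -ler_pdivlMr // ge_min lexx orbT.
have [d1 d10 hle] := rotate_le o H n1 xq xp qp hth' c0.
have [d2 /andP[d20 d2pi] hlim] := rate_lim ha c0.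
have [|del [/andP[del0 deld] del_le hge]] := rotate_ge o H n1 xp xq pq hth c0 (d0 := Num.min d1 d2).
  by rewrite lt_min d10.
move: deld; rewrite lt_min => /andP[deld1 deld2].
have [|_ hle'] := hle del; first by rewrite del0.
have hthd : 0 <= ang x p q + del <= pi.
  by rewrite del_le addr_ge0 ?(ltW del0) //; case/andP: hth => /ltW.
rewrite (angC e x q p) (Fsym hthd) // (metric_sym q p) in hle'.
have := le_trans hge hle'; rewrite lerD2l -/sal -/sbe => h1.
have hdel : 0 < del <= pi by rewrite del0 (le_trans (ltW deld2)).
have h2 : (sbe + c) * F del (d x q) (d x q) <= (sbe + c) * (B * del).
  by rewrite ler_wpM2l ?rate_ge // addr_ge0 // ltW.
have h3 : (sal - c) * ((A - c) * del) <= (sal - c) * F del (d x p) (d x p).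
  by rewrite ler_wpM2l ?subr_ge0 // hlim // del0.
have h4 : (sal - c) * (A - c) <= (sbe + c) * B.
  rewrite -(ler_pM2r del0); move: h1 h2 h3; sclear; lra.
have c4 : c * sal <= c by rewrite ler_piMr ?(ltW c0) // sin_le1.
have c5 : 0 <= c * c by rewrite mulr_ge0 // ltW.
by move: h4 c2 c4 c5; sclear; lra.
Qed.

Lemma sine_law x p q : side x p -> side x q -> side p q ->
  d x p < r2 -> d x q < r2 -> 0 < ang x p q < pi ->
  rate (d x p) * sin (ang p x q) = rate (d x q) * sin (ang q x p).
Proof.
move=> xp xq pq ar br hth; apply/eqP; rewrite eq_le sine_law_le //=.
by apply: sine_law_le => //; [exact: sideC|rewrite angC].
Qed.

Local Notation r3 := (rho / 64).

Lemma r3_r2 a : 0 < a < r3 -> 0 < a < r2.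
Proof. by move: rho0; sclear; lra. Qed.

(** The sine law is used at two vertices, [x] and [p], to eliminate the angle at [q]. Sides below
    [rho / 64] put the third side below [rho / 32], where its rate is under control. *)
Lemma triangle_rates th a b : 0 < th < pi -> 0 < a < r3 -> 0 < b < r3 ->
  exists x p q, [/\ side x p, side x q, side p q &
    [/\ ang x p q = th, d x p = a, d x q = b & d p q = F th a b] /\
    [/\ 0 < ang p x q < pi, 0 < d p q < r2,
       rate a * sin th = rate (F th a b) * sin (ang q x p) &
       rate a * sin (ang p x q) = rate a * rate b * sin th / rate (F th a b)]].
Proof.
move=> hth ha hb; have ha2 := r3_r2 ha; have hb2 := r3_r2 hb.
have hth' : 0 <= th <= pi by move: hth; sclear; lra.
have [x [p [q [xp xq pq [thE xpE xqE pqE]]]]] := triangle_ex hth ha2 hb2.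
exists x, p, q; split=> //; split=> //.
have pq2 : d p q < r2.
  rewrite pqE; have := Fle hth' (r2_rho ha2) (r2_rho hb2); move: ha hb; sclear; lra.
have pq0 : 0 < d p q by case/andP: pq.
rewrite -thE in hth; have hal := ang_interior o H n1 xp xq pq hth.
have ar2 : d x p < r2 by rewrite xpE; case/andP: ha2.
have br2 : d x q < r2 by rewrite xqE; case/andP: hb2.
have L1 := sine_law xp xq pq ar2 br2 hth.
have px := sideC xp.
have := @sine_law p x q px pq xq; rewrite (metric_sym p x) => /(_ ar2 pq2 hal).
rewrite (angC e q p x) xpE pqE thE => L2.
have rc : 0 < rate (F th a b) by rewrite -pqE; apply: rate_gt0; rewrite pq0.
split=> //; first by rewrite -pqE pq0.
rewrite xpE xqE in L1; apply: (mulIf (lt0r_neq0 rc)).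
rewrite divfK ?lt0r_neq0 // L1.
transitivity (rate b * (rate (F th a b) * sin (ang q x p))); first by ring.
by rewrite -L2; ring.
Qed.

(* The derivative of [F] in the angle, see [F_rate_ge] and [F_rate_le]. *)
Definition Frate th a b := rate a * rate b * sin th / rate (F th a b).

Lemma F_rate_ge th a b eta d0 : 0 < th < pi -> 0 < a < r3 -> 0 < b < r3 -> 0 < eta -> 0 < d0 ->
  exists del, [/\ 0 < del < d0, th + del <= pi &
    F th a b + (Frate th a b - eta) * del <= F (th + del) a b].
Proof.
move=> hth ha hb eta0 d00; have ha2 := r3_r2 ha; have ra := rate_gt0 ha2.
have [x [p [q [xp xq pq [[thE xpE xqE pqE] [hal _ _ DE]]]]]] := triangle_rates hth ha hb.
rewrite -/(Frate th a b) in DE; rewrite -DE.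
have sa := sin_gt0_pi hal; set s := sin _ in sa *.
have hth2 : 0 < ang x p q < pi by rewrite thE.
pose c := Num.min s (eta / (rate a + 1)).
have c0 : 0 < c by rewrite lt_min sa divr_gt0 // addr_gt0.
have c1 : c <= s by rewrite ge_min lexx.
have c2 : c * (rate a + 1) <= eta by rewrite -ler_pdivlMr ?addr_gt0 // ge_min lexx orbT.
have [d2 /andP[d20 d2pi] hlim] := rate_lim ha2 c0.
have [|del [/andP[del0 deld] del_le hge]] := rotate_ge o H n1 xp xq pq hth2 c0 (d0 := Num.min d0 d2).
  by rewrite lt_min d00.
move: deld; rewrite lt_min => /andP[deld0 deld2].
rewrite thE xpE xqE pqE -/s in hge del_le.
exists del; split=> //; first by rewrite del0.
apply: le_trans hge; rewrite lerD2l.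
apply: le_trans (_ : (s - c) * ((rate a - c) * del) <= _); last first.
  by rewrite ler_wpM2l ?subr_ge0 // hlim // del0.
rewrite mulrA ler_pM2r //.
have c4 : c * s <= c by rewrite ler_piMr ?(ltW c0) // sin_le1.
have c5 : 0 <= c * c by rewrite mulr_ge0 // ltW.
by move: c2 c4 c5; sclear; lra.
Qed.

Lemma F_rate_le th a b eta : 0 < th < pi -> 0 < a < r3 -> 0 < b < r3 -> 0 < eta ->
  exists2 d0, 0 < d0 & forall del, 0 < del < d0 -> th + del <= pi /\
    F (th + del) a b <= F th a b + (Frate th a b + eta) * del.
Proof.
move=> hth ha hb eta0; have ha2 := r3_r2 ha; have ra := rate_gt0 ha2.
have [x [p [q [xp xq pq [[thE xpE xqE pqE] [hal _ _ DE]]]]]] := triangle_rates hth ha hb.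
rewrite -/(Frate th a b) in DE; rewrite -DE.
have sa := sin_gt0_pi hal; set s := sin _ in sa *.
have hth2 : 0 < ang x p q < pi by rewrite thE.
have c0 : 0 < eta / rate a by rewrite divr_gt0.
have [d1 d10 hle] := rotate_le o H n1 xp xq pq hth2 c0.
exists d1 => // del hdel; have [del_le h] := hle del hdel.
rewrite thE xpE xqE pqE -/s in h del_le; split=> //; apply: le_trans h _; rewrite lerD2l.
have del0 : 0 < del by case/andP: hdel.
have hdel' : 0 < del <= pi.
  by rewrite del0 (le_trans _ del_le) // lerDr; case/andP: hth => /ltW.
apply: le_trans (_ : (s + eta / rate a) * (rate a * del) <= _).
  by rewrite ler_wpM2l ?rate_ge // addr_ge0 // ltW.
rewrite mulrA mulrDl divfK ?gt_eqF // [s * _]mulrC lexx //.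
Qed.

Lemma Frate_gt0 th a b : 0 < th < pi -> 0 < a < r3 -> 0 < b < r3 -> 0 < Frate th a b.
Proof.
move=> hth ha hb; have [x [p [q [_ _ _ [[_ _ _ pqE] [_ pq2 _ _]]]]]] := triangle_rates hth ha hb.
rewrite /Frate divr_gt0 ?mulr_gt0 ?rate_gt0 ?sin_gt0_pi //; try exact: r3_r2.
by rewrite -pqE.
Qed.

Lemma iso_F_strict th th' a b : 0 <= th -> th < th' -> th' <= pi -> 0 < a < r3 -> 0 < b < r3 ->
  F th a b < F th' a b.
Proof.
move=> th0 tt' th'pi ha hb; have har := r2_rho (r3_r2 ha); have hbr := r2_rho (r3_r2 hb).
have [e0|ne0] := eqVneq th 0.
  rewrite e0 (iso_F0 H) //; apply: (iso_F_gt_sub o H n1).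
  - by rewrite th'pi andbT; apply: le_lt_trans tt'.
  - by case/andP: ha.
  - by case/andP: hb.
  - by case/andP: har.
  - by case/andP: hbr.
have hth : 0 < th < pi by rewrite lt_neqAle eq_sym ne0 th0 (lt_le_trans tt').
have D0 := Frate_gt0 hth ha hb; have D2 : 0 < Frate th a b / 2 by rewrite divr_gt0.
have [|del [/andP[del0 deld] _ h]] := F_rate_ge hth ha hb D2 (d0 := th' - th).
  by rewrite subr_gt0.
apply: lt_le_trans (_ : F (th + del) a b <= _).
  apply: lt_le_trans h; rewrite ltrDl mulr_gt0 //; move: D0; sclear; lra.
apply: (iso_mono H) => //; [by rewrite addr_ge0 // ltW|move: deld; sclear; lra].
Qed.

Lemma angle_of_side a b c : 0 < a < r3 -> 0 < b < r3 -> `|a - b| < c < a + b ->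
  exists2 th, 0 < th < pi & F th a b = c.
Proof.
move=> ha hb /andP[c1 c2]; have har := r2_rho (r3_r2 ha); have hbr := r2_rho (r3_r2 hb).
have Fpi : F pi a b = a + b.
  by apply: (iso_Fpi H); [case/andP: har|case/andP: hbr|move: ha hb rho0; sclear; lra].
have [||th /andP[th0 thpi] E] := @econt_ivt _ 0 pi (fun t => F t a b) c (pi_ge0 R).
- exact: (iso_cont H).
- by rewrite (iso_F0 H) // Fpi !ltW.
exists th => //; rewrite !lt_neqAle th0 thpi !andbT; apply/andP; split; apply/eqP => E'.
- by move: c1; rewrite -E -E' (iso_F0 H) // ltxx.
- by move: c2; rewrite -E E' Fpi ltxx.
Qed.

(* By the sine law, a triangle with two sides [c0] and third side [c] expresses
   [rate c] through [rate c0]. *)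
Lemma rate_cont c0 eta : 0 < c0 < r3 -> 0 < eta ->
  exists2 del, 0 < del & forall c, 0 < c -> `|c - c0| < del -> `|rate c - rate c0| < eta.
Proof.
move=> hc0 eta0; have hcr := r2_rho (r3_r2 hc0); have s0 := rate_gt0 (r3_r2 hc0).
have c00 : 0 < c0 by case/andP: hc0.
(* [t0] is the angle of the equilateral triangle of side [c0]. In a triangle with sides [c0], [c0],
   [c] and [c] close to [c0], both the angle opposite to [c] and a base angle are close to [t0], and
   the sine law makes the ratio of rates a ratio of their sines. *)
have [|t0 /andP[t00 t0pi] Ft0] := @angle_of_side c0 c0 c0 hc0 hc0.
  by rewrite subrr normr0 ltrDl c00.
have st0 : 0 < sin t0 by rewrite sin_gt0_pi // t00.
pose k := Num.min (sin t0 / 2) (eta * sin t0 / (8 * rate c0)).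
have k0 : 0 < k by rewrite lt_min !divr_gt0 ?mulr_gt0.
have k1 : k <= sin t0 / 2 by rewrite ge_min lexx.
have k2 : k * (8 * rate c0) <= eta * sin t0 by rewrite -ler_pdivlMr ?mulr_gt0 // ge_min lexx orbT.
have [|dl dl0 hsin] := econt_continuous (a := 0) (b := pi) (@continuous_sin R) (_ : 0 <= t0 <= pi) k0.
  by rewrite !ltW.
pose dk := Num.min (dl / 2) (Num.min (t0 / 2) ((pi - t0) / 2)).
have dk1 : dk <= dl / 2 by rewrite ge_min lexx.
have dk2 : dk <= t0 / 2 by rewrite !ge_min lexx orbT.
have dk3 : dk <= (pi - t0) / 2 by rewrite !ge_min lexx !orbT.
have dk0 : 0 < dk by rewrite !lt_min !divr_gt0 ?subr_gt0.
have Fp : c0 < F (t0 + dk) c0 c0.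
  by rewrite -[X in X < _]Ft0; apply: iso_F_strict => //; move: t00 dk0 dk3 t0pi; sclear; lra.
have Fm : F (t0 - dk) c0 c0 < c0.
  by rewrite -[X in _ < X]Ft0; apply: iso_F_strict => //; move: t00 dk0 dk2 t0pi; sclear; lra.
pose del := Num.min (Num.min (F (t0 + dk) c0 c0 - c0) (c0 - F (t0 - dk) c0 c0)) (Num.min (c0 / 2) (r3 - c0)).
exists del; first by rewrite !lt_min !subr_gt0 Fp Fm divr_gt0 //; case/andP: hc0.
move=> c cpos; rewrite !lt_min => /andP[/andP[q1 q2] /andP[q3 q4]].
have := q3; rewrite ltr_norml => q3'.
have hc : 0 < c < r3 by rewrite cpos; move: q4; rewrite ltr_norml; sclear; lra.
have hc' := r2_rho (r3_r2 hc).
have near_t0 t : 0 < t < pi -> (`|F t c0 c0 - c0| < del \/ F t c0 c = c0) -> `|t - t0| < dl.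
  move=> /andP[tt0 tpi] ht.
  have hp : 0 <= t0 + dk <= pi by move: t00 dk0 dk3; sclear; lra.
  have hm : 0 <= t0 - dk <= pi by move: t0pi dk0 dk2; sclear; lra.
  have ht' : 0 <= t <= pi by rewrite !ltW.
  suff : t0 - dk < t < t0 + dk by move: dk1 dk0 dl0; rewrite ltr_norml; sclear; lra.
  case: ht => ht.
    move: ht; rewrite !lt_min => /andP[/andP[q1' q2'] _].
    apply/andP; split; apply: (iso_F_lt H _ _ hcr hcr) => //.
      by move: q2'; rewrite ltr_norml; sclear; lra.
    by move: q1'; rewrite ltr_norml; sclear; lra.
  have Lp := Flip hp hcr hc' hcr; have Lm := Flip hm hcr hc' hcr.
  apply/andP; split; apply: (iso_F_lt H _ _ hcr hc') => //; rewrite ht.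
    by move: Lm q2; rewrite ler_norml; set z := `|c - c0|; sclear; lra.
  by move: Lp q1; rewrite ler_norml; set z := `|c - c0|; sclear; lra.
have [|t /andP[tt0 tpi] Ft] := @angle_of_side c0 c0 c hc0 hc0.
  by rewrite subrr normr0 cpos; move: q3'; sclear; lra.
have hth : 0 < t < pi by rewrite tt0.
have [x [p [q [xp xq pq [[thE xpE xqE pqE] [hal pq2 L1 _]]]]]] := triangle_rates hth hc0 hc0.
rewrite Ft in pqE L1.
have hbe : 0 < ang q x p < pi.
  by apply: (ang_interior o H n1 xq xp (sideC pq)); rewrite angC thE.
set be := ang q x p in L1 hbe.
have Fbe : F be c0 c = c0.
  have qx : d q x < rho by rewrite metric_sym xqE; case/andP: hcr.
  have qp : d q p < rho by rewrite metric_sym pqE; case/andP: hc'.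
  by have := dist_ang H qx qp; rewrite xpE (metric_sym q x) xqE (metric_sym q p) pqE.
have n1' : `|t - t0| < dl.
  by apply: near_t0 => //; left; rewrite Ft !lt_min q1 q2 q3 q4.
have n2' : `|be - t0| < dl by apply: near_t0 => //; right.
have S1 := hsin t ltac:(by rewrite !ltW) n1'.
have S2 := hsin be ltac:(case/andP: hbe => *; by rewrite !ltW) n2'.
have sbe : sin t0 / 2 <= sin be by move: S2 k1; rewrite ltr_norml; sclear; lra.
have sbe0 : 0 < sin be by apply: lt_le_trans sbe; rewrite divr_gt0.
have E : (rate c - rate c0) * sin be = rate c0 * (sin t - sin be) by rewrite mulrBl -L1; ring.
have diff : `|sin t - sin be| < 2 * k.
  by move: S1 S2; rewrite !ltr_norml; sclear; lra.
have : `|rate c - rate c0| * sin be < rate c0 * (2 * k).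
  by rewrite -{1}(gtr0_norm sbe0) -normrM E normrM (gtr0_norm s0) ltr_pM2l.
move=> h; have h' : `|rate c - rate c0| * (sin t0 / 2) <= `|rate c - rate c0| * sin be.
  by rewrite ler_wpM2l.
rewrite -(ltr_pM2r st0); move: h h' k2; set z := `|rate c - rate c0|.
have : 0 < eta * sin t0 by rewrite mulr_gt0.
by sclear; lra.
Qed.

End CircleRate.

(** * The functional equation of the generalized sine *)

Section OrdinaryDE.
Variable R : realType.
Implicit Types (f P s : R -> R) (a b c t x l eta : R).

(* [is_derive] is a class; sealing it keeps instance resolution out of the
   explicit derivative computations below. *)
Definition der1 x f l : Prop := is_derive x 1 f l.

Lemma is_derive_eps f x l :
  (forall eta, 0 < eta -> exists2 d, 0 < d & forall t, `|t - x| < d ->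
     `|f t - f x - l * (t - x)| <= eta * `|t - x|) -> der1 x f l.
Proof.
move=> h; have cv : (fun t => t^-1 *: (f (t *: 1 + x) - f x)) @ 0^' --> l.
  apply/cvgrPdist_le => eta eta0; have [d d0 hd] := h _ eta0.
  rewrite near_withinE; apply/nbhs_ballP; exists d => //= t; rewrite /ball /= sub0r normrN => td t0.
  rewrite [t *: 1]/GRing.scale /= mulr1; have := hd (t + x); rewrite addrK => /(_ td) {}hd.
  have -> : l - t^-1 *: (f (t + x) - f x) = - (t^-1 * (f (t + x) - f x - l * t)).
    by rewrite {1}/GRing.scale /=; field.
  rewrite normrN normrM normfV mulrC ler_pdivrMr ?normr_gt0 //.
split; first by apply: cvgP cv.
exact: cvg_lim cv.
Qed.

Lemma derive_eps f x l : der1 x f l -> forall eta, 0 < eta -> exists2 d, 0 < d &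
  forall t, `|t - x| < d -> `|f t - f x - l * (t - x)| <= eta * `|t - x|.
Proof.
move=> [fx fl] eta eta0; have cv : (fun t => t^-1 *: (f (t *: 1 + x) - f x)) @ 0^' --> l.
  by rewrite -fl; exact: fx.
move/cvgrPdist_le : cv => /(_ _ eta0); rewrite near_withinE => /nbhs_ballP[d /= d0 hd].
exists d => // t td; have [->|tx] := eqVneq t x; first by rewrite !subrr mulr0 subr0 normr0 mulr0.
have := hd (t - x); rewrite /ball /= sub0r normrN subr_eq0 => /(_ td tx).
rewrite [(t - x) *: 1]/GRing.scale /= mulr1 subrK /GRing.scale /=.
have tx0 : t - x != 0 by rewrite subr_eq0.
have -> : f t - f x - l * (t - x) = - (l - (t - x)^-1 * (f t - f x)) * (t - x) by field.
by rewrite normrM normrN => h; rewrite ler_wpM2r.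
Qed.

Lemma deriveC_ c x : der1 x (fun=> c : R) 0.
Proof. exact: is_derive_cst. Qed.

Lemma deriveD_ f g x l m : der1 x f l -> der1 x g m ->
  der1 x (fun t => f t + g t) (l + m).
Proof. by move=> hf hg; apply: (@is_deriveD _ _ _ f g x 1 l m hf hg). Qed.

Lemma deriveM_ f g x l m : der1 x f l -> der1 x g m ->
  der1 x (fun t => f t * g t) (f x * m + g x * l).
Proof. by move=> hf hg; apply: (@is_deriveM _ _ f g x 1 l m hf hg). Qed.

Lemma deriveZ_ f c x l : der1 x f l -> der1 x (fun t => c * f t) (c * l).
Proof. move=> hf; have := deriveM_ (deriveC_ c x) hf; rewrite mulr0 addr0; exact. Qed.

Lemma deriveB_ f g x l m : der1 x f l -> der1 x g m ->
  der1 x (fun t => f t - g t) (l - m).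
Proof. by move=> hf hg; apply: (@is_deriveB _ _ _ f g x 1 l m hf hg). Qed.

Lemma deriveN_ f x l : der1 x f l -> der1 x (fun t => - f t) (- l).
Proof. by move=> hf; apply: (@is_deriveN _ _ _ f x 1 l hf). Qed.

Lemma derive_shiftr f x c l : der1 (x + c) f l -> der1 x (fun t => f (t + c)) l.
Proof.
move=> h; have hs : der1 x (shift c) 1 by exact: is_derive_shift.
by have := @is_derive1_comp _ f (shift c) x _ _ h hs; rewrite mulr1.
Qed.

Lemma derive_subl f x c l : der1 (c - x) f l -> der1 x (fun t => f (c - t)) (- l).
Proof.
move=> h; have hs : der1 x (fun t : R => c - t) (0 - 1).
  by apply: deriveB_; [exact: deriveC_|exact: is_derive_id].
by have := @is_derive1_comp _ f (fun t => c - t) x _ _ h hs; rewrite sub0r mulrN1.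
Qed.

Lemma derive_local f g x l c0 c1 : c0 < x < c1 -> (forall t, c0 < t < c1 -> f t = g t) ->
  der1 x g l -> der1 x f l.
Proof.
move=> /andP[x0 x1] fg; apply: near_eq_is_derive.
have h0 : \forall t \near x, c0 < t by exact: lt_nbhsr.
have h1 : \forall t \near x, t < c1 by exact: lt_nbhsl.
by apply: filterS2 h0 h1 => t t0 t1; apply/esym/fg; rewrite t0.
Qed.

Lemma der1_eq f x l m : der1 x f l -> l = m -> der1 x f m.
Proof. by move=> h <-. Qed.

Lemma derive_unique f x l m : der1 x f l -> der1 x f m -> l = m.
Proof. by move=> [_ <-] [_ <-]. Qed.

Lemma derive_cont f x l : der1 x f l -> {for x, continuous f}.
Proof. by move=> [h _]; apply: differentiable_continuous; apply/derivable1_diffP. Qed.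

Lemma derive_mvt_bound f df a b l eta : a < b ->
  (forall t, a <= t <= b -> der1 t f (df t)) ->
  (forall t, a <= t <= b -> `|df t - l| <= eta) -> `|f b - f a - l * (b - a)| <= eta * (b - a).
Proof.
move=> ab df_f hdf; have [||c] := @MVT R f df a b ab.
- by move=> x /itvP xab; apply: df_f; rewrite !xab.
- apply: derivable_within_continuous => x /itvP xab.
  by have [] := df_f x ltac:(by rewrite !xab).
move=> /itvP cab ->; rewrite -mulrBl normrM [`|b - a|]gtr0_norm ?subr_gt0 //.
by rewrite ler_wpM2r ?subr_ge0 ?(ltW ab) // hdf // !cab.
Qed.

Lemma derive0_cst f c : (forall t, 0 < t < c -> der1 t f 0) ->
  forall a b, 0 < a < c -> 0 < b < c -> f a = f b.
Proof.
move=> df a b ha hb; wlog ab : a b ha hb / a < b => [hw|].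
  by case: (ltgtP a b) => [|ba|->] //; [exact: hw|rewrite (hw b a)].
have h : `|f b - f a - 0 * (b - a)| <= 0 * (b - a).
  apply: (@derive_mvt_bound f (fun=> 0)) => // t htab; last by rewrite subrr normr0.
  by apply: df; move: ha hb htab; clear; lra.
by move: h; rewrite mul0r subr0 normr_le0 subr_eq0 => /eqP.
Qed.

Definition lim0 f l := forall eta, 0 < eta -> exists2 d, 0 < d & forall t, 0 < t < d -> `|f t - l| < eta.

Lemma lim0_cst f c l : 0 < c -> lim0 f l -> (forall a b, 0 < a < c -> 0 < b < c -> f a = f b) ->
  forall t, 0 < t < c -> f t = l.
Proof.
move=> c0 fl fc t ht; apply/eqP; rewrite -subr_eq0 -normr_le0; apply/ler_addgt0Pr => eta /fl[d d0 hd].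
rewrite add0r; pose s := Num.min (d / 2) (c / 2).
have s1 : s <= d / 2 by rewrite ge_min lexx.
have s2 : s <= c / 2 by rewrite ge_min lexx orbT.
have s0 : 0 < s by rewrite lt_min !divr_gt0.
rewrite (fc t s) //; first by apply/ltW/hd; move: s0 s1 d0; clear; lra.
by move: s0 s2 c0; clear; lra.
Qed.

Lemma lim0D f g l m : lim0 f l -> lim0 g m -> lim0 (fun t => f t + g t) (l + m).
Proof.
move=> hf hg eta eta0; have e2 : 0 < eta / 2 by rewrite divr_gt0.
have [d d0 hd] := hf _ e2; have [d' d'0 hd'] := hg _ e2.
exists (Num.min d d'); first by rewrite lt_min d0.
move=> t /andP[t0]; rewrite lt_min => /andP[td td'].
have := hd t ltac:(by rewrite t0); have := hd' t ltac:(by rewrite t0).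
rewrite !ltr_norml; clear; lra.
Qed.

Lemma lim0M f g l m : lim0 f l -> lim0 g m -> lim0 (fun t => f t * g t) (l * m).
Proof.
move=> hf hg eta eta0; pose K := `|l| + `|m| + 1.
have K1 : 1 <= K by rewrite lerDr addr_ge0.
have K0 : 0 < K by exact: lt_le_trans K1.
have e2 : 0 < Num.min 1 (eta / (2 * K)) by rewrite lt_min ltr01 divr_gt0 // mulr_gt0.
have [d d0 hd] := hf _ e2; have [d' d'0 hd'] := hg _ e2.
exists (Num.min d d'); first by rewrite lt_min d0.
move=> t /andP[t0]; rewrite lt_min => /andP[td td'].
have := hd t ltac:(by rewrite t0); rewrite lt_min => /andP[f1 f2].
have := hd' t ltac:(by rewrite t0); rewrite lt_min => /andP[g1 g2].
have -> : f t * g t - l * m = (f t - l) * g t + l * (g t - m) by ring.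
apply: le_lt_trans (ler_normD _ _) _; rewrite !normrM.
have gK : `|g t| <= K.
  have -> : g t = m + (g t - m) by ring.
  apply: le_trans (ler_normD _ _) _; rewrite /K; move: g1 (normr_ge0 l); clear; lra.
have lK : `|l| <= K by rewrite /K; move: (normr_ge0 m); clear; lra.
rewrite ltr_pdivlMr ?mulr_gt0 // in f2; rewrite ltr_pdivlMr ?mulr_gt0 // in g2.
have b1 : `|f t - l| * `|g t| <= `|f t - l| * K by rewrite ler_wpM2l.
have b2 : `|l| * `|g t - m| <= K * `|g t - m| by rewrite ler_wpM2r.
move: f2 g2 b1 b2; clear; lra.
Qed.

Lemma lim0_cont f g x : (forall t, 0 < t -> f t = g (x + t)) \/ (forall t, 0 < t -> f t = g (x - t)) ->
  {for x, continuous g} -> lim0 f (g x).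
Proof.
move=> h cg eta eta0; move/cvgrPdist_lt : cg => /(_ _ eta0); rewrite near_simpl => /nbhs_ballP[d /= d0 hd].
exists d => // t /andP[t0 td]; rewrite distrC.
case: h => -> //; apply: hd; rewrite /ball /=.
  by rewrite opprD addrA subrr sub0r normrN gtr0_norm.
by rewrite opprB addrCA subrr addr0 gtr0_norm.
Qed.

Lemma lim0_eq f g c l : 0 < c -> (forall t, 0 < t < c -> f t = g t) -> lim0 g l -> lim0 f l.
Proof.
move=> c0 fg gl eta /gl[d d0 hd]; exists (Num.min c d); first by rewrite lt_min c0.
by move=> t /andP[t0]; rewrite lt_min => /andP[tc td]; rewrite fg ?t0 // hd // t0.
Qed.

Lemma lim0_const l : lim0 (fun=> l) l.
Proof. by move=> eta eta0; exists 1 => // t _; rewrite subrr normr0. Qed.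

Lemma derive_mvt_lim0 f df t l eta : 0 < t -> lim0 f 0 ->
  (forall x, 0 < x <= t -> der1 x f (df x)) ->
  (forall x, 0 < x <= t -> `|df x - l| <= eta) -> `|f t - l * t| <= eta * t.
Proof.
move=> t0 f0 hf hdf; apply/ler_addgt0Pr => e e0.
have [d d0 hd] := f0 (e / 2) ltac:(by rewrite divr_gt0).
have K0 : 0 < `|l| + 1 by rewrite ltr_wpDl.
pose u := Num.min (t / 2) (Num.min (d / 2) (e / 2 / (`|l| + 1))).
have u0 : 0 < u by rewrite !lt_min !divr_gt0.
have u1 : u <= t / 2 by rewrite ge_min lexx.
have u2 : u <= d / 2 by rewrite !ge_min lexx orbT.
have u3 : u <= e / 2 / (`|l| + 1) by rewrite !ge_min lexx !orbT.
have ut : u < t by move: u1 t0; clear; lra.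
have := @derive_mvt_bound f df u t l eta ut.
move=> /(_ (fun x hx => hf x ltac:(move: hx u0; clear; lra)) (fun x hx => hdf x ltac:(move: hx u0; clear; lra))).
have := hd u ltac:(move: u0 u2 d0; clear; lra); rewrite subr0 => fu.
move: u3; rewrite ler_pdivlMr // => u3.
have lu : `|l * u| <= e / 2.
  by rewrite normrM (gtr0_norm u0) mulrC; apply: le_trans u3; rewrite ler_pM2l // lerDl.
have -> : f t - f u - l * (t - u) = (f t - l * t) - (f u - l * u) by ring.
have eta0 : 0 <= eta by apply: le_trans (hdf t _); rewrite ?normr_ge0 // t0 lexx.
move=> h; have -> : f t - l * t = ((f t - l * t) - (f u - l * u)) + (f u - l * u) by ring.
apply: le_trans (ler_normD _ _) _; have := ler_normB (f u) (l * u).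
have : 0 <= eta * u by rewrite mulr_ge0 // ltW.
move: h fu lu; set A := `|_|; set B := `|_|; set D := `|_|; clear; lra.
Qed.

Section GeneralizedSine.
Variables (r : R) (P s : R -> R).
Hypothesis r0 : 0 < r.
Hypothesis s_gt0 : forall t, 0 < t < r -> 0 < s t.
Hypothesis dP : forall t, 0 < t < r -> der1 t P (s t).
Hypothesis P0 : lim0 P 0.
Hypothesis PDB : forall a b, 0 < b -> b < a -> a + b < r ->
  P (a + b) - P (a - b) = 2 * s a * s b.
Local Ltac sclear := clear - R r P s r0 s_gt0 dP P0 PDB.

(** For fixed [b] the functional equation writes [s] as a difference of translates of [P], up to a
    constant factor, so [s] inherits differentiability from [P]. *)
Lemma sine_derive_aux a b : 0 < b -> b < a -> a + b < r ->
  der1 a s ((2 * s b)^-1 * (s (a + b) - s (a - b))).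
Proof.
move=> b0 ba abr.
apply: (@derive_local _ (fun t => (2 * s b)^-1 * (P (t + b) - P (t - b))) _ _ b (r - b)).
- by move: b0 ba abr; sclear; lra.
- move=> t ht; rewrite PDB //; [|by move: ht; sclear; lra|by move: ht; sclear; lra].
  have : s b != 0 by rewrite lt0r_neq0 // s_gt0 //; move: ht b0; sclear; lra.
  by sclear => h; field.
apply: deriveZ_; apply: deriveB_; apply: derive_shiftr; apply: dP; move: b0 ba abr; sclear; lra.
Qed.

Lemma sine_derive_ex a : 0 < a < r -> der1 a s ('D_1 s a).
Proof.
move=> ha; pose b := Num.min (a / 2) ((r - a) / 2).
have b1 : b <= a / 2 by rewrite ge_min lexx.
have b2 : b <= (r - a) / 2 by rewrite ge_min lexx orbT.
have b0 : 0 < b by rewrite lt_min; move: ha; sclear; lra.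
have h : der1 a s ((2 * s b)^-1 * (s (a + b) - s (a - b))).
  by apply: sine_derive_aux => //; move: b0 b1 b2 ha; sclear; lra.
by case: (h) => h1 _; apply: DeriveDef.
Qed.

Section Cosine.
Variable C : R -> R.
Hypothesis sine_derive : forall a, 0 < a < r -> der1 a s (C a).
Local Ltac cclear := clear - R r P s r0 s_gt0 dP P0 PDB C sine_derive.

Lemma sine_CB a b : 0 < b -> b < a -> a + b < r -> s (a + b) - s (a - b) = 2 * C a * s b.
Proof.
move=> b0 ba abr; have ha : 0 < a < r by move: b0 ba abr; cclear; lra.
rewrite (derive_unique (sine_derive ha) (sine_derive_aux b0 ba abr)).
have : s b != 0 by rewrite lt0r_neq0 // s_gt0 //; move: b0 ba abr; cclear; lra.
by cclear => h; field.
Qed.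

(** The functional equation differentiated in [b], now that the derivative of [s] exists. *)
Lemma sine_CD a b : 0 < b -> b < a -> a + b < r -> s (a + b) + s (a - b) = 2 * s a * C b.
Proof.
move=> b0 ba abr; have hb : 0 < b < r by move: b0 ba abr; cclear; lra.
have h1 : der1 b (fun t => P (t + a) - P (a - t)) (s (b + a) - - s (a - b)).
  apply: deriveB_; [apply: derive_shiftr|apply: derive_subl]; apply: dP; move: b0 ba abr; cclear; lra.
have h2 : der1 b (fun t => P (t + a) - P (a - t)) (2 * s a * C b).
  apply: (@derive_local _ (fun t => 2 * s a * s t) _ _ 0 (Num.min a (r - a))).
  - by rewrite b0 lt_min ba; move: abr; cclear; lra.
  - move=> t /andP[t0]; rewrite lt_min => /andP[ta tr]; rewrite [t + a]addrC PDB //.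
    by move: tr; cclear; lra.
  by apply: deriveZ_; apply: sine_derive.
by rewrite -(derive_unique h1 h2) opprK addrC [b + a]addrC addrC.
Qed.

Lemma cosine_derive_aux a b : 0 < b -> b < a -> a + b < r ->
  der1 a C ((2 * s b)^-1 * (C (a + b) - C (a - b))).
Proof.
move=> b0 ba abr.
apply: (@derive_local _ (fun t => (2 * s b)^-1 * (s (t + b) - s (t - b))) _ _ b (r - b)).
- by move: b0 ba abr; cclear; lra.
- move=> t ht; rewrite sine_CB //; [|by move: ht; cclear; lra|by move: ht; cclear; lra].
  have : s b != 0 by rewrite lt0r_neq0 // s_gt0 //; move: ht b0; cclear; lra.
  by cclear => h; field.
by apply: deriveZ_; apply: deriveB_; apply: derive_shiftr; apply: sine_derive; move: b0 ba abr; cclear; lra.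
Qed.

Lemma cosine_derive_ex a : 0 < a < r -> der1 a C ('D_1 C a).
Proof.
move=> ha; pose b := Num.min (a / 2) ((r - a) / 2).
have b1 : b <= a / 2 by rewrite ge_min lexx.
have b2 : b <= (r - a) / 2 by rewrite ge_min lexx orbT.
have b0 : 0 < b by rewrite lt_min; move: ha; cclear; lra.
have h : der1 a C ((2 * s b)^-1 * (C (a + b) - C (a - b))).
  by apply: cosine_derive_aux => //; move: b0 b1 b2 ha; cclear; lra.
by case: (h) => h1 h2; apply: DeriveDef.
Qed.

Section CosineDerivative.
Variable D : R -> R.
Hypothesis cosine_derive : forall a, 0 < a < r -> der1 a C (D a).
Local Ltac dclear := clear - R r P s r0 s_gt0 dP P0 PDB C sine_derive D cosine_derive.

(** [C (a + b) - C (a - b)] is computed by differentiating [sine_CB] in [a] and [sine_CD] in [b].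
    Hence [D / s] is constant, which is where the curvature comes from. *)
Lemma cosine_derive_ratio a b : 0 < b -> b < a -> a + b < r -> D a * s b = s a * D b.
Proof.
move=> b0 ba abr; have hb : 0 < b < r by move: b0 ba abr; dclear; lra.
have ha : 0 < a < r by move: b0 ba abr; dclear; lra.
have sb : s b != 0 by rewrite lt0r_neq0 // s_gt0.
have e1 : C (a + b) - C (a - b) = 2 * D a * s b.
  rewrite (derive_unique (cosine_derive ha) (cosine_derive_aux b0 ba abr)).
  by move: sb; dclear => h; field.
have h1 : der1 b (fun t => s (t + a) + s (a - t)) (C (b + a) + - C (a - b)).
  by apply: deriveD_; [apply: derive_shiftr|apply: derive_subl]; apply: sine_derive; move: b0 ba abr; dclear; lra.
have h2 : der1 b (fun t => s (t + a) + s (a - t)) (2 * s a * D b).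
  apply: (@derive_local _ (fun t => 2 * s a * C t) _ _ 0 (Num.min a (r - a))).
  - by rewrite b0 lt_min ba; move: abr; dclear; lra.
  - move=> t /andP[t0]; rewrite lt_min => /andP[ta tr]; rewrite [t + a]addrC sine_CD //.
    by move: tr; dclear; lra.
  by apply: deriveZ_; apply: cosine_derive.
have := derive_unique h1 h2; rewrite [b + a]addrC e1.
set x := D a; set y := D b; set u := s a; set v := s b; rewrite -!mulrA.
by apply: mulfI; rewrite pnatr_eq0.
Qed.

(** The functional equation at [a = r / 2], solved for [s b]: continuity of [P] in the interior
    determines the behaviour of [s] at 0. *)
Lemma lim0_sine : lim0 s 0.
Proof.
have ha : 0 < r / 2 < r by move: r0; dclear; lra.
have sa := s_gt0 ha; have cP : {for r / 2, continuous P} by exact: derive_cont (dP ha).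
have h1 : lim0 (fun t => P (r / 2 + t) + -1 * P (r / 2 - t)) (P (r / 2) + -1 * P (r / 2)).
  apply: lim0D; first by apply: lim0_cont => //; left.
  by apply: lim0M; [exact: lim0_const|apply: lim0_cont => //; right].
have := lim0M (lim0_const (2 * s (r / 2))^-1) h1.
rewrite mulN1r subrr mulr0; apply: (lim0_eq (c := r / 2)); first by rewrite divr_gt0.
move=> t ht; rewrite mulN1r PDB; [|by move: ht; dclear; lra..].
by move: (lt0r_neq0 sa); set S := s _; dclear => h; field.
Qed.

Lemma lim0_cosine : lim0 C 1.
Proof.
have ha : 0 < r / 2 < r by move: r0; dclear; lra.
have sa := s_gt0 ha; have cs : {for r / 2, continuous s} by exact: derive_cont (sine_derive ha).
have h1 : lim0 (fun t => s (r / 2 + t) + s (r / 2 - t)) (s (r / 2) + s (r / 2)).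
  by apply: lim0D; apply: lim0_cont => //; [left|right].
have := lim0M (lim0_const (2 * s (r / 2))^-1) h1.
have -> : (2 * s (r / 2))^-1 * (s (r / 2) + s (r / 2)) = 1.
  by move: (lt0r_neq0 sa); set S := s _; dclear => h; field.
apply: (lim0_eq (c := r / 2)); first by rewrite divr_gt0.
move=> t ht; rewrite sine_CD; [|by move: ht; dclear; lra..].
by move: (lt0r_neq0 sa); set S := s _; dclear => h; field.
Qed.

(** The first two identities are first integrals: the difference of the sides has derivative 0, and
    its limit at 0 is known. The last one integrates the limit of [C] twice. *)
Lemma generalized_sine_aux : exists k,
  [/\ forall t, 0 < t < r / 2 -> s t ^+ 2 = 2 * P t - k * P t ^+ 2,
    forall a b, 0 < b -> b < a -> a < r / 2 -> P (a - b) = P a + P b - k * P a * P b - s a * s b &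
    forall eta, 0 < eta -> exists2 d, 0 < d & forall t, 0 < t < d -> `|P t - t ^+ 2 / 2| <= eta * t ^+ 2].
Proof.
(* The constant ratio [D / s], sampled at [r / 4], up to sign. *)
pose k := - (D (r / 4) / s (r / 4)).
have r4 : 0 < s (r / 4) by apply: s_gt0; move: r0; dclear; lra.
have r20 : 0 < r / 2 by rewrite divr_gt0.
have dC t : 0 < t < r / 2 -> der1 t C (- k * s t).
  move=> ht; have -> : - k * s t = D t.
    rewrite /k opprK mulrAC; suff -> : D (r / 4) * s t = D t * s (r / 4).
      by rewrite mulfK ?lt0r_neq0.
    case: (ltgtP t (r / 4)) => [tr|tr|<- //].
      by rewrite (@cosine_derive_ratio (r / 4) t) // 1?mulrC //; move: ht tr r0; dclear; lra.
    by rewrite (@cosine_derive_ratio t (r / 4)) // 1?mulrC //; move: ht tr r0; dclear; lra.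
  by apply: cosine_derive; move: ht r0; dclear; lra.
have inr t : 0 < t < r / 2 -> 0 < t < r by move: r0; dclear; lra.
have CP t : 0 < t < r / 2 -> C t = 1 - k * P t.
  move=> ht; suff : C t + k * P t = 1 + k * 0 by rewrite mulr0 addr0 => <-; rewrite addrK.
  apply: (@lim0_cst (fun t => C t + k * P t) (r / 2)) ht => //.
    by apply: lim0D; [exact: lim0_cosine|apply: lim0M => //; exact: lim0_const].
  apply: derive0_cst => u hu; apply: der1_eq.
    by apply: deriveD_; [exact: dC|apply: deriveZ_; exact/dP/inr].
  by rewrite mulNr addNr.
have sP t : 0 < t < r / 2 -> s t ^+ 2 = 2 * P t - k * P t ^+ 2.
  move=> ht; suff : s t * s t + (-2 * P t + k * (P t * P t)) = 0 * 0 + (-2 * 0 + k * (0 * 0)).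
    by rewrite !expr2; dclear; lra.
  apply: (@lim0_cst (fun t => s t * s t + (-2 * P t + k * (P t * P t))) (r / 2)) ht => //.
    apply: lim0D; first by apply: lim0M; exact: lim0_sine.
    by apply: lim0D; (apply: lim0M; first exact: lim0_const) => //; exact: lim0M.
  apply: derive0_cst => u hu; apply: der1_eq.
    apply: deriveD_; first by apply: deriveM_; exact/sine_derive/inr.
    by apply: deriveD_; apply: deriveZ_; [exact/dP/inr|apply: deriveM_; exact/dP/inr].
  by rewrite CP //; ring.
exists k; split => //.
- move=> a b b0 ba ar; have hb : 0 < b < r / 2 by move: b0 ba ar; dclear; lra.
  (* [P t] is written [P (b + t - b)] so that every varying term is a function of [b + t]. The
     derivative vanishes by the addition formulas, and the limit at 0 by the identity for
     [s b ^+ 2]. *)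
  pose f t := P (b + t - b) + (- P (b + t) + (- P b + (k * P b * P (b + t) + s b * s (b + t)))).
  suff : f (a - b) = 0.
    by rewrite /f (_ : b + (a - b) = a); [dclear; lra|dclear; lra].
  have bb : der1 b P (s b) by apply/dP/inr.
  have bs : der1 b s (C b) by exact/sine_derive/inr.
  have -> : 0 = 0 + (- P b + (- P b + (k * P b * P b + s b * s b))).
    by have := sP _ hb; rewrite !expr2; dclear; lra.
  apply: (@lim0_cst f (r / 2 - b)).
  + by move: hb; dclear; lra.
  + apply: lim0D; first by move=> e /P0[d d0 hd]; exists d => // t; rewrite [b + t]addrC addrK; exact: hd.
    apply: lim0D; first by apply: (lim0_cont (g := fun t => - P t)); [left|apply: continuousN; exact: derive_cont bb].
    apply: lim0D; first exact: lim0_const.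
    apply: lim0D; apply: lim0M; try exact: lim0_const.
      by apply: lim0_cont; [left|exact: derive_cont bb].
    by apply: lim0_cont; [left|exact: derive_cont bs].
  + apply: derive0_cst => u hu.
    have hbu : 0 < b + u < r / 2 by move: hu hb; dclear; lra.
    have hu2 : 0 < u < r / 2 by move: hu hb; dclear; lra.
    have d1 (g : R -> R) l : der1 (b + u) g l -> der1 u (fun t => g (b + t)) l.
      rewrite [b + u]addrC => /derive_shiftr; apply: near_eq_is_derive.
      by near=> t; rewrite addrC.
    have e1 := @sine_CB (b + u) b ltac:(move: hu hb; dclear; lra) ltac:(move: hu hb; dclear; lra) ltac:(move: hu hb; dclear; lra).
    have e2 := @sine_CD (b + u) b ltac:(move: hu hb; dclear; lra) ltac:(move: hu hb; dclear; lra) ltac:(move: hu hb; dclear; lra).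
    apply: der1_eq.
      apply: deriveD_; first apply: (d1 (fun t => P (t - b))).
        by apply: derive_shiftr; apply/dP/inr; move: hu hb; dclear; lra.
      apply: deriveD_; first apply: (d1 (fun t => - P t)).
        by apply: deriveN_; exact/dP/inr.
      apply: deriveD_; first exact: deriveC_.
      apply: deriveD_; apply: deriveZ_; first by apply: d1; exact/dP/inr.
      by apply: d1; exact/sine_derive/inr.
    have := CP _ hb; move: e1 e2; set S := s (b + u); set Cu := C (b + u); move=> e1 e2 cb.
    have kPb : k * P b = 1 - C b by move: cb; dclear; lra.
    rewrite kPb; move: e1 e2; rewrite -mulrA -[2 * S * C b]mulrA.
    have -> : (1 - C b) * S = S - S * C b by ring.
    by rewrite [Cu * _]mulrC; set x := s b * Cu; set y := S * C b; dclear; lra.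
  by move: ba ar; dclear; lra.
(* Since [C] tends to 1, the mean value inequality compares [s t] with [t], and then [P t] with
   [t ^ 2 / 2]. *)
- move=> eta eta0; have [d d0 hd] := lim0_cosine eta0.
  have sd t : 0 < t < Num.min d r -> `|s t - t| <= eta * t.
    rewrite lt_min => /and3P[t0 td tr]; rewrite -{2}[t]mul1r.
    apply: (@derive_mvt_lim0 s C) => //; first exact: lim0_sine.
      by move=> x hx; apply: sine_derive; move: hx tr; dclear; lra.
    by move=> x hx; apply/ltW/hd; move: hx td; dclear; lra.
  exists (Num.min d r); first by rewrite lt_min d0.
  move=> t ht; have t0 : 0 < t by case/andP: ht.
  have := @derive_mvt_lim0 (fun x => P x + - (2^-1) * (x * x)) (fun x => s x + - (2^-1) * (x * 1 + x * 1)) t 0 (eta * t) t0.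
  rewrite mul0r subr0 -mulrA -expr2 (_ : - 2^-1 * (t * t) = - (t ^+ 2 / 2)); last by rewrite expr2; ring.
  apply.
  + rewrite -[X in lim0 _ X](addr0 0); apply: lim0D => //.
    rewrite -[X in lim0 _ X](mulr0 (- 2^-1)); apply: lim0M; first exact: lim0_const.
    rewrite -[X in lim0 _ X](mulr0 0); apply: lim0M => e e0; exists e => // x /andP[x0 xe];
      by rewrite subr0 gtr0_norm.
  + move=> x hx; apply: deriveD_.
      by apply: dP; move: hx ht; rewrite lt_min => hx /and3P[_ _]; move: hx; dclear; lra.
    by apply: deriveZ_; apply: deriveM_; exact: is_derive_id.
  + move=> x hx; rewrite subr0 (_ : _ + _ = s x - x); last by dclear; lra.
    apply: le_trans (sd _ _) _; first by move: hx ht => /andP[-> xt] /andP[_]; exact: le_lt_trans.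
    by rewrite ler_pM2l //; case/andP: hx.
Unshelve. all: by end_near. Qed.

End CosineDerivative.
End Cosine.

Lemma generalized_sine : exists k,
  [/\ forall t, 0 < t < r / 2 -> s t ^+ 2 = 2 * P t - k * P t ^+ 2,
    forall a b, 0 < b -> b < a -> a < r / 2 -> P (a - b) = P a + P b - k * P a * P b - s a * s b &
    forall eta, 0 < eta -> exists2 d, 0 < d & forall t, 0 < t < d -> `|P t - t ^+ 2 / 2| <= eta * t ^+ 2].
Proof.
exact: (@generalized_sine_aux (fun t => 'D_1 s t) sine_derive_ex
  (fun t => 'D_1 (fun t => 'D_1 s t) t) (cosine_derive_ex sine_derive_ex)).
Qed.

End GeneralizedSine.

End OrdinaryDE.

(** * The law of cosines in the small *)

Section LawOfCosines.
Variables (R : realType) (Y : metricType R) (n : nat) (rho : R).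
Variables (F : R -> R -> R -> R) (e : Y -> 'rV[R]_n -> Y) (o : Y).
Hypotheses (H : isotropic_space rho F e) (n1 : (1 < n)%N) (rho0 : 0 < rho).
Implicit Types (p q : Y) (u v w : 'rV[R]_n) (s t L a b c th : R).
Local Notation d := (@mdist R Y).
Local Notation r3 := (rho / 64).
Local Notation a0 := (rho / 256).
Local Notation sg := (rate F).
Local Ltac sclear := clear - R Y n rho F e o H n1 rho0.

Lemma r3_rho a : 0 < a < r3 -> 0 <= a < rho.
Proof. by move: rho0; sclear; lra. Qed.

Lemma sg_gt0 a : 0 < a < r3 -> 0 < sg a.
Proof. by move=> ha; apply: (rate_gt0 o H n1 rho0); move: ha rho0; sclear; lra. Qed.

Lemma F_in th a b : 0 < th < pi -> 0 < a -> 0 < b -> a + b < r3 -> 0 < F th a b < r3.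
Proof.
move=> hth a0 b0 ab; have har : 0 <= a < rho by move: a0 b0 ab rho0; sclear; lra.
have hbr : 0 <= b < rho by move: a0 b0 ab rho0; sclear; lra.
have hth' : 0 <= th <= pi by move: hth; sclear; lra.
apply/andP; split; last by apply: le_lt_trans ab; apply: (iso_Fle o H n1).
apply: le_lt_trans (_ : `|a - b| < _); first exact: normr_ge0.
apply: (iso_F_gt_sub o H n1) => //; [move: hth; sclear; lra|by case/andP: har|by case/andP: hbr].
Qed.

Lemma cos_lip t t' : `|cos t - cos t'| <= `|t - t'| :> R.
Proof.
wlog tt : t t' / t' < t => [hw|].
  have [->|] := eqVneq t t'; first by rewrite !subrr.
  rewrite neq_lt => /orP[|] tt; last exact: hw.
  by rewrite distrC [X in _ <= X]distrC; exact: hw.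
have h : `|cos t - cos t' - 0 * (t - t')| <= 1 * (t - t').
  apply: (@derive_mvt_bound _ cos (fun t => - sin t)) => // x _; first exact: is_derive_cos.
  by rewrite subr0 normrN sin_max.
by move: h; rewrite mul0r subr0 mul1r [`|t - t'|]gtr0_norm ?subr_gt0.
Qed.

Lemma econt_F_cos k A th1 th2 a b : 0 <= th1 -> th2 <= pi -> 0 < a < r3 -> 0 < b < r3 -> 0 < A ->
  econt th1 th2 (fun th => k * F th a b + A * cos th).
Proof.
move=> t1 t2 ha hb A0; apply: econtD.
  move=> t ht eta eta0; have k0 : 0 < `|k| + 1 by rewrite ltr_wpDl.
  have ht' : 0 <= t <= pi by move: ht t1 t2; sclear; lra.
  have [|d1 d10 hd1] := iso_cont H (r3_rho ha) (r3_rho hb) ht' (eta := eta / (`|k| + 1)).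
    by rewrite divr_gt0.
  exists d1 => // t' ht2 td; rewrite -mulrBr normrM.
  have := hd1 t' ltac:(move: ht2 t1 t2; sclear; lra) td; rewrite ltr_pdivlMr // => h.
  by apply: le_lt_trans h; rewrite mulrC ler_wpM2l // lerDl.
apply: (@econt_lip _ _ _ A); first exact: ltW.
by move=> t t' _ _; rewrite -mulrBr normrM gtr0_norm // ler_pM2l // cos_lip.
Qed.

(** Integration of the angle derivative [Frate]: where the rate of the third side stays below [k],
    the sum of [k * F] and [sg a * sg b * cos] does not decrease. [growth_ge] fits, because
    [F_rate_ge] supplies only some small increments. *)
Lemma F_cos_le k th1 th2 a b : 0 < th1 -> th1 < th2 -> th2 < pi -> 0 < a -> 0 < b -> a + b < r3 ->
  (forall th, th1 <= th <= th2 -> sg (F th a b) < k) ->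
  sg a * sg b * (cos th1 - cos th2) <= k * (F th2 a b - F th1 a b).
Proof.
move=> t1 t12 t2 a_0 b_0 abr hk; set A := sg a * sg b.
have ha : 0 < a < r3 by move: a_0 b_0 abr; sclear; lra.
have hb : 0 < b < r3 by move: a_0 b_0 abr; sclear; lra.
have A0 : 0 < A by rewrite mulr_gt0 // sg_gt0.
suff : k * F th1 a b + A * cos th1 + 0 * (th2 - th1) <= k * F th2 a b + A * cos th2.
  by sclear; lra.
apply: (@growth_ge _ _ _ 0 (fun th => k * F th a b + A * cos th)); first exact: ltW.
  by apply: econt_F_cos => //; exact: ltW.
move=> t ht; have ht' : 0 < t < pi by move: ht t1 t2; sclear; lra.
have Fin := F_in ht' a_0 b_0 abr; have s0 := sg_gt0 Fin.
have st := sin_gt0_pi ht'; have As : 0 < A * sin t by exact: mulr_gt0.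
pose D := k * Frate F t a b - A * sin t.
have D0 : 0 < D.
  rewrite subr_gt0 /Frate -/A mulrA ltr_pdivlMr // mulrC (ltr_pM2r As).
  by apply: hk; move: ht; sclear; lra.
have k0 : 0 < k by apply: lt_trans s0 _; apply: hk; move: ht; sclear; lra.
have kA0 : 0 < k + A by rewrite addr_gt0.
pose eta := D / (k + A); have eta0 : 0 < eta by rewrite /eta divr_gt0.
have [d1 d10 hd1] := derive_eps (is_derive_cos t) eta0.
have [|del [/andP[del0 del1] _ hF]] := F_rate_ge o H n1 rho0 ht' ha hb eta0 (d0 := Num.min d1 (th2 - t)).
  by rewrite lt_min d10; move: ht; sclear; lra.
move: del1; rewrite lt_min => /andP[deld delt].
exists (t + del); first by move: del0 delt; sclear; lra.
have := hd1 (t + del); rewrite addrAC subrr add0r gtr0_norm // => /(_ deld).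
rewrite ler_norml => /andP[hc _].
have e1 : k * (F t a b + (Frate F t a b - eta) * del) <= k * F (t + del) a b by rewrite ler_pM2l.
have e2 : A * (- (eta * del)) <= A * (cos (t + del) - cos t - - sin t * del) by rewrite ler_pM2l.
have e3 : eta * (k + A) = D by rewrite /eta divfK // lt0r_neq0.
have e4 : eta * (k + A) * del = D * del by rewrite e3.
move: e1 e2 e4; rewrite /D; set f := Frate _ _ _ _; sclear; lra.
Qed.

Lemma F_cos_ge k th1 th2 a b : 0 < th1 -> th1 < th2 -> th2 < pi -> 0 < a -> 0 < b -> a + b < r3 ->
  0 <= k -> (forall th, th1 <= th <= th2 -> k < sg (F th a b)) ->
  k * (F th2 a b - F th1 a b) <= sg a * sg b * (cos th1 - cos th2).
Proof.
move=> t1 t12 t2 a_0 b_0 abr k0 hk; set A := sg a * sg b.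
have ha : 0 < a < r3 by move: a_0 b_0 abr; sclear; lra.
have hb : 0 < b < r3 by move: a_0 b_0 abr; sclear; lra.
have A0 : 0 < A by rewrite mulr_gt0 // sg_gt0.
suff : k * F th2 a b + A * cos th2 <= k * F th1 a b + A * cos th1 + 0 * (th2 - th1).
  by sclear; lra.
apply: (@growth_le _ _ _ 0 (fun th => k * F th a b + A * cos th)); first exact: ltW.
  by apply: econt_F_cos => //; exact: ltW.
move=> t ht; have ht' : 0 < t < pi by move: ht t1 t2; sclear; lra.
have Fin := F_in ht' a_0 b_0 abr; have s0 := sg_gt0 Fin.
have st := sin_gt0_pi ht'; have As : 0 < A * sin t by exact: mulr_gt0.
pose D := A * sin t - k * Frate F t a b.
have D0 : 0 < D.
  rewrite subr_gt0 /Frate -/A mulrA ltr_pdivrMr // [X in _ < X]mulrC (ltr_pM2r As).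
  by apply: hk; move: ht; sclear; lra.
have kA0 : 0 < k + A by rewrite ltr_wpDl.
pose eta := D / (k + A); have eta0 : 0 < eta by rewrite /eta divr_gt0.
have [d1 d10 hd1] := derive_eps (is_derive_cos t) eta0.
have [d2 d20 hd2] := F_rate_le o H n1 rho0 ht' ha hb eta0.
pose del := Num.min (d1 / 2) (Num.min (d2 / 2) (th2 - t)).
have del0 : 0 < del by rewrite !lt_min !divr_gt0 //; move: ht; sclear; lra.
have l1 : del <= d1 / 2 by rewrite ge_min lexx.
have l2 : del <= d2 / 2 by rewrite !ge_min lexx orbT.
have l3 : del <= th2 - t by rewrite !ge_min lexx !orbT.
have [_ hF] := hd2 del ltac:(move: del0 l2 d20; sclear; lra).
exists (t + del); first by move: del0 l3; sclear; lra.
have := hd1 (t + del); rewrite addrAC subrr add0r gtr0_norm // => /(_ ltac:(move: del0 l1 d10; sclear; lra)).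
rewrite ler_norml => /andP[_ hc].
have e1 : k * F (t + del) a b <= k * (F t a b + (Frate F t a b + eta) * del) by rewrite ler_wpM2l.
have e2 : A * (cos (t + del) - cos t - - sin t * del) <= A * (eta * del) by rewrite ler_pM2l.
have e3 : eta * (k + A) = D by rewrite /eta divfK // lt0r_neq0.
have e4 : eta * (k + A) * del = D * del by rewrite e3.
move: e1 e2 e4; rewrite /D; set f := Frate _ _ _ _; sclear; lra.
Qed.

(** The law of cosines in infinitesimal form: [rate c * dc = - rate a * rate b * d (cos th)], with
    an error relative to the change of the third side. Continuity of the rate lets it be replaced by
    its value at [c]. *)
Lemma F_cos_local th a b eta : 0 < th < pi -> 0 < a -> 0 < b -> a + b < r3 -> 0 < eta ->
  exists2 d, 0 < d & forall th', `|th' - th| < d -> 0 < th' < pi /\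
    `|sg a * sg b * (cos th - cos th') - sg (F th a b) * (F th' a b - F th a b)|
      <= eta * `|F th' a b - F th a b|.
Proof.
move=> hth a_0 b_0 abr; set A := sg a * sg b; set c := F th a b.
have ha : 0 < a < r3 by move: a_0 b_0 abr; sclear; lra.
have hb : 0 < b < r3 by move: a_0 b_0 abr; sclear; lra.
have hc := F_in hth a_0 b_0 abr; have s0 := sg_gt0 hc.
(* The lower bound [sg c - eta] for the rate has to be nonnegative in [F_cos_ge]. *)
wlog : eta / eta < sg c => [hw eta0|etac eta0].
  have m0 : 0 < Num.min eta (sg c / 2) by rewrite lt_min eta0 divr_gt0.
  have [||d d0 hd] := hw (Num.min eta (sg c / 2)) => //.
    by rewrite gt_min; apply/orP; right; move: s0; sclear; rewrite -/c; lra.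
  exists d => // th' /hd[h1 h2]; split=> //; apply: le_trans h2 _.
  by rewrite ler_wpM2r // ge_min lexx.
have [del del0 hdel] := rate_cont o H n1 rho0 hc eta0.
have hth' : 0 <= th <= pi by move: hth; sclear; lra.
have [d1 d10 hd1] := iso_cont H (r3_rho ha) (r3_rho hb) hth' del0.
pose d2 := Num.min d1 (Num.min th (pi - th)).
have d20 : 0 < d2 by rewrite !lt_min d10; move: hth; sclear; lra.
exists d2 => // th'; rewrite !lt_min => /and3P[td1].
rewrite !ltr_norml => /andP[t1 _] /andP[_ t2].
have ht' : 0 < th' < pi by move: t1 t2; sclear; lra.
split=> //.
have near x : Num.min th th' <= x <= Num.max th th' -> `|sg (F x a b) - sg c| < eta.
  rewrite ge_min le_max => hx; have hx' : 0 < x < pi.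
    by case/andP: hx => /orP[] x1 /orP[] x2; move: x1 x2 ht' hth; sclear; lra.
  apply: hdel; first by have /andP[] := F_in hx' a_0 b_0 abr.
  apply: hd1; first by move: hx'; sclear; lra.
  move: td1; rewrite !ltr_norml; case/andP: hx => /orP[] x1 /orP[] x2 /andP[]; move: x1 x2 d10; sclear; lra.
case: (ltgtP th' th) => [tt|tt|->]; last by rewrite !subrr !mulr0 subrr !normr0 mulr0.
- have Fm := iso_F_strict o H n1 rho0 (ltW (proj1 (andP ht'))) tt (proj2 (andP hth')) ha hb.
  have h1 := @F_cos_le (sg c + eta) th' th a b (proj1 (andP ht')) tt (proj2 (andP hth)) a_0 b_0 abr.
  have h2 := @F_cos_ge (sg c - eta) th' th a b (proj1 (andP ht')) tt (proj2 (andP hth)) a_0 b_0 abr.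
  have hx x : th' <= x <= th -> `|sg (F x a b) - sg c| < eta.
    by move=> hx; apply: near; rewrite (min_idPr (ltW tt)) (max_idPl (ltW tt)).
  have {}h1 := h1 (fun x h => ltac:(have := hx x h; rewrite ltr_norml; sclear; lra)).
  have {}h2 := h2 ltac:(rewrite subr_ge0; exact: ltW) (fun x h => ltac:(have := hx x h; rewrite ltr_norml; sclear; lra)).
  rewrite -/c -/A in h1 h2 Fm; rewrite [`|F _ _ _ - c|]ltr0_norm ?subr_lt0 // ler_norml.
  by apply/andP; split; move: h1 h2; sclear; lra.
- have Fm := iso_F_strict o H n1 rho0 (proj1 (andP hth')) tt (ltW (proj2 (andP ht'))) ha hb.
  have h1 := @F_cos_le (sg c + eta) th th' a b (proj1 (andP hth)) tt (proj2 (andP ht')) a_0 b_0 abr.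
  have h2 := @F_cos_ge (sg c - eta) th th' a b (proj1 (andP hth)) tt (proj2 (andP ht')) a_0 b_0 abr.
  have hx x : th <= x <= th' -> `|sg (F x a b) - sg c| < eta.
    by move=> hx; apply: near; rewrite (min_idPl (ltW tt)) (max_idPr (ltW tt)).
  have {}h1 := h1 (fun x h => ltac:(have := hx x h; rewrite ltr_norml; sclear; lra)).
  have {}h2 := h2 ltac:(rewrite subr_ge0; exact: ltW) (fun x h => ltac:(have := hx x h; rewrite ltr_norml; sclear; lra)).
  rewrite -/c -/A in h1 h2 Fm; rewrite [`|F _ _ _ - c|]gtr0_norm ?subr_gt0 // ler_norml.
  by apply/andP; split; move: h1 h2; sclear; lra.
Qed.

End LawOfCosines.

Lemma econt_const (R : realType) (a b : R) g : a < b -> econt a b g ->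
  (forall t t', a < t < b -> a < t' < b -> g t = g t') ->
  forall t t', a <= t <= b -> a <= t' <= b -> g t = g t'.
Proof.
move=> ab hg gc; pose m := (a + b) / 2.
have hm : a < m < b by rewrite /m; clear -ab; lra.
suff h t : a <= t <= b -> g t = g m by move=> t t' ht ht'; rewrite !h.
move=> ht; apply/eqP; rewrite -subr_eq0 -normr_le0; apply/ler_addgt0Pr => eta eta0; rewrite add0r.
have [d d0 hd] := hg t ht eta eta0.
have [t' ht' td] : exists2 t', a < t' < b & `|t' - t| < d.
  case: (ltgtP t m) => [tm|tm|->]; last by exists m => //; rewrite subrr normr0.
    exists (Num.min m (t + d / 2)).
      by rewrite lt_min gt_min; move: ht hm tm d0; clear; lra.
    have h1 : Num.min m (t + d / 2) <= t + d / 2 by rewrite ge_min lexx orbT.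
    have h2 : t <= Num.min m (t + d / 2) by rewrite le_min; move: tm d0; clear; lra.
    by rewrite ger0_norm ?subr_ge0 //; move: h1 d0; clear; lra.
  exists (Num.max m (t - d / 2)).
    by rewrite lt_max gt_max; move: ht hm tm d0; clear; lra.
  have h1 : t - d / 2 <= Num.max m (t - d / 2) by rewrite le_max lexx orbT.
  have h2 : Num.max m (t - d / 2) <= t by rewrite ge_max; move: tm d0; clear; lra.
  by rewrite distrC ger0_norm ?subr_ge0 //; move: h1 d0; clear; lra.
rewrite (gc m t') // distrC; apply/ltW/hd => //; move: ht'; clear; lra.
Qed.

(* [P] is a generalized haversine and [s] a generalized sine: for curvature
   [k > 0] one has [P t = (1 - cos (sqrt k * t)) / k] and
   [s t = sin (sqrt k * t) / sqrt k]. *)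
Record cosine_law (R : realType) (Y : metricType R) (n : nat) (r0 k : R) (P s : R -> R)
    (e : Y -> 'rV[R]_n -> Y) : Prop := CosineLaw {
  cl_P0 : P 0 = 0 ;
  cl_s0 : s 0 = 0 ;
  cl_mono : forall a b, 0 <= a -> a < b -> b < 2 * r0 -> P a < P b ;
  cl_cont : forall c eta, 0 <= c < 2 * r0 -> 0 < eta -> exists2 d, 0 < d &
    forall c', 0 <= c' < 2 * r0 -> `|c' - c| < d -> `|P c' - P c| < eta ;
  cl_s_gt0 : forall t, 0 < t < r0 -> 0 < s t ;
  cl_sq : forall t, 0 <= t < r0 -> s t ^+ 2 = 2 * P t - k * P t ^+ 2 ;
  cl_asym : forall eta, 0 < eta -> exists2 d, 0 < d &
    forall t, 0 < t < d -> `|P t - t ^+ 2 / 2| <= eta * t ^+ 2 ;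
  cl_law : forall p v w a b, esphere v -> esphere w -> 0 <= a < r0 -> 0 <= b < r0 ->
    P (mdist (e p (a *: v)) (e p (b *: w))) =
      P a + P b - k * P a * P b - s a * s b * edot v w
}.

(** * The primitive of the rate and the law of cosines *)

Section Haversine.
Variables (R : realType) (Y : metricType R) (n : nat) (rho : R).
Variables (F : R -> R -> R -> R) (e : Y -> 'rV[R]_n -> Y) (o : Y).
Hypotheses (H : isotropic_space rho F e) (n1 : (1 < n)%N) (rho0 : 0 < rho).
Implicit Types (p q : Y) (u v w : 'rV[R]_n) (s t L a b c th : R).
Local Notation d := (@mdist R Y).
Local Notation r4 := (rho / 128).
Local Notation a0 := (rho / 256).
Local Notation sg := (rate F).
Local Ltac sclear := clear - R Y n rho F e o H n1 rho0.

Definition hav_angle c := xget 0 [set th | 0 < th < pi /\ F th a0 a0 = c].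

(** The law of cosines for triangles with two sides [a0], read as a definition of [P]; [a0] is an
    arbitrary small length. The value at 0 is set to match the limit. *)
Definition hav c := if 0 < c then sg a0 * sg a0 * (1 - cos (hav_angle c)) else 0.

Definition gsin c := if 0 < c then sg c else 0.

Lemma a0_r3 : 0 < a0 < rho / 64. Proof. by move: rho0; sclear; lra. Qed.

Lemma hav_angleP c : 0 < c < r4 -> 0 < hav_angle c < pi /\ F (hav_angle c) a0 a0 = c.
Proof.
move=> hc; rewrite /hav_angle; apply: (xgetPex 0 (P := [set th | 0 < th < pi /\ F th a0 a0 = c])).
have [|th h1 h2] := angle_of_side H rho0 a0_r3 a0_r3 (c := c); last by exists th.
by rewrite subrr normr0; move: hc; sclear; lra.
Qed.

Lemma hav_angle_lt c th : 0 < c < r4 -> 0 < th < pi -> c < F th a0 a0 -> hav_angle c < th.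
Proof.
move=> hc hth cF; rewrite ltNge; apply/negP => h.
have [ht E] := hav_angleP hc.
have : F th a0 a0 <= F (hav_angle c) a0 a0.
  apply: (iso_mono H) => //; move: hth ht rho0; sclear; lra.
by rewrite E leNgt cF.
Qed.

Lemma hav_angle_gt c th : 0 < c < r4 -> 0 < th < pi -> F th a0 a0 < c -> th < hav_angle c.
Proof.
move=> hc hth cF; rewrite ltNge; apply/negP => h.
have [ht E] := hav_angleP hc.
have : F (hav_angle c) a0 a0 <= F th a0 a0.
  apply: (iso_mono H) => //; move: hth ht rho0; sclear; lra.
by rewrite E leNgt cF.
Qed.

(** [F_cos_local] for two sides [a0] is exactly the estimate of the difference quotient. Strict
    monotonicity of [F] in the angle makes the angles of nearby lengths close. *)
Lemma hav_derive c : 0 < c < r4 -> der1 c hav (sg c).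
Proof.
move=> hc; apply: is_derive_eps => eta eta0.
have [hth cE] := hav_angleP hc; set th := hav_angle c in hth cE *.
have a00 : 0 < a0 by case/andP: a0_r3.
have aa : a0 + a0 < rho / 64 by move: rho0; sclear; lra.
have [d1 d10 hd1] := F_cos_local o H n1 rho0 hth a00 a00 aa eta0.
pose d2 := Num.min d1 (Num.min th (pi - th)) / 2.
have d20 : 0 < d2 by rewrite /d2 divr_gt0 // !lt_min d10; move: hth; sclear; lra.
have [l1 l2 l3] : [/\ d2 <= d1 / 2, d2 <= th / 2 & d2 <= (pi - th) / 2].
  by rewrite /d2; split; rewrite ler_pM2r // !ge_min lexx ?orbT.
have m1 := @iso_F_strict _ _ _ _ _ _ o H n1 rho0 (th - d2) th a0 a0 _ _ _ a0_r3 a0_r3.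
have {}m1 := m1 ltac:(move: l2 d20 hth; sclear; lra) ltac:(move: d20; sclear; lra) ltac:(move: hth; sclear; lra).
have m2 := @iso_F_strict _ _ _ _ _ _ o H n1 rho0 th (th + d2) a0 a0 _ _ _ a0_r3 a0_r3.
have {}m2 := m2 ltac:(move: hth; sclear; lra) ltac:(move: d20; sclear; lra) ltac:(move: d20 l3 hth; sclear; lra).
rewrite cE in m1 m2.
exists (Num.min (c - F (th - d2) a0 a0) (F (th + d2) a0 a0 - c)).
  by rewrite lt_min !subr_gt0 m1.
move=> t; rewrite lt_min !ltr_norml => /andP[/andP[t1 _] /andP[_ t2]].
have F1 : 0 <= F (th - d2) a0 a0.
  by apply: (chord_ge0 H); move: rho0 d20 l2 hth; sclear; lra.
have F2 : F (th + d2) a0 a0 <= a0 + a0.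
  by apply: (iso_Fle o H n1); move: rho0 d20 l3 hth; sclear; lra.
have ht : 0 < t < r4 by move: t1 t2 F1 F2; sclear; lra.
have g1 : th - d2 < hav_angle t by apply: hav_angle_gt => //; move: t1 l2 d20 hth; sclear; lra.
have g2 : hav_angle t < th + d2 by apply: hav_angle_lt => //; move: t2 l3 d20 hth; sclear; lra.
have [] := hd1 (hav_angle t); first by rewrite ltr_norml; move: g1 g2 l1 d10; sclear; lra.
move=> _; have [_ ->] := hav_angleP ht; rewrite cE => h; apply: le_trans h.
by rewrite /hav !ifT; [|by case/andP: hc|by case/andP: ht]; rewrite le_eqVlt; apply/orP; left; apply/eqP; congr `|_|; rewrite -/th; ring.
Qed.

Lemma hav0 : hav 0 = 0. Proof. by rewrite /hav ltxx. Qed.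

Lemma hav_mono a b : 0 <= a -> a < b -> b < r4 -> hav a < hav b.
Proof.
move=> a_0 ab br; have hb : 0 < b < r4 by move: a_0 ab br; sclear; lra.
have [hth bE] := hav_angleP hb; have A0 : 0 < sg a0 * sg a0 by rewrite mulr_gt0 ?(sg_gt0 o H n1 rho0) // a0_r3.
have c1 c c' : 0 <= c -> c < c' -> c' <= pi -> cos c' < cos c :> R.
  by move=> c0 cc c'pi; rewrite ltr_cos // in_itv /=; move: c0 cc c'pi; sclear; lra.
rewrite /hav; have [a00|] := ltP 0 a; last first.
  move=> _; rewrite ifT; last by case/andP: hb.
  by rewrite mulr_gt0 // subr_gt0 -[X in _ < X]cos0; apply: c1 => //; [case/andP: hth|move: hth; sclear; lra].
have ha : 0 < a < r4 by move: a00 ab br; sclear; lra.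
have [hta aE] := hav_angleP ha.
rewrite ifT; last by case/andP: hb.
rewrite ltr_pM2l // ltrD2l ltrN2; apply: c1; [by case/andP: hta => /ltW| |by case/andP: hth => _ /ltW].
by apply: hav_angle_lt => //; rewrite bE.
Qed.

Lemma lim0_hav : lim0 hav 0.
Proof.
have A0 : 0 < sg a0 * sg a0 by rewrite mulr_gt0 ?(sg_gt0 o H n1 rho0) // a0_r3.
move=> eta eta0; have p0 := pi_gt0 R.
pose th := Num.min (pi / 2) (eta / (2 * (sg a0 * sg a0))).
have th0 : 0 < th by rewrite lt_min !divr_gt0 // mulr_gt0.
have l1 : th <= pi / 2 by rewrite ge_min lexx.
have l2 : th <= eta / (2 * (sg a0 * sg a0)) by rewrite ge_min lexx orbT.
have hth : 0 < th < pi by move: th0 l1 p0; sclear; lra.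
have hF := F_in o H n1 rho0 hth (proj1 (andP a0_r3)) (proj1 (andP a0_r3)) ltac:(move: rho0; sclear; lra).
exists (Num.min r4 (F th a0 a0)); first by rewrite lt_min divr_gt0 //; case/andP: hF.
move=> t /andP[t0]; rewrite lt_min => /andP[tr tF].
have ht : 0 < t < r4 by rewrite t0.
have [ha _] := hav_angleP ht; have lt := hav_angle_lt ht hth tF.
rewrite subr0 /hav t0 normrM [`|_ * _|]gtr0_norm //.
apply: le_lt_trans (_ : sg a0 * sg a0 * th < _).
  rewrite ler_pM2l // -cos0; apply: le_trans (cos_lip _ _) _.
  by rewrite sub0r normrN gtr0_norm; [exact: ltW|case/andP: ha].
move: l2; rewrite ler_pdivlMr; last by rewrite mulr_gt0.
move: eta0; set A := sg a0 * sg a0; set x := th; sclear; lra.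
Qed.

Lemma hav_cont c eta : 0 <= c < r4 -> 0 < eta -> exists2 d, 0 < d &
  forall c', 0 <= c' < r4 -> `|c' - c| < d -> `|hav c' - hav c| < eta.
Proof.
move=> /andP[]; rewrite le_eqVlt => /orP[/eqP <- _|c0 cr] eta0.
  have [d1 d10 hd1] := lim0_hav eta0; exists d1 => // c'.
  rewrite hav0 le_eqVlt subr0 => /andP[/orP[/eqP <- _ _|c'0 _]]; first by rewrite hav0 subrr normr0.
  by rewrite gtr0_norm // => h; apply: hd1; rewrite c'0.
have [|d1 d10 hd1] := derive_eps (@hav_derive c _) (eta := 1) ltr01; first by rewrite c0.
have sg0 : 0 < sg c by apply: (sg_gt0 o H n1 rho0); move: c0 cr; sclear; lra.
have K0 : 0 < sg c + 1 by rewrite addr_gt0.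
exists (Num.min d1 (eta / (sg c + 1))); first by rewrite lt_min d10 divr_gt0.
move=> c' _; rewrite lt_min ltr_pdivlMr // => /andP[h1 h2].
have := hd1 _ h1; rewrite mul1r => h3; apply: le_lt_trans h2.
have -> : hav c' - hav c = (hav c' - hav c - sg c * (c' - c)) + sg c * (c' - c) by ring.
apply: le_trans (ler_normD _ _) _; rewrite normrM (gtr0_norm sg0).
by move: h3; sclear; lra.
Qed.

(** The chain rule, with the inner function [F] known only through [F_cos_local]: the change of
    [hav] is [sg c * D] up to a small multiple of [|D|], and [sg c * D] cancels the change of the
    cosine term up to the same order. *)
Lemma hav_law_der a b th : 0 < a -> 0 < b -> a + b < r4 -> 0 < th < pi ->
  der1 th (fun th => hav (F th a b) + sg a * sg b * cos th) 0.
Proof.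
move=> a_0 b_0 ab hth; set A := sg a * sg b; set c := F th a b.
have ab3 : a + b < rho / 64 by move: ab rho0; sclear; lra.
have ha : 0 < a < rho / 64 by move: a_0 b_0 ab3; sclear; lra.
have hb : 0 < b < rho / 64 by move: a_0 b_0 ab3; sclear; lra.
have har := r3_rho rho0 ha; have hbr := r3_rho rho0 hb.
have hth' : 0 <= th <= pi by move: hth; sclear; lra.
have A0 : 0 < A by rewrite mulr_gt0 // (sg_gt0 o H n1 rho0).
have hc : 0 < c < r4.
  have /andP[-> _] := F_in o H n1 rho0 hth a_0 b_0 ab3.
  by apply: le_lt_trans ab; exact: (iso_Fle o H n1).
have sc0 : 0 < sg c by apply: (sg_gt0 o H n1 rho0); move: hc rho0; sclear; lra.
apply: is_derive_eps => eta eta0.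
have A4 : 0 < 4 * A by apply: mulr_gt0.
pose z := Num.min (sg c / 2) (eta * sg c / (4 * A)).
have z0 : 0 < z by rewrite lt_min !divr_gt0 // mulr_gt0.
have z1 : z <= sg c / 2 by rewrite ge_min lexx.
have z2 : z <= eta * sg c / (4 * A) by rewrite ge_min lexx orbT.
have [d1 d10 hd1] := F_cos_local o H n1 rho0 hth a_0 b_0 ab3 z0.
have [d2 d20 hd2] := derive_eps (hav_derive hc) z0.
have [d3 d30 hd3] := iso_cont H har hbr hth' d20.
exists (Num.min d1 d3); first by rewrite lt_min d10.
move=> t; rewrite lt_min => /andP[t1 t3]; have [ht e1] := hd1 _ t1.
have := hd2 _ (hd3 t ltac:(move: ht; sclear; lra) t3).
move: e1; rewrite -/A -/c mul0r subr0; set D := F t a b - c => e1 e2.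
have -> : hav (F t a b) + A * cos t - (hav c + A * cos th) =
  (hav (F t a b) - hav c - sg c * D) - (A * (cos th - cos t) - sg c * D) by ring.
apply: le_trans (ler_normB _ _) _.
(* The local law bounds [|D|] itself by a multiple of [|t - th|], since [z] is at most [sg c / 2];
   errors relative to [|D|] are thus small relative to [|t - th|]. *)
have e3 : sg c * `|D| <= A * `|t - th| + z * `|D|.
  rewrite -{1}(gtr0_norm sc0) -normrM.
  have -> : sg c * D = A * (cos th - cos t) - (A * (cos th - cos t) - sg c * D) by ring.
  apply: le_trans (ler_normB _ _) _; apply: lerD => //.
  by rewrite normrM gtr0_norm // ler_pM2l // distrC [X in _ <= X]distrC distrC; exact: cos_lip.
have e4 : z * `|D| <= sg c / 2 * `|D| by rewrite ler_wpM2r.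
have e5 : z * (2 * A) * `|D| <= eta * sg c / 2 * `|D|.
  rewrite ler_wpM2r //; move: z2; rewrite (ler_pdivlMr _ _ A4).
  by sclear; lra.
have e6 : sg c * (z * `|D|) <= z * (2 * A) * `|t - th|.
  have : z * (sg c * `|D|) <= z * (2 * (A * `|t - th|)) by rewrite ler_pM2l //; move: e3 e4; sclear; lra.
  by sclear; set x := `|D|; set y := `|_|; lra.
have e7 : z * (2 * A) * `|t - th| <= eta * sg c / 2 * `|t - th|.
  rewrite ler_wpM2r //; move: z2; rewrite (ler_pdivlMr _ _ A4).
  by sclear; lra.
have e8 : sg c * (z * `|D|) <= sg c * (eta / 2 * `|t - th|).
  by apply: le_trans e6 _; apply: le_trans e7 _; sclear; set y := `|_|; lra.
rewrite ler_pM2l // in e8.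
by move: e1 e2 e8; sclear; lra.
Qed.

Lemma hav_law a b th th' : 0 < a -> 0 < b -> a + b < r4 -> 0 <= th <= pi -> 0 <= th' <= pi ->
  hav (F th a b) + sg a * sg b * cos th = hav (F th' a b) + sg a * sg b * cos th'.
Proof.
move=> a_0 b_0 ab hth hth'; have p0 := pi_gt0 R.
have ha : 0 < a < rho / 64 by move: a_0 b_0 ab rho0; sclear; lra.
have hb : 0 < b < rho / 64 by move: a_0 b_0 ab rho0; sclear; lra.
have har := r3_rho rho0 ha; have hbr := r3_rho rho0 hb.
have A0 : 0 < sg a * sg b by rewrite mulr_gt0 // (sg_gt0 o H n1 rho0).
have Fin t : 0 <= t <= pi -> 0 <= F t a b < r4.
  move=> ht; apply/andP; split; last by apply: le_lt_trans ab; exact: (iso_Fle o H n1).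
  by apply: le_trans (iso_Fge H ht har hbr); exact: normr_ge0.
apply: (@econt_const _ 0 pi (fun th => hav (F th a b) + sg a * sg b * cos th)) => //.
  apply: econtD; last first.
    apply: (@econt_lip _ _ _ (sg a * sg b)); first exact: ltW.
    by move=> t t' _ _; rewrite -mulrBr normrM gtr0_norm // ler_pM2l // cos_lip.
  move=> t ht eta eta0; have [d1 d10 hd1] := hav_cont (Fin t ht) eta0.
  have [d2 d20 hd2] := iso_cont H har hbr ht d10; exists d2 => // t' ht' td.
  by apply: hd1; [exact: Fin|exact: hd2].
by apply: derive0_cst => t ht; exact: hav_law_der.
Qed.

Lemma hav_addsub a b : 0 < b -> b < a -> a + b < r4 ->
  hav (a + b) - hav (a - b) = 2 * sg a * sg b.
Proof.
move=> b_0 ba ab; have p0 := pi_gt0 R.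
have := @hav_law a b 0 pi ltac:(move: b_0 ba; sclear; lra) b_0 ab.
rewrite lexx (ltW p0) cos0 cospi (iso_F0 H) 1?(iso_Fpi H); try by move: b_0 ba ab rho0; sclear; lra.
rewrite [`|a - b|]gtr0_norm ?subr_gt0 // lexx => /(_ isT isT).
by set x := hav _; set y := hav _; set z := sg a; set w := sg b; sclear; lra.
Qed.

Lemma cosine_law_ge2 : exists k, cosine_law a0 k hav gsin e.
Proof.
have r40 : 0 < r4 by rewrite divr_gt0.
have rr : 2 * a0 = r4 by field.
have sg0 t : 0 < t < r4 -> 0 < sg t.
  by move=> ht; apply: (sg_gt0 o H n1 rho0); move: ht rho0; sclear; lra.
have [k [h1 h2 h3]] := generalized_sine r40 sg0 hav_derive lim0_hav hav_addsub.
have r42 : r4 / 2 = a0 by field.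
rewrite r42 in h1 h2; exists k.
have gE t : 0 < t -> gsin t = sg t by rewrite /gsin => ->.
have sq t : 0 <= t < a0 -> gsin t ^+ 2 = 2 * hav t - k * hav t ^+ 2.
  move=> /andP[]; rewrite le_eqVlt => /orP[/eqP <- _|t0 ta]; last by rewrite gE // h1 // t0.
  by rewrite /gsin ltxx hav0 expr0n /= !mulr0 subr0.
split => //; rewrite ?rr.
- exact: hav0.
- by rewrite /gsin ltxx.
- exact: hav_mono.
- exact: hav_cont.
- by move=> t ht; rewrite gE; [apply: sg0; move: ht rho0; sclear; lra|case/andP: ht].
have pos (c : R) : 0 <= c -> c = 0 \/ 0 < c.
  by rewrite le_eqVlt => /orP[/eqP <-|]; [left|right].
move=> p v w a b hv hw ha hb.
have har : 0 <= a < rho by move: ha rho0; sclear; lra.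
have hbr : 0 <= b < rho by move: hb rho0; sclear; lra.
rewrite (iso_dist H) //; have hth := angle_itv hv hw; rewrite -(cos_angle hv hw).
move: (angle v w) hth => th hth.
have [a00|a_0] := pos a (proj1 (andP ha)).
  have -> : F th a b = b.
    have := iso_Fge H hth har hbr; have := iso_Fle o H n1 hth har hbr.
    rewrite a00 sub0r add0r normrN ger0_norm; last by case/andP: hb.
    by move=> f1 f2; apply/eqP; rewrite eq_le f1.
  by rewrite a00 /gsin ltxx hav0; ring.
have [b00|b_0] := pos b (proj1 (andP hb)).
  have -> : F th a b = a.
    have := iso_Fge H hth har hbr; have := iso_Fle o H n1 hth har hbr.
    rewrite b00 subr0 addr0 ger0_norm; last by case/andP: ha.
    by move=> f1 f2; apply/eqP; rewrite eq_le f1.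
  by rewrite b00 /gsin ltxx hav0; ring.
rewrite !gE //; wlog ba : a b ha hb har hbr a_0 b_0 / b <= a => [hw'|].
  have [ba|/ltW ab] := leP b a; first exact: hw'.
  by rewrite (iso_Fsym o H n1) // hw' //; ring.
(* Comparison with the angle 0, where the third side is [a - b] and the subtraction formula for [P]
   applies. *)
have := @hav_law a b th 0 a_0 b_0 ltac:(move: ha hb rho0; sclear; lra) hth.
rewrite cos0 (iso_F0 H) // [`|a - b|]ger0_norm ?subr_ge0 // lexx (ltW (pi_gt0 R)) => /(_ isT).
have -> : hav (a - b) = hav a + hav b - k * hav a * hav b - sg a * sg b.
  move: ba; rewrite le_eqVlt => /orP[/eqP ->|ba]; last by apply: h2 => //; case/andP: ha.
  by have := sq a ha; rewrite subrr hav0 gE // !expr2; set x := hav a; set y := sg a; sclear; lra.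
by set x := hav _; set y := hav a; set z := hav b; set q := cos _; sclear; lra.
Qed.

End Haversine.

(** On a line, unit vectors make only the angles 0 and pi, and the law says that the square of
    [a - b] or [a + b] expands as usual, with [k = 0]. *)
Lemma cosine_law_dim1 (R : realType) (Y : metricType R) (rho : R) F (e : Y -> 'rV[R]_1 -> Y) :
  isotropic_space rho F e -> 0 < rho -> cosine_law (rho / 2) 0 (fun t => t ^+ 2 / 2) id e.
Proof.
move=> H rho0; split=> //.
- by rewrite expr0n mul0r.
- by move=> a b a0 ab _; rewrite ltr_pM2r // ltr_pXn2r ?nnegrE //; apply: ltW; exact: le_lt_trans ab.
- move=> c eta hc eta0; have K0 : 0 < 2 * rho by rewrite mulr_gt0.
  exists (eta / (2 * rho)); first by rewrite divr_gt0.
  move=> c' hc'; rewrite ltr_pdivlMr // => h; apply: le_lt_trans h.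
  have -> : c' ^+ 2 / 2 - c ^+ 2 / 2 = (c' - c) * ((c' + c) / 2) by field.
  rewrite normrM ler_wpM2l // ger0_norm; move: hc hc' rho0; clear; lra.
- by move=> t /andP[].
- by move=> t _; rewrite mul0r subr0 mulrC divfK // pnatr_eq0.
- by move=> eta eta0; exists 1 => // t _; rewrite subrr normr0 mulr_ge0 ?sqr_ge0 // ltW.
move=> p v w a b hv hw ha hb.
have har : 0 <= a < rho by move: ha rho0; clear; lra.
have hbr : 0 <= b < rho by move: hb rho0; clear; lra.
rewrite (iso_dist H) //.
have E (u u' : 'rV[R]_1) : edot u u' = u 0 0 * u' 0 0 by rewrite /edot mxE big_ord1 mxE.
have : edot v w ^+ 2 = 1.
  have := esphereP v; have := esphereP w; rewrite !E => -[h1 _] [h2 _].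
  by rewrite exprMn !expr2 h1 // h2 // mul1r.
move/eqP; rewrite sqrf_eq1 /angle => /orP[] /eqP ->.
  rewrite acos1 (iso_F0 H) //; have /real_normK -> := num_real (a - b).
  by field.
by rewrite acosN1 (iso_Fpi H); [field|case/andP: ha|case/andP: hb|move: ha hb; clear; lra].
Qed.

Lemma cosine_law_ex (R : realType) (Y : metricType R) (n : nat) (rho : R) F
    (e : Y -> 'rV[R]_n -> Y) (o : Y) : isotropic_space rho F e -> 0 < rho -> (0 < n)%N ->
  exists r0 k P s, [/\ 0 < r0, r0 < rho & cosine_law r0 k P s e].
Proof.
move=> H rho0; case: n e H => [//|[|n]] e H _.
  exists (rho / 2), 0, (fun t => t ^+ 2 / 2), id; split; [by rewrite divr_gt0|move: rho0; clear; lra|].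
  exact: cosine_law_dim1 H rho0.
have [k hk] := cosine_law_ge2 o H isT rho0.
by exists (rho / 256), k, (hav rho F), (gsin F); split=> //; [rewrite divr_gt0|move: rho0; clear; lra].
Qed.

(** * Homogeneity *)

Lemma edot_dim1 (R : realType) (n : nat) (u v : 'rV[R]_n) : (n <= 1)%N ->
  edot u v ^+ 2 = edot u u * edot v v.
Proof.
case: n u v => [|[|//]] u v _; first by rewrite !edotE !big_ord0 expr0n mulr0.
by rewrite !edotE !big_ord1; ring.
Qed.

Section Midpoints.
Variables (R : realType) (Y : metricType R).
Hypothesis hlength : complete_length_space Y.
Implicit Types (x y p o : Y).
Local Notation d := (@mdist R Y).

Lemma dist_lip x y y' : `|d x y - d x y'| <= d y y'.
Proof.
rewrite ler_norml; have := metric_triangle x y y'; have := metric_triangle x y' y.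
by rewrite (metric_sym y' y); lra.
Qed.

(** A minimizing curve meets the sphere of half the distance about [x]. The partition with that
    single interior point bounds the sum of the two distances by the length. *)
Lemma midpoint x y : exists m, d x m = d x y / 2 /\ d m y = d x y / 2.
Proof.
have [L0|] := eqVneq (d x y) 0.
  by exists x; rewrite L0 mul0r mdistxx.
have [a [b [c [ab cc ca cb len]]]] := hlength x y.
move=> L0; have L00 : 0 < d x y by rewrite lt_neqAle eq_sym L0 mdist_ge0.
have ec : econt a b (fun t => d x (c t)).
  move=> t ht eta eta0; move/subspace_continuousP : cc => /(_ t).
  rewrite /= in_itv /= => /(_ ht) /cvg_ballP /(_ _ eta0); rewrite near_withinE => /nbhs_ballP[e /= e0 he].
  exists e => // t' ht' td; apply: le_lt_trans (dist_lip _ _ _) _.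
  have hb : ball t e t' by rewrite -ball_normE /ball_ /= distrC.
  have : ball (c t) eta (c t') by apply: he => //; rewrite in_itv.
  by rewrite ballEmdist /= metric_sym.
have [t htab tE] : exists2 t, a <= t <= b & d x (c t) = d x y / 2.
  apply: (econt_ivt ab ec); rewrite ca cb mdistxx.
  by move: L00; clear; lra.
have ta : a < t.
  rewrite lt_neqAle (proj1 (andP htab)) andbT; apply/eqP => tE'; move: tE.
  rewrite -tE' ca mdistxx.
  by move: L00; clear; lra.
have tb : t < b.
  rewrite lt_neqAle (proj2 (andP htab)) andbT; apply/eqP => tE'; move: tE.
  by rewrite tE' cb; move: L00; clear; lra.
exists (c t); split=> //.
have : ((d x (c t) + d (c t) y)%:E <= (d x y)%:E)%E.
  rewrite -len; apply: ereal_sup_ubound; exists [:: t; b] => /=.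
    by split; rewrite /= ?ta ?tb.
  by rewrite big_nat_recl // big_nat1 /= ca cb.
rewrite lee_fin tE => h; apply/eqP; rewrite eq_le; apply/andP; split.
  by move: h; clear; lra.
by have := metric_triangle x (c t) y; rewrite tE; clear; lra.
Qed.

(** Repeated midpoints link two points by steps shorter than [delta], so a property that passes to
    points closer than [delta] passes to all points. *)
Lemma chain_ind (Q : Y -> Prop) delta : 0 < delta ->
  (forall x p, Q x -> d x p < delta -> Q p) -> forall o p, Q o -> Q p.
Proof.
move=> d0 step o p; have [k] : exists k : nat, d o p < delta * 2 ^+ k.
  pose N := Num.bound (d o p / delta).
  have hN : d o p / delta < N%:R by apply: archi_boundP; rewrite divr_ge0 // ?mdist_ge0 // ltW.
  exists N; rewrite mulrC -ltr_pdivrMr //; apply: lt_le_trans hN _.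
  by rewrite -natrX ler_nat ltnW // ltn_expl.
elim: k o p => [|k IH] o p; first by rewrite expr0 mulr1 => h Qo; exact: step Qo h.
have [m [om mp]] := midpoint o p; rewrite exprS => h Qo.
by apply: (IH m); [rewrite mp|apply: (IH o) => //; rewrite om]; move: h; clear; lra.
Qed.

End Midpoints.

(** * One isotropy function for all points *)

Section Homogeneity.
Variables (R : realType) (Y : metricType R) (E : exp_structure Y) (r : R).
Variable F : Y -> R -> R -> R -> R.
Hypotheses (hlength : complete_length_space Y) (r0 : 0 < r) (hr : r < inf (range (Defs.rad E))).
Hypothesis hF : forall x, isotropy_function E r x (F x).
Local Notation n := (edim E).
Hypothesis n0 : (0 < n)%N.
Implicit Types (x y p q o m : Y) (u v w : 'rV[R]_n) (s t a b th : R).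
Local Notation d := (@mdist R Y).
Local Ltac sclear := clear - R Y E r F hlength r0 hr hF n0.

Lemma rad_gt y : r < Defs.rad E y.
Proof.
apply: lt_le_trans hr _; apply: ge_inf; last by exists y.
by exists 0 => _ [z _ <-]; exact/ltW/rad_gt0.
Qed.

Lemma expo0 x : expo E x 0 = x.
Proof.
have [v hv] := sphere_ex R n0; have [h _] := expo_minimizing x hv.
by rewrite scale0r in h.
Qed.

Lemma expo_ray x v s t : esphere v -> 0 <= s -> s <= t -> t < Defs.rad E x ->
  d (expo E x (s *: v)) (expo E x (t *: v)) = t - s.
Proof.
move=> hv s0 st tr; have [_ h] := expo_minimizing x hv.
by have [-> [->]] := h s t s0 st tr.
Qed.

Lemma expo_dist x v w s t : esphere v -> esphere w -> 0 <= s < r -> 0 <= t < r ->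
  d (expo E x (s *: v)) (expo E x (t *: w)) = F x (angle v w) s t.
Proof. by move=> hv hw hs ht; have [_ _ _ _ h] := hF x; rewrite (h v w t s). Qed.

Lemma expo_center x v t : esphere v -> 0 <= t < r -> d x (expo E x (t *: v)) = t.
Proof.
move=> hv /andP[t0 tr]; rewrite -{1}(expo0 x) -(scale0r v) expo_ray ?subr0 //.
exact: lt_trans tr (rad_gt x).
Qed.

Lemma expo_onto x y : d x y < r -> exists2 v, esphere v & y = expo E x (d x y *: v).
Proof.
move=> xy; have [_ _ h] := expo_bij E x.
have [|u hu uE] := h y; first by rewrite ballEmdist /=; apply: lt_trans xy (rad_gt x).
have [v0 hv0] := sphere_ex R n0; have [v hv uv] := polar u hv0.
exists v => //; suff <- : enorm u = d x y by rewrite -uv uE.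
rewrite -uE {2}uv -{1}(expo0 x) -(scale0r v) expo_ray ?subr0 //.
exact: enorm_ge0.
Qed.

Lemma expo_inj x v w s t : esphere v -> esphere w -> 0 <= s < r -> 0 <= t < r ->
  expo E x (s *: v) = expo E x (t *: w) -> s *: v = t *: w.
Proof.
move=> hv hw /andP[s0 sr] /andP[t0 tr]; have [_ h _] := expo_bij E x.
apply: h; rewrite inE /eball /= enorm_sphere // ger0_norm //; exact: lt_trans (rad_gt x).
Qed.

Lemma F_zero x s t : 0 <= s < r -> 0 <= t < r -> F x 0 s t = `|s - t|.
Proof.
have [v hv] := sphere_ex R n0.
move=> hs ht; rewrite -(anglexx hv) -expo_dist //.
have tr : t < Defs.rad E x by apply: lt_trans (rad_gt x); case/andP: ht.
have sr : s < Defs.rad E x by apply: lt_trans (rad_gt x); case/andP: hs.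
have [st|/ltW ts] := leP s t.
  by rewrite expo_ray //; [rewrite distrC ger0_norm ?subr_ge0|case/andP: hs].
by rewrite metric_sym expo_ray //; [rewrite ger0_norm ?subr_ge0|case/andP: ht].
Qed.

Lemma F_mono x th1 th2 s t : 0 <= th1 -> th1 <= th2 -> th2 <= pi ->
  0 <= s < r -> 0 <= t < r -> F x th1 s t <= F x th2 s t.
Proof.
move=> t1; rewrite le_eqVlt => /orP[/eqP ->//|t12] t2 hs ht.
by have [_ h _ _ _] := hF x; apply: h => //; apply/andP; split; [case/andP: hs|case/andP: hs => _ /ltW|case/andP: ht|case/andP: ht => _ /ltW].
Qed.

(** Opposite rays at [x] are not known in advance to form a geodesic. But the ray from a point [p]
    near [x] toward [x] runs on past [x], so some angle at [x] realizes [s + t], and pi does so by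
    monotonicity. *)
Lemma F_pi x s t : 0 <= s -> 0 <= t -> s + t < r -> F x pi s t = s + t.
Proof.
move=> s0 t0 st; have hs : 0 <= s < r by move: s0 t0 st; sclear; lra.
have ht : 0 <= t < r by move: s0 t0 st; sclear; lra.
have [v hv] := sphere_ex R n0; have hNv := esphereN hv.
apply/eqP; rewrite eq_le; apply/andP; split.
  rewrite -(angleN hv) -expo_dist //; apply: le_trans (metric_triangle _ x _) _.
  by rewrite metric_sym !expo_center.
have [p pE] : exists p, p = expo E x (s *: v) by exists (expo E x (s *: v)).
have xp : d x p = s by rewrite pE; exact: expo_center.
have [|w hw] := @expo_onto p x; first by rewrite metric_sym xp; case/andP: hs.
rewrite metric_sym xp => xE.
have [q qE'] : exists q, q = expo E p ((s + t) *: w) by exists (expo E p ((s + t) *: w)).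
have pq : d p q = s + t by rewrite qE'; apply: expo_center => //; rewrite addr_ge0.
have xq : d x q = t.
  have := @expo_ray p w s (s + t) hw s0; rewrite -xE -qE' addrAC subrr add0r; apply; first by rewrite lerDl.
  exact: lt_trans (rad_gt p).
have [|v' hv'] := @expo_onto x q; first by rewrite xq; case/andP: ht.
rewrite xq => qE; move: pq; rewrite pE qE expo_dist // => <-.
by apply: F_mono => //; rewrite ?angle_ge0 ?angle_lepi.
Qed.

Lemma F_econt x s t : 0 <= s < r -> 0 <= t < r -> econt 0 pi (fun th => F x th s t).
Proof.
move=> hs ht th hth eta eta0; have [hc _ _ _ _] := hF x.
have hs' : 0 <= s <= r by case/andP: hs => -> /ltW.
have ht' : 0 <= t <= r by case/andP: ht => -> /ltW.
move/subspace_continuousP : hc => /(_ (th, s, t)) /= /(_ ltac:(by split)).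
move=> /cvg_ballP /(_ _ eta0); rewrite near_withinE => /nbhs_ballP[e /= e0 he].
exists e => // th' hth' td; rewrite distrC; apply: (he (th', s, t)) => //.
by split; [split; [rewrite -ball_normE /ball_ /= distrC|exact: ballxx]|exact: ballxx].
Qed.

Lemma F_gt0 x th t : (1 < n)%N -> 0 < th <= pi -> 0 < t < r -> 0 < F x th t t.
Proof.
move=> n1 hth ht; have hth' : 0 <= th <= pi by move: hth; sclear; lra.
have ht' : 0 <= t < r by case/andP: ht => /ltW ->.
have [v [w [hv hw vw]]] := iso_angles n1 hth'.
rewrite -vw -expo_dist // mdist_gt0; apply/eqP => /(expo_inj hv hw ht' ht').
have t0 : t != 0 by rewrite gt_eqF //; case/andP: ht.
move=> /(scalerI t0) vw'; move: vw hth; rewrite vw' anglexx // => <-.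
by rewrite ltxx.
Qed.

(** The reflection in the hyperplane orthogonal to [v - w]. *)
Lemma point_reflection m v w : esphere v -> esphere w -> exists A : 'rV[R]_n -> 'rV[R]_n,
  [/\ forall t u, A (t *: u) = t *: A u, forall u u', edot (A u) (A u') = edot u u',
    involutive A & A v = w].
Proof.
move=> hv hw; have [->|vw] := eqVneq v w; first by exists id; split.
have nz : enorm (v - w) != 0 by apply: contraNN vw => /eqP /enorm_eq0 /eqP; rewrite subr_eq0.
have [b bE hb] : exists2 b, b = (enorm (v - w))^-1 *: (v - w) & esphere b.
  by exists ((enorm (v - w))^-1 *: (v - w)) => //; exact: esphere_normalize.
have bb : edot b b = 1 by move/esphereP: hb.
exists (fun u => u - (2 * edot u b) *: b); split.
- by move=> t u; rewrite edotZl scalerBr scalerA mulrCA.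
- by move=> u u'; rewrite !edot_lin (edotC b u') bb; ring.
- move=> u; rewrite !edot_lin bb; set c := edot u b.
  by rewrite -addrA -opprD -scalerDl (_ : 2 * c + _ = 0) ?scale0r ?subr0 //; ring.
- rewrite bE scalerA edotZr.
  have e1 : edot (v - w) (v - w) = 2 * edot v (v - w).
    move/esphereP: hv => hv; move/esphereP: hw => hw.
    by rewrite !edot_lin hv hw (edotC w v); ring.
  rewrite (_ : 2 * _ * _ = 1); last first.
    move: e1; rewrite -sqr_enorm; move: nz; set N := enorm _; set z := edot v _ => Nz e1.
    have -> : 2 * (N^-1 * z) * N^-1 = (2 * z) * (N^-1 * N^-1) by ring.
    by rewrite -e1; field.
  by rewrite scale1r opprB addrC subrK.
Qed.

(** An exponential map at [p] whose distances are governed by the function of [o]; it need not be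
    [expo E p]. *)
Record iso_frame (o p : Y) (e : 'rV[R]_n -> Y) : Prop := IsoFrame {
  fr_dist : forall v w s t, esphere v -> esphere w -> 0 <= s < r / 2 -> 0 <= t < r / 2 ->
    d (e (s *: v)) (e (t *: w)) = F o (angle v w) s t ;
  fr_center : e 0 = p ;
  fr_onto : forall y, d p y < r / 2 -> exists2 v, esphere v & y = e (d p y *: v)
}.

(* Conjugating the linear reflection that exchanges the directions from the
   midpoint [m] to [x] and [p] by [expo E m] gives an isometry of the ball
   [B(m, r)] that exchanges [x] and [p]. *)
Lemma iso_frame_step o x p e : iso_frame o x e -> d x p < r / 2 -> exists e', iso_frame o p e'.
Proof.
move=> [e_dist e_cent e_onto] xp; have [m [xm mp]] := midpoint hlength x p.
have mx : d m x = d x p / 2 by rewrite metric_sym.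
have [|v hv xE] := @expo_onto m x; first by rewrite mx; move: xp r0; sclear; lra.
have [|w hw pE] := @expo_onto m p; first by rewrite mp; move: xp r0; sclear; lra.
have [A [AZ Aedot AK Av]] := point_reflection m hv hw.
have Aw : A w = v by rewrite -Av AK.
have As u : esphere u -> esphere (A u) by move=> /esphereP hu; apply/esphereP; rewrite Aedot.
have Aang u u' : angle (A u) (A u') = angle u u' by rewrite /angle Aedot.
pose phi y := expo E m (A (xget 0 [set u | enorm u < r /\ expo E m u = y])).
have phiE t u : esphere u -> 0 <= t < r -> phi (expo E m (t *: u)) = expo E m (t *: A u).
  move=> hu ht; rewrite /phi; set S := [set _ | _].
  have [/=|h1 h2] := @xgetPex _ 0 S.
    by exists (t *: u); split=> //; rewrite enorm_sphere // ger0_norm; case/andP: ht.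
  have [w' hw' wE] := polar (xget 0 S) hv.
  rewrite wE AZ; rewrite wE in h2; rewrite -AZ -wE -AZ.
  congr (expo E m (A _)); rewrite wE; apply: (expo_inj hw' hu _ ht h2).
  by rewrite enorm_ge0.
have inB y : d m y < r -> exists2 u, esphere u & y = expo E m (d m y *: u) by exact: expo_onto.
have phi_iso y z : d m y < r -> d m z < r -> d (phi y) (phi z) = d y z.
  move=> my mz; have [u hu yE] := inB _ my; have [u' hu' zE] := inB _ mz.
  have hy : 0 <= d m y < r by rewrite mdist_ge0.
  have hz : 0 <= d m z < r by rewrite mdist_ge0.
  rewrite yE zE !phiE // !expo_dist ?Aang //; exact: As.
have phiK y : d m y < r -> phi (phi y) = y.
  move=> my; have [u hu yE] := inB _ my; have hy : 0 <= d m y < r by rewrite mdist_ge0.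
  by rewrite yE !phiE ?AK //; exact: As.
have phix : phi x = p.
  rewrite xE phiE ?Av ?mdist_ge0 //=; first by rewrite mx -mp -pE.
  by rewrite mx; move: xp r0; sclear; lra.
have phip : phi p = x by rewrite -phix phiK // mx; move: xp r0; sclear; lra.
have near z y : d m z = d x p / 2 -> d z y < r / 2 -> d m y < r.
  by move=> mz zy; have := metric_triangle m z y; rewrite mz; move: zy xp r0; sclear; lra.
have e_near u t : esphere u -> 0 <= t < r / 2 -> d m (e (t *: u)) < r.
  move=> hu ht; apply: (near x) => //.
  have h0 : 0 <= (0 : R) < r / 2 by move: r0; sclear; lra.
  rewrite -{1}e_cent -(scale0r u) e_dist // anglexx // F_zero; try by move: ht r0; sclear; lra.
  by rewrite sub0r normrN ger0_norm; case/andP: ht.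
exists (phi \o e); split.
- move=> u u' s t hu hu' hs ht /=; rewrite phi_iso ?e_dist //; exact: e_near.
- by rewrite /= e_cent phix.
move=> y py; have my : d m y < r by exact: (near p).
have xy : d x (phi y) = d p y by rewrite -phip phi_iso // mp; move: xp r0; sclear; lra.
have [|u hu yE] := e_onto (phi y); first by rewrite xy.
by exists u => //=; rewrite -xy -yE phiK.
Qed.

(** Arbitrarily long chains cost no radius: the balls of radius [r / 2] about [x] and [p] lie in the
    ball of radius [r] about their midpoint, so each step carries the whole frame. *)
Lemma iso_frames o : exists e : Y -> 'rV[R]_n -> Y, forall p, iso_frame o p (e p).
Proof.
suff /choice[e he] : forall p, exists e, iso_frame o p e by exists e.
move=> p; apply: (chain_ind hlength (delta := r / 2) (Q := fun p => exists e, iso_frame o p e) _ _ (o := o)).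
- by rewrite divr_gt0.
- by move=> x q [e he]; exact: iso_frame_step he.
have hr2 t : 0 <= t < r / 2 -> 0 <= t < r by move: r0; sclear; lra.
exists (expo E o); split.
- by move=> v w s t hv hw /hr2 hs /hr2 ht; exact: expo_dist.
- exact: expo0.
by move=> y oy; apply: expo_onto; move: oy r0; sclear; lra.
Qed.

Lemma isotropic_space_ex (o : Y) : exists (F' : R -> R -> R -> R) (e : Y -> 'rV[R]_n -> Y),
  isotropic_space (r / 2) F' e.
Proof.
have [e he] := iso_frames o.
have hr2 t : 0 <= t < r / 2 -> 0 <= t < r by move: r0; sclear; lra.
have hr3 t : 0 < t < r / 2 -> 0 < t < r by move: r0; sclear; lra.
have [n1|] := ltnP 1 n.
  exists (F o), e; split.
  - by move=> p v w s t hv hw hs ht; apply: (fr_dist (he p)).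
  - by move=> p; exact: fr_center (he p).
  - by move=> p y; exact: (fr_onto (he p)).
  - by move=> th1 th2 s t h1 h12 h2 /hr2 hs /hr2 ht; exact: F_mono.
  - by move=> s t /hr2 hs /hr2 ht; exact: F_econt.
  - by move=> s t /hr2 hs /hr2 ht; exact: F_zero.
  - by move=> s t s0 t0 st; apply: F_pi => //; move: st r0; sclear; lra.
  - by move=> th t hth /hr3 ht; exact: F_gt0.
(* In dimension 1 no pair of unit vectors has an angle strictly between 0 and pi. The values in
   between are replaced by linear interpolation from [|s - t|] to [s + t], which has the required
   monotonicity and positivity. *)
move=> n1; have p0 := pi_gt0 R.
exists (fun th s t => `|s - t| + th / pi * (s + t - `|s - t|)), e.
have nn s t : 0 <= s < r / 2 -> 0 <= t < r / 2 -> 0 <= s + t - `|s - t|.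
  by move=> hs ht; rewrite subr_ge0 ler_norml; move: hs ht; sclear; lra.
have F1 v w s t : esphere v -> esphere w -> 0 <= s < r / 2 -> 0 <= t < r / 2 ->
    F o (angle v w) s t = `|s - t| + angle v w / pi * (s + t - `|s - t|).
  move=> hv hw hs ht; have := edot_dim1 v w n1.
  move/esphereP: (hv) => ->; move/esphereP: (hw) => ->; rewrite mulr1 => /eqP.
  rewrite sqrf_eq1 /angle => /orP[] /eqP ->.
    by rewrite acos1 mul0r mul0r addr0; apply: F_zero; exact: hr2.
  have -> : acos (-1) = pi :> R by exact: acosN1.
  rewrite divff ?gt_eqF // mul1r F_pi; [ring|by case/andP: hs|by case/andP: ht|].
  by move: hs ht; sclear; lra.
split.
- by move=> p v w s t hv hw hs ht; rewrite (fr_dist (he p)) // F1.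
- by move=> p; exact: fr_center (he p).
- by move=> p y; exact: (fr_onto (he p)).
- move=> th1 th2 s t h1 h12 h2 hs ht; rewrite lerD2l ler_wpM2r ?nn //.
  by rewrite ler_pM2r ?invr_gt0.
- move=> s t hs ht; have K0 := nn _ _ hs ht.
  apply: (@econt_lip _ _ _ ((s + t - `|s - t|) / pi)); first by rewrite divr_ge0 // ltW.
  move=> x y _ _; have k0 : 0 <= (s + t - `|s - t|) / pi by rewrite divr_ge0 // ltW.
  rewrite -[X in _ <= X * _](ger0_norm k0) -normrM le_eqVlt; apply/orP; left; apply/eqP; congr `|_|.
  ring.
- by move=> s t hs ht; rewrite mul0r mul0r addr0.
- by move=> s t s0 t0 st; rewrite divff ?gt_eqF // mul1r; ring.
move=> th t hth ht; rewrite subrr normr0 subr0 add0r mulr_gt0 ?divr_gt0 //; first by case/andP: hth.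
by case/andP: ht => t0 _; rewrite addr_gt0.
Qed.

End Homogeneity.

(** * Stereographic coordinates *)

(* [psi p] is the inverse of a stereographic chart at [p]; the law [cc_law] is
   the chordal form of the distance in the conformal model of curvature [k].
   The smaller radius [r1] keeps any point [q] with [B(p, r1)] and [B(q, r1)]
   overlapping well inside the domain [B(p, r)] of the law. *)
Record conformal_charts (R : realType) (Y : metricType R) (n : nat) (r T r1 T1 k : R)
    (P : R -> R) (psi : Y -> 'rV[R]_n -> Y) : Prop := ConformalCharts {
  cc_r1 : 0 < r1 ;
  cc_r : 3 * r1 <= r ;
  cc_T1 : 0 < T1 ;
  cc_T : T1 < T ;
  cc_kT : `|k| * T < 1 ;
  cc_P0 : P 0 = 0 ;
  cc_mono : forall a b, 0 <= a -> a < b -> b < 2 * r -> P a < P b ;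
  cc_cont : forall eta, 0 < eta -> exists2 d, 0 < d & forall t, 0 <= t < d -> P t < eta ;
  cc_asym : forall eta, 0 < eta -> exists2 d, 0 < d &
    forall t, 0 < t < d -> `|P t - t ^+ 2 / 2| <= eta * t ^+ 2 ;
  cc_center : forall p, psi p 0 = p ;
  cc_law : forall p x x', edot x x < T -> edot x' x' < T ->
    P (mdist (psi p x) (psi p x')) =
      2 * edot (x - x') (x - x') / ((1 + k * edot x x) * (1 + k * edot x' x')) ;
  cc_onto : forall p y, mdist p y < r -> exists2 x, edot x x < T & psi p x = y ;
  cc_in : forall p x, edot x x < T -> mdist p (psi p x) < r ;
  cc_in1 : forall p x, edot x x < T -> (mdist p (psi p x) < r1) = (edot x x < T1)
}.

Section Stereographic.
Variables (R : realType) (Y : metricType R) (n : nat) (rho r0 k : R) (P s : R -> R).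
Variables (F : R -> R -> R -> R) (e : Y -> 'rV[R]_n -> Y).
Hypotheses (H : isotropic_space rho F e) (C : cosine_law r0 k P s e).
Hypotheses (r00 : 0 < r0) (r0rho : r0 < rho) (n0 : (0 < n)%N).
Implicit Types (p q y : Y) (u v w x : 'rV[R]_n) (t a b X : R).
Local Notation d := (@mdist R Y).
Local Ltac sclear := clear - R Y n rho r0 k P s F e H C r00 r0rho n0.

Lemma cl_ge0 t : 0 <= t < 2 * r0 -> 0 <= P t.
Proof.
case/andP; rewrite le_eqVlt => /orP[/eqP <- _|t0 tr]; first by rewrite (cl_P0 C).
by rewrite -(cl_P0 C); apply/ltW/(cl_mono C).
Qed.

Lemma cl_small eta : 0 < eta -> exists2 d, 0 < d < r0 & forall t, 0 <= t <= d -> P t < eta.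
Proof.
move=> eta0; have [|d1 d10 hd1] := cl_cont C (c := 0) (eta := eta) _ eta0.
  by rewrite lexx mulr_gt0.
exists (Num.min (d1 / 2) (r0 / 2)).
  by rewrite lt_min !divr_gt0 //= gt_min; apply/orP; right; move: r00; sclear; lra.
move=> t /andP[t0]; rewrite le_min => /andP[td tr].
have := hd1 t; rewrite (cl_P0 C) !subr0 ger0_norm // => h.
apply: le_lt_trans (ler_norm _) _; apply: h; first by move: t0 tr r00; sclear; lra.
by move: td d10; sclear; lra.
Qed.

Lemma stereo_lt X X' : 0 <= X -> 0 <= X' -> `|k| * X < 1 -> `|k| * X' < 1 ->
  (2 * X / (1 + k * X) < 2 * X' / (1 + k * X')) = (X < X').
Proof.
have q0 Z : 0 <= Z -> `|k| * Z < 1 -> 0 < 1 + k * Z.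
  move=> Z0; rewrite -{1}(ger0_norm Z0) -normrM ltr_norml; sclear; lra.
move=> X0 X'0 kX kX'; have q1 := q0 _ X0 kX; have q2 := q0 _ X'0 kX'.
rewrite ltr_pdivrMr // mulrAC ltr_pdivlMr //.
have -> : 2 * X * (1 + k * X') = 2 * X + 2 * (k * X * X') by ring.
have -> : 2 * X' * (1 + k * X) = 2 * X' + 2 * (k * X * X') by ring.
by rewrite ltrD2r ltr_pM2l.
Qed.

Lemma conformal_charts_ex : exists r T r1 T1 P' (psi : Y -> 'rV[R]_n -> Y),
  conformal_charts r T r1 T1 k P' psi.
Proof.
have K0 : 0 < (`|k| + 1)^-1 by rewrite invr_gt0 ltr_wpDl.
(* On radii up to [r] the product [|k| * P] is below 1, which keeps the denominators [2 - k * P t]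
   and [1 + k * X] positive. *)
have [r /andP[rgt rlt] hr] := cl_small K0.
have Pk t : 0 <= t <= r -> 0 <= P t /\ `|k| * P t < 1.
  move=> ht; have P0 : 0 <= P t by apply: cl_ge0; move: ht rlt r00; sclear; lra.
  split=> //; have := hr t ht; rewrite -[_^-1]mul1r ltr_pdivlMr; last by rewrite ltr_wpDl.
  by apply: le_lt_trans; rewrite mulrC ler_wpM2l // lerDl.
(* The squared norm of the stereographic coordinate of a point at distance [t]: the inverse of
   [X |-> 2 * X / (1 + k * X)] applied to [P t]. *)
pose tau t := P t / (2 - k * P t).
have tauP t : 0 <= t <= r -> [/\ 0 <= tau t, `|k| * tau t < 1, 1 < 2 - k * P t,
    P t = 2 * tau t / (1 + k * tau t) & 1 + k * tau t = 2 / (2 - k * P t)].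
  move=> ht; have [P0 kP] := Pk t ht.
  have D1 : 1 < 2 - k * P t.
    by move: kP; rewrite -{1}(ger0_norm P0) -normrM ltr_norml; sclear; lra.
  have D0 : 0 < 2 - k * P t by apply: lt_trans D1.
  have tau0 : 0 <= tau t by rewrite divr_ge0 // ltW.
  have ktau : `|k| * tau t < 1 by rewrite mulrA ltr_pdivrMr // mul1r; apply: lt_trans D1.
  have E1 : 1 + k * tau t = 2 / (2 - k * P t) by rewrite /tau; move: (lt0r_neq0 D0); sclear => ?; field.
  by split=> //; rewrite E1 /tau; move: (lt0r_neq0 D0); sclear => ?; field.
pose T := tau r; pose r1 := r / 3; pose T1 := tau r1.
have rr : 0 <= r <= r by rewrite lexx andbT ltW.
have hr1 : 0 < r1 by rewrite divr_gt0.
have rr1 : 0 <= r1 <= r by move: rgt; rewrite /r1; sclear; lra.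
have [T0 kT _ PT _] := tauP r rr; have [T10 kT1 _ PT1 _] := tauP r1 rr1.
have kX X : 0 <= X -> X < T -> `|k| * X < 1.
  by move=> X0 XT; apply: le_lt_trans kT; rewrite ler_wpM2l // ltW.
have PXlt X : 0 <= X -> X < T -> 2 * X / (1 + k * X) < P r.
  by move=> X0 XT; rewrite PT stereo_lt // kX.
have PX0 X : 0 <= X -> X < T -> 0 <= 2 * X / (1 + k * X).
  move=> X0 XT; have := kX X X0 XT; rewrite -{1}(ger0_norm X0) -normrM ltr_norml => h.
  by rewrite divr_ge0 // ?mulr_ge0 //; move: h; sclear; lra.
have Pecont : econt 0 r P.
  move=> t ht eta eta0; have [|d1 d10 hd1] := cl_cont C (c := t) (eta := eta) _ eta0.
    by move: ht rlt r00; sclear; lra.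
  by exists d1 => // t' ht'; apply: hd1; move: ht' rlt r00; sclear; lra.
have rad_ex x : edot x x < T -> exists t, 0 <= t < r /\ P t = 2 * edot x x / (1 + k * edot x x).
  move=> xT; have X0 := edot_ge0 x.
  have [|t /andP[t0]] := econt_ivt (ltW rgt) Pecont (y := 2 * edot x x / (1 + k * edot x x)).
    by rewrite (cl_P0 C) PX0 //= ltW // PXlt.
  rewrite le_eqVlt => /orP[/eqP ->|tr] Pt; last by exists t; rewrite t0 tr.
  by have := PXlt _ X0 xT; rewrite Pt ltxx.
pose rd x := xget 0 [set t | 0 <= t < r /\ P t = 2 * edot x x / (1 + k * edot x x)].
have rdP x : edot x x < T -> 0 <= rd x < r /\ P (rd x) = 2 * edot x x / (1 + k * edot x x).
  by move=> /rad_ex; exact: xgetPex.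
(* [rd x] is the distance from the centre that corresponds to the norm of [x]. At [x = 0] the
   quotient is 0, with no effect on the product with [x]. *)
pose psi p x := e p ((rd x / enorm x) *: x).
have Pinj a b : 0 <= a < 2 * r0 -> 0 <= b < 2 * r0 -> P a = P b -> a = b.
  move=> /andP[a0 ar] /andP[b0 br] E; case: (ltgtP a b) => // ab.
    by have := cl_mono C a0 ab br; rewrite E ltxx.
  by have := cl_mono C b0 ab ar; rewrite E ltxx.
have [v0 hv0] := sphere_ex R n0.
have rho_r t : 0 <= t < r -> 0 <= t < rho by move: rlt r0rho; sclear; lra.
have r0_r t : 0 <= t < r -> 0 <= t < r0 by move: rlt; sclear; lra.
have psiE x : edot x x < T -> exists v, [/\ esphere v, x = enorm x *: v,
    forall p, psi p x = e p (rd x *: v) & s (rd x) = 2 * enorm x / (1 + k * edot x x)].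
  move=> xT; have [hrd Prd] := rdP x xT; have [v hv xv] := polar x hv0.
  have X0 := edot_ge0 x; have kx := kX _ X0 xT.
  have qx : 0 < 1 + k * edot x x.
    by move: kx; rewrite -{1}(ger0_norm X0) -normrM ltr_norml; sclear; lra.
  exists v; split => //.
    move=> p; rewrite /psi; have [x0|x0] := eqVneq (enorm x) 0; last first.
      by rewrite {3}xv scalerA divfK.
    have -> : rd x = 0.
      apply: Pinj; [move: hrd rlt r00; sclear; lra|by rewrite lexx mulr_gt0|].
      by rewrite Prd -sqr_enorm x0 expr0n mulr0 mul0r (cl_P0 C).
    by rewrite mul0r !scale0r.
  have sq := cl_sq C (r0_r _ hrd).
  have s0 : 0 <= s (rd x).
    case/andP: (hrd); rewrite le_eqVlt => /orP[/eqP <- _|h1 h2]; first by rewrite (cl_s0 C).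
    by apply/ltW/(cl_s_gt0 C); rewrite h1; move: h2 rlt; sclear; lra.
  apply/eqP; rewrite -(@eqrXn2 _ 2) //; last by rewrite divr_ge0 ?mulr_ge0 ?enorm_ge0 // ltW.
  rewrite [X in _ == X]expr_div_n exprMn sqr_enorm sq Prd; apply/eqP.
  by move: (lt0r_neq0 qx); set X := edot x x; sclear => h; field.
have law p x x' : edot x x < T -> edot x' x' < T ->
    P (mdist (psi p x) (psi p x')) =
      2 * edot (x - x') (x - x') / ((1 + k * edot x x) * (1 + k * edot x' x')).
  move=> xT xT'; have [v [hv xv -> sv]] := psiE x xT; have [w [hw xw -> sw]] := psiE x' xT'.
  have [h1 P1] := rdP x xT; have [h2 P2] := rdP x' xT'.
  rewrite (cl_law C) //; try exact: r0_r.
  have xx : enorm x * enorm x' * edot v w = edot x x' by rewrite {2}xv {2}xw !edot_lin; ring.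
  rewrite P1 P2 sv sw !edot_lin (edotC x' x) -xx.
  have qx : 1 + k * edot x x != 0.
    have X0 := edot_ge0 x; have := kX _ X0 xT; rewrite -{1}(ger0_norm X0) -normrM ltr_norml => h.
    by rewrite lt0r_neq0 //; move: h; sclear; lra.
  have qx' : 1 + k * edot x' x' != 0.
    have X0 := edot_ge0 x'; have := kX _ X0 xT'; rewrite -{1}(ger0_norm X0) -normrM ltr_norml => h.
    by rewrite lt0r_neq0 //; move: h; sclear; lra.
  move: qx qx'; set X := edot x x; set X' := edot x' x'; set a := enorm x; set b := enorm x'; set c := edot v w.
  by sclear => qx qx'; field; rewrite qx qx'.
have cent p : psi p 0 = p by rewrite /psi scaler0 (iso_center H).
have dpsi p x : edot x x < T -> d p (psi p x) = rd x.
  move=> xT; have [v [hv xv -> _]] := psiE x xT; have [h _] := rdP x xT.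
  by rewrite (dist_center H) //; exact: rho_r.
exists r, T, r1, T1, P, psi; split=> //.
- by rewrite /r1; move: rgt; sclear; lra.
- rewrite lt_neqAle T10 andbT; apply/eqP => E.
  have := cl_mono C (lexx 0) hr1 ltac:(move: rr1 rlt r00; sclear; lra).
  by rewrite PT1 -/T1 -E mulr0 mul0r (cl_P0 C) ltxx.
- have : T1 < T; last by [].
  rewrite -stereo_lt // -PT -PT1; apply: (cl_mono C); move: rr1 rgt rlt r00; rewrite /r1; sclear; lra.
- exact: cl_P0 C.
- by move=> a b a0 ab br; apply: (cl_mono C) => //; move: br rlt; sclear; lra.
- by move=> eta /cl_small[d1 /andP[d10 _] h]; exists d1 => // t ht; apply: h; move: ht; sclear; lra.
- exact: cl_asym C.
- move=> p y py; have [|v hv yE] := iso_onto H (p := p) (y := y).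
    by move: py rlt r0rho; sclear; lra.
  set t := d p y in py yE; have ht : 0 <= t < r by rewrite mdist_ge0.
  have ht' : 0 <= t <= r by rewrite mdist_ge0 ltW.
  have [tau0 ktau D1 PtE _] := tauP t ht'.
  pose x := Num.sqrt (tau t) *: v.
  have xx : edot x x = tau t.
    by rewrite /x !edot_lin; move/esphereP: (hv) => ->; rewrite mulr1 -expr2 sqr_sqrtr.
  have xT : edot x x < T.
    rewrite xx -stereo_lt // -PtE -PT; apply: (cl_mono C); [exact: mdist_ge0|exact: py|].
    by move: rlt r00; sclear; lra.
  exists x => //; have [h1 P1] := rdP x xT.
  have rdt : rd x = t.
    by apply: Pinj; [move: h1 rlt r00; sclear; lra|move: ht rlt r00; sclear; lra|rewrite P1 xx].
  rewrite /psi rdt yE; congr (e p _).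
  have [t0|t0] := eqVneq t 0; first by rewrite t0 mul0r !scale0r.
  have nx : enorm x = Num.sqrt (tau t) by rewrite /x enorm_sphere // ger0_norm ?sqrtr_ge0.
  rewrite /x scalerA nx divfK // sqrtr_eq0 -ltNge lt_neqAle tau0 andbT eq_sym.
  apply/eqP => tz; move/eqP: t0; apply; apply: Pinj; [move: ht rlt r00; sclear; lra|by rewrite lexx mulr_gt0|].
  by rewrite PtE tz mulr0 mul0r (cl_P0 C).
- by move=> p x xT; rewrite dpsi //; have [/andP[]] := rdP x xT.
move=> p x xT; rewrite dpsi //; have [h1 P1] := rdP x xT.
rewrite -(stereo_lt (edot_ge0 x) T10 (kX _ (edot_ge0 x) xT) kT1) -PT1 -P1.
apply/idP/idP => h.
  by apply: (cl_mono C) => //; [case/andP: h1|move: rr1 rlt r00; sclear; lra].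
rewrite ltNge; apply/negP; rewrite le_eqVlt => /orP[/eqP E|h'].
  by move: h; rewrite E ltxx.
have := cl_mono C (ltW hr1) h' ltac:(move: h1 rlt r00; sclear; lra).
by rewrite ltNge (ltW h).
Qed.

End Stereographic.

(** Each chart has a single point, so the chordal law compares 0 with 0; the constants are
    arbitrary, and [t ^+ 2 / 2] has the prescribed asymptotics. *)
Lemma conformal_charts_dim0 (R : realType) (Y : metricType R) (r : R) : 0 < r ->
  (forall x y : Y, mdist x y < r -> x = y) ->
  conformal_charts r 1 (r / 3) (1 / 2) 0 (fun t => t ^+ 2 / 2) (fun (p : Y) (_ : 'rV[R]_0) => p).
Proof.
move=> r0 hr; have e0 (x y : 'rV[R]_0) : edot x y = 0 by rewrite edotE big_ord0.
split=> //.
- by rewrite divr_gt0.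
- by clear -r0; lra.
- lra.
- by rewrite normr0 mul0r.
- by rewrite expr0n mul0r.
- by move=> a b a0 ab _; rewrite ltr_pM2r // ltr_pXn2r ?nnegrE //; apply: ltW; exact: le_lt_trans ab.
- move=> eta eta0; exists (Num.min 1 eta); first by rewrite lt_min ltr01.
  move=> t /andP[t0]; rewrite lt_min => /andP[t1 te].
  have : t ^+ 2 <= t by rewrite expr2 ler_piMr // ltW.
  by move: te eta0 t0; clear; lra.
- by move=> eta eta0; exists 1 => // t _; rewrite subrr normr0 mulr_ge0 ?sqr_ge0 // ltW.
- by move=> p x x' _ _; rewrite !e0 mdistxx expr0n !(mulr0, mul0r).
- by move=> p y /hr ->; exists 0; rewrite ?e0 ?ltr01.
- by move=> p x _; rewrite mdistxx.
- by move=> p x _; rewrite mdistxx e0 !divr_gt0.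
Qed.

(** * Rational functions and smoothness *)

Section RationalFunctions.
Variables (R : realType) (m : nat).
Implicit Types (U : set 'rV[R]_m) (x v : 'rV[R]_m) (f g : 'rV[R]_m -> R).

(** Rational functions without poles on [U]. The class is closed under directional derivatives on
    [U], so membership gives smoothness of every order at once. *)
Inductive ratfun U : ('rV[R]_m -> R) -> Prop :=
| ratfun_cst c : ratfun U (fun=> c)
| ratfun_coord i : ratfun U (fun x => x 0 i)
| ratfun_add f g : ratfun U f -> ratfun U g -> ratfun U (fun x => f x + g x)
| ratfun_mul f g : ratfun U f -> ratfun U g -> ratfun U (fun x => f x * g x)
| ratfun_inv f : ratfun U f -> (forall x, U x -> f x != 0) -> ratfun U (fun x => (f x)^-1).

Lemma ratfun_sub U f g : ratfun U f -> ratfun U g -> ratfun U (fun x => f x - g x).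
Proof.
move=> hf hg; have -> : (fun x => f x - g x) = (fun x => f x + -1 * g x).
  by apply/funext => x; rewrite mulN1r.
by apply: ratfun_add => //; apply: ratfun_mul => //; exact: ratfun_cst.
Qed.

Lemma ratfun_sum U (I : finType) (f : I -> 'rV[R]_m -> R) :
  (forall i, ratfun U (f i)) -> ratfun U (fun x => \sum_i f i x).
Proof.
move=> hf; elim: (index_enum I) => [|i s IH].
  have -> : (fun x => \sum_(i <- [::]) f i x) = (fun=> 0) by apply/funext => x; rewrite big_nil.
  exact: ratfun_cst.
have -> : (fun x => \sum_(j <- i :: s) f j x) = (fun x => f i x + \sum_(j <- s) f j x).
  by apply/funext => x; rewrite big_cons.
exact: ratfun_add.
Qed.

Lemma ratfun_edot U (w : 'rV[R]_m) : ratfun U (fun x => edot x w).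
Proof.
have -> : (fun x => edot x w) = (fun x => \sum_i x 0 i * w 0 i).
  by apply/funext => x; rewrite edotE.
by apply: ratfun_sum => i; apply: ratfun_mul; [exact: ratfun_coord|exact: ratfun_cst].
Qed.

Lemma ratfun_edotxx U : ratfun U (fun x => edot x x).
Proof.
have -> : (fun x : 'rV[R]_m => edot x x) = (fun x => \sum_i x 0 i * x 0 i).
  by apply/funext => x; rewrite edotE.
by apply: ratfun_sum => i; apply: ratfun_mul; exact: ratfun_coord.
Qed.

Lemma ratfun_differentiable U f x : ratfun U f -> U x -> differentiable f x.
Proof.
move=> hf; elim: hf x => {f} [c|i|f g _ IHf _ IHg|f g _ IHf _ IHg|f _ IHf f0] x Ux.
- exact: differentiable_cst.
- exact: differentiable_coord.
- exact: differentiableD (IHf _ Ux) (IHg _ Ux).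
- exact: differentiableM (IHf _ Ux) (IHg _ Ux).
- exact: differentiableV (IHf _ Ux) (f0 _ Ux).
Qed.

Lemma derive_coord x v i : 'D_v (fun y : 'rV[R]_m => y 0 i) x = v 0 i.
Proof.
rewrite /derive; apply: cvg_lim => //; apply: cvg_near_cst.
near=> h; rewrite /= !mxE addrK /GRing.scale /= mulKf //; near: h; exact: nbhs_dnbhs_neq.
Unshelve. all: by end_near. Qed.

Lemma ratfun_derive U f v : ratfun U f ->
  exists2 g, ratfun U g & forall x, U x -> 'D_v f x = g x.
Proof.
have der h x : ratfun U h -> U x -> derivable h x v.
  by move=> hh Ux; apply: diff_derivable; exact: ratfun_differentiable hh Ux.
elim => {f} [c|i|f g hf [f' hf' fE] hg [g' hg' gE]|f g hf [f' hf' fE] hg [g' hg' gE]|f hf [f' hf' fE] f0].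
- by exists (fun=> 0); [exact: ratfun_cst|move=> x _; rewrite derive_cst].
- by exists (fun=> v 0 i); [exact: ratfun_cst|move=> x _; rewrite derive_coord].
- exists (fun x => f' x + g' x); first exact: ratfun_add.
  by move=> x Ux; rewrite -fE // -gE // -deriveD //; exact: der.
- exists (fun x => f x * g' x + g x * f' x).
    by apply: ratfun_add; exact: ratfun_mul.
  by move=> x Ux; rewrite -fE // -gE // -[RHS]deriveM //; exact: der.
exists (fun x => -1 * ((f x * f x)^-1 * f' x)).
  apply: ratfun_mul; first exact: ratfun_cst.
  apply: ratfun_mul => //; apply: ratfun_inv; first exact: ratfun_mul.
  by move=> x Ux; rewrite mulf_neq0 // f0.
move=> x Ux; rewrite deriveV ?f0 //; last exact: der.
by rewrite fE // /GRing.scale /= expr2; ring.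
Qed.

Inductive ratmap U (W : normedModType R) : ('rV[R]_m -> W) -> Prop :=
| ratmap_scale f w : ratfun U f -> ratmap U (fun x => f x *: w)
| ratmap_add (f g : 'rV[R]_m -> W) : ratmap U f -> ratmap U g -> ratmap U (fun x => f x + g x).

Lemma ratmap_sum U (W : normedModType R) (I : finType) (f : I -> 'rV[R]_m -> W) :
  (forall i, ratmap U (f i)) -> ratmap U (fun x => \sum_i f i x).
Proof.
move=> hf; elim: (index_enum I) => [|i s IH].
  have -> : (fun x => \sum_(i <- [::]) f i x) = (fun=> 0 *: 0).
    by apply/funext => x; rewrite big_nil scale0r.
  by apply: (@ratmap_scale U W (fun=> 0)); exact: ratfun_cst.
have -> : (fun x => \sum_(j <- i :: s) f j x) = (fun x => f i x + \sum_(j <- s) f j x).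
  by apply/funext => x; rewrite big_cons.
exact: ratmap_add.
Qed.

Lemma ratmap_differentiable U (W : normedModType R) (f : 'rV[R]_m -> W) x :
  ratmap U f -> U x -> differentiable f x.
Proof.
move=> hf Ux; elim: hf => {f} [f w hf|f g _ IHf _ IHg].
  by apply: differentiableZl; exact: ratfun_differentiable hf Ux.
exact: differentiableD.
Qed.

Lemma ratmap_derive U (W : normedModType R) (f : 'rV[R]_m -> W) v : ratmap U f ->
  exists2 g, ratmap U g & forall x, U x -> 'D_v f x = g x.
Proof.
elim => {f} [f w hf|f g hf [f' hf' fE] hg [g' hg' gE]].
  have [f' hf' fE] := ratfun_derive v hf; exists (fun x => f' x *: w); first exact: ratmap_scale.
  move=> x Ux; have df := ratfun_differentiable hf Ux.
  by rewrite deriveE; [rewrite diffZl // -fE // deriveE|exact: differentiableZl].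
exists (fun x => f' x + g' x); first exact: ratmap_add.
move=> x Ux; rewrite -fE // -gE // -deriveD //; apply: diff_derivable; exact: ratmap_differentiable Ux.
Qed.

Lemma near_open_eq U (W : normedModType R) (f g : 'rV[R]_m -> W) x : open U -> U x ->
  (forall y, U y -> f y = g y) -> \near x, f x = g x.
Proof.
by move=> oU Ux fg; near=> y; apply: fg; near: y; exact: open_nbhs_nbhs.
Unshelve. all: by end_near. Qed.

Lemma ratmap_eq_differentiable U (W : normedModType R) (f g : 'rV[R]_m -> W) x : open U ->
  ratmap U g -> (forall y, U y -> f y = g y) -> U x -> differentiable f x.
Proof.
move=> oU hg fg Ux; have /diff_locallyP[cg gE] := ratmap_differentiable hg Ux.
have fE : f \o shift x = cst (f x) + 'd g x +o_ (0 : 'rV[R]_m) id.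
  apply/eqaddoP => _/posnumP[e]; move/eqaddoP : gE => /(_ e%:num (gt0 e)).
  have := near_open_eq oU Ux fg; rewrite (near_shift 0 x) subr0.
  by apply: filterS2 => h /= fgh hh; move: hh; rewrite !fctE /= fgh (fg x Ux).
have dE := diff_unique cg fE.
by apply/diff_locallyP; rewrite dE.
Qed.

(** Induction on the order: on the open set [U] the derivative of [f] agrees with that of [g], which
    is rational again. *)
Lemma ratmap_smooth U (W : normedModType R) (f g : 'rV[R]_m -> W) : open U ->
  ratmap U g -> (forall x, U x -> f x = g x) -> smooth_on U f.
Proof.
move=> oU hg fg k; have c0 (f' g' : 'rV[R]_m -> W) : ratmap U g' -> (forall x, U x -> f' x = g' x) ->
    forall x, U x -> {for x, continuous f'}.
  by move=> hg' fg' x Ux; apply/differentiable_continuous/(ratmap_eq_differentiable oU hg' fg').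
elim: k f g hg fg => [|k IH] f g hg fg; first by split=> //; exact: (c0 _ _ hg fg).
split; first exact: (c0 _ _ hg fg).
move=> i; have [g' hg' gE] := ratmap_derive (basis_vec R i) hg.
split.
  move=> x Ux; apply: (near_eq_derivable (f := g)).
    by apply: near_open_eq oU Ux _ => y Uy; rewrite fg.
  by apply: diff_derivable; exact: ratmap_differentiable hg Ux.
apply: IH hg' _ => x Ux; rewrite -gE //; apply: near_eq_derive.
exact: near_open_eq oU Ux fg.
Qed.

End RationalFunctions.

(** * The atlas *)

Lemma open_mdist_ball (R : realType) (Y : metricType R) (p : Y) (e : R) :
  open [set y | mdist p y < e].
Proof.
rewrite openE => y /= py; apply/nbhs_ballP; exists (e - mdist p y); first by rewrite /= subr_gt0.
move=> y'; rewrite ballEmdist /= => h.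
by have := metric_triangle p y y'; move: h; clear; lra.
Qed.

Section Atlas.
Variables (R : realType) (Y : metricType R) (n : nat) (r T r1 T1 k : R).
Variables (P : R -> R) (psi : Y -> 'rV[R]_n -> Y).
Hypothesis CC : conformal_charts r T r1 T1 k P psi.
Implicit Types (p a b : Y) (x z u v w : 'rV[R]_n) (t : R).
Local Notation d := (@mdist R Y).
Local Notation q x := (1 + k * edot x x).
Local Notation dl := (1 - `|k| * T).
Local Ltac sclear := clear - R Y n r T r1 T1 k P psi CC.

Lemma dl_gt0 : 0 < dl. Proof. by rewrite subr_gt0 (cc_kT CC). Qed.

Lemma q_bounds x : edot x x < T -> dl <= q x <= 2.
Proof.
move=> xT; have X0 := edot_ge0 x; have kT := cc_kT CC.
have : `|k * edot x x| <= `|k| * T by rewrite normrM (ger0_norm X0) ler_wpM2l // ltW.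
by rewrite ler_norml; move: kT; sclear; lra.
Qed.

Lemma q_gt0 x : edot x x < T -> 0 < q x.
Proof. by move=> /q_bounds /andP[h _]; apply: lt_le_trans dl_gt0 h. Qed.

Lemma q_neq0 x : edot x x < T -> q x != 0.
Proof. by move=> /q_gt0 h; rewrite gt_eqF. Qed.

Lemma r_gt0 : 0 < r.
Proof. by move: (cc_r1 CC) (cc_r CC); sclear; lra. Qed.

Lemma cod_T x : edot x x < T1 -> edot x x < T.
Proof. by move=> h; apply: lt_trans h (cc_T CC). Qed.

Lemma r1_r : r1 < r.
Proof. by move: (cc_r1 CC) (cc_r CC); sclear; lra. Qed.

Lemma psi_near p x x' : edot x x < T -> edot x' x' < T -> 0 <= d (psi p x) (psi p x') < 2 * r.
Proof.
move=> xT xT'; rewrite mdist_ge0 /=; apply: le_lt_trans (metric_triangle _ p _) _.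
by have := cc_in CC p xT; have := cc_in CC p xT'; rewrite (metric_sym _ p); sclear; lra.
Qed.

Lemma psi_inj p x x' : edot x x < T -> edot x' x' < T -> psi p x = psi p x' -> x = x'.
Proof.
move=> xT xT' E; have := cc_law CC p xT xT'; rewrite E mdistxx (cc_P0 CC) => /esym/eqP.
have Q : q x * q x' != 0 by rewrite mulf_neq0 ?q_neq0.
rewrite mulf_eq0 invr_eq0 (negbTE Q) orbF mulf_eq0 pnatr_eq0 /= => /eqP /edot_eq0 /eqP.
by rewrite subr_eq0 => /eqP.
Qed.

Definition phi p y := xget 0 [set x | edot x x < T /\ psi p x = y].

Lemma phiP p y : d p y < r -> edot (phi p y) (phi p y) < T /\ psi p (phi p y) = y.
Proof.
by move=> /(cc_onto CC)[x xT xE]; apply: (@xgetPex _ 0 [set x | edot x x < T /\ psi p x = y]); exists x.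
Qed.

Lemma psiK p x : edot x x < T -> phi p (psi p x) = x.
Proof. by move=> xT; have [h1 h2] := phiP (cc_in CC p xT); apply: psi_inj h2. Qed.

Lemma near_edot x e : 0 < e -> \forall y \near x, edot (x - y) (x - y) < e.
Proof.
move=> e0; pose f (y : 'rV[R]_n) := edot y y + (- 2 * edot y x + edot x x).
have fE y : edot (x - y) (x - y) = f y by rewrite /f !edot_lin (edotC x y); ring.
have rf : ratfun setT f.
  apply: ratfun_add; first exact: ratfun_edotxx.
  apply: ratfun_add; last exact: ratfun_cst.
  by apply: ratfun_mul; [exact: ratfun_cst|exact: ratfun_edot].
have cf : {for x, continuous f} by apply: differentiable_continuous; exact: (ratfun_differentiable rf).
have f0 : f x = 0 by rewrite -fE subrr edot0l.
move/cvgrPdist_lt : cf => /(_ _ e0); rewrite f0; apply: filterS => y.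
by rewrite sub0r normrN -fE ger0_norm // edot_ge0.
Qed.

Lemma ball_edot x y e : 0 < e -> edot (x - y) (x - y) < e ^+ 2 -> ball x e y.
Proof.
move=> e0 h; split=> // i j; rewrite -ball_normE /ball_ /= (ord1 i) {i}.
rewrite -(@ltr_pXn2r _ 2) ?nnegrE ?(ltW e0) // real_normK ?num_real //.
apply: le_lt_trans h; rewrite edotE (bigD1 j) //= !mxE -expr2 lerDl.
by apply: sumr_ge0 => l _; rewrite -expr2 sqr_ge0.
Qed.

(** A distance of at least [e'] would, by monotonicity of [P] and the chordal law, keep the
    coordinates apart; [dl] bounds the denominators from below on the whole coordinate ball. *)
Lemma psi_cont p x e : edot x x < T -> 0 < e ->
  \forall y \near x, edot y y < T -> d (psi p x) (psi p y) < e.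
Proof.
move=> xT e0; pose e' := Num.min e r.
have e'0 : 0 < e' by rewrite lt_min e0 r_gt0.
have e'r : e' < 2 * r by rewrite gt_min; apply/orP; right; move: r_gt0; sclear; lra.
have Pe : 0 < P e' by rewrite -(cc_P0 CC); apply: (cc_mono CC).
have D0 := dl_gt0; have b0 : 0 < P e' * (dl * dl) / 2 by rewrite divr_gt0 // !mulr_gt0.
apply: filterS (near_edot x b0) => y h yT.
apply: lt_le_trans (_ : e' <= e); last by rewrite ge_min lexx.
rewrite ltNge; apply/negP => le_d.
have : P e' <= P (d (psi p x) (psi p y)).
  move: le_d; rewrite le_eqVlt => /orP[/eqP <- //|lt_d].
  by apply/ltW/(cc_mono CC) => //; [exact: ltW|by have /andP[] := psi_near p xT yT].
rewrite (cc_law CC) // leNgt => /negP; apply.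
have /andP[qx _] := q_bounds xT; have /andP[qy _] := q_bounds yT.
rewrite ltr_pdivrMr ?mulr_gt0 ?q_gt0 //.
have Q : dl * dl <= q x * q y by apply: ler_pM => //; exact: ltW.
have : P e' * (dl * dl) <= P e' * (q x * q y) by rewrite ler_pM2l.
by move: h; set A := edot _ _; set B := P e' * (dl * dl); set D := P e' * _; sclear; lra.
Qed.

Lemma phi_ucont e : 0 < e -> exists2 s, 0 < s &
  forall p y y', d p y < r -> d p y' < r -> d y y' < s -> edot (phi p y - phi p y') (phi p y - phi p y') < e.
Proof.
move=> e0; have [|s s0 hs] := cc_cont CC (eta := e / 2); first by rewrite divr_gt0.
exists s => // p y y' py py' yy'; have [h1 E1] := phiP py; have [h2 E2] := phiP py'.
have := hs (d y y'); rewrite mdist_ge0 yy' => /(_ isT).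
rewrite -{1}E1 -{1}E2 (cc_law CC) //.
have /andP[_ q1] := q_bounds h1; have /andP[_ q2] := q_bounds h2.
rewrite ltr_pdivrMr ?mulr_gt0 ?q_gt0 //.
have Q : q (phi p y) * q (phi p y') <= 2 * 2 by apply: ler_pM => //; apply/ltW/q_gt0.
have : e / 2 * (q (phi p y) * q (phi p y')) <= e / 2 * (2 * 2) by rewrite ler_pM2l // divr_gt0.
by set A := edot (_ - _) _; set B := q _ * _; sclear; lra.
Qed.

Definition chart_dom p : set Y := [set y | d p y < r1].
Definition chart_cod : set 'rV[R]_n := [set x | edot x x < T1].

Lemma chart_dom_open p : open (chart_dom p).
Proof. exact: open_mdist_ball. Qed.

Lemma edot_continuous : continuous (fun x : 'rV[R]_n => edot x x).
Proof.
by move=> x; apply: differentiable_continuous; exact: (ratfun_differentiable (ratfun_edotxx setT)).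
Qed.

Lemma chart_cod_open : open chart_cod.
Proof. by apply: (@open_comp _ _ (fun x : 'rV[R]_n => edot x x) [set t | t < T1]) => [x _|]; [exact: edot_continuous|exact: open_lt]. Qed.

Lemma chart_map_cod p y : chart_dom p y -> chart_cod (phi p y).
Proof.
move=> py; have pyr : d p y < r by apply: lt_trans py r1_r.
by have [h E] := phiP pyr; rewrite /chart_cod /= -(cc_in1 CC p h) E.
Qed.

Lemma chart_inv_dom p x : chart_cod x -> chart_dom p (psi p x).
Proof. by move=> h; rewrite /chart_dom /= (cc_in1 CC) //; exact: cod_T. Qed.

Lemma chart_mapK p y : chart_dom p y -> psi p (phi p y) = y.
Proof. by move=> py; have [] := phiP (lt_trans py r1_r). Qed.

Lemma chart_invK p x : chart_cod x -> phi p (psi p x) = x.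
Proof. by move=> h; apply/psiK/cod_T. Qed.

Lemma chart_map_continuous p : {within chart_dom p, continuous (phi p)}.
Proof.
apply/subspace_continuousP => y py; apply/cvg_ballP => e e0; rewrite near_withinE.
have [|s s0 hs] := @phi_ucont (e ^+ 2); first by rewrite exprn_gt0.
apply/nbhs_ballP; exists s => // y' yy' py'; apply: ball_edot => //; apply: hs.
- exact: lt_trans py r1_r.
- exact: lt_trans py' r1_r.
by move: yy'; rewrite ballEmdist.
Qed.

Lemma chart_inv_continuous p : {within chart_cod, continuous (psi p)}.
Proof.
apply/subspace_continuousP => x xT; apply/cvg_ballP => e e0; rewrite near_withinE.
apply: filterS (psi_cont p (cod_T xT) e0) => y h yT; have {}h := h (cod_T yT).
by rewrite ballEmdist.
Qed.

Definition conf_chart p : chart Y R n :=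
  @Chart Y R n (chart_dom p) chart_cod (phi p) (psi p) (@chart_dom_open p) chart_cod_open
    (@chart_map_cod p) (@chart_inv_dom p) (@chart_mapK p) (@chart_invK p)
    (@chart_map_continuous p) (@chart_inv_continuous p).

Definition conf_factor x : R := 4 * (q x * q x)^-1.

Definition conf_metric (p : Y) x : 'M[R]_n := (conf_factor x)%:M.

Lemma ratfun_q U : ratfun U (fun x => q x).
Proof.
by apply: ratfun_add; [|apply: ratfun_mul]; try exact: ratfun_cst; exact: ratfun_edotxx.
Qed.

Lemma ratfun_conf_factor : ratfun chart_cod conf_factor.
Proof.
apply: ratfun_mul; first exact: ratfun_cst.
apply: ratfun_inv; first by apply: ratfun_mul; exact: ratfun_q.
by move=> x /cod_T h; rewrite mulf_neq0 // q_neq0.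
Qed.

Lemma conf_factor_gt0 x : chart_cod x -> 0 < conf_factor x.
Proof. by move=> /cod_T h; rewrite mulr_gt0 // invr_gt0 mulr_gt0 // q_gt0. Qed.

Lemma conf_metric_smooth p : smooth_on (ccod (conf_chart p)) (conf_metric p).
Proof.
apply: (ratmap_smooth (g := fun x => conf_factor x *: (1%:M : 'M[R]_n))) chart_cod_open _ _.
  by apply: ratmap_scale; exact: ratfun_conf_factor.
by move=> x _; rewrite scalemx1.
Qed.

Lemma metric_at_conf p x u v : metric_at (conf_metric p) x u v = conf_factor x * edot u v.
Proof. by rewrite /metric_at /conf_metric mul_mx_scalar -scalemxAl mxE. Qed.

Lemma overlap_open a b : open (overlap (conf_chart a) (conf_chart b)).
Proof.
rewrite openE => x [/= xc xb]; have xT := cod_T xc.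
have e0 : 0 < r1 - d b (psi a x) by rewrite subr_gt0.
have h1 := psi_cont a xT e0.
have h2 : \forall y \near x, chart_cod y by apply: open_nbhs_nbhs; split => //; exact: chart_cod_open.
apply: filterS2 h1 h2 => y h3 yc; split => //=; rewrite /chart_dom /=.
have := h3 (cod_T yc); have := metric_triangle b (psi a x) (psi a y); sclear; lra.
Qed.

(* The coordinates [z] of a point in the chart at [b] are determined by its
   distances to [b] and to the points [psi b (h *: e_i)]; in the chart at [a]
   the law expresses these distances rationally. *)
Lemma transition_rational a b x0 : overlap (conf_chart a) (conf_chart b) x0 ->
  exists2 g : 'rV[R]_n -> 'rV[R]_n, ratmap (overlap (conf_chart a) (conf_chart b)) g &
    forall x, overlap (conf_chart a) (conf_chart b) x -> transition (conf_chart a) (conf_chart b) x = g x.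
Proof.
set U := overlap _ _ => -[/= x0c x0b].
have [h h0 hT] : exists2 h : R, 0 < h & h ^+ 2 < T1.
  exists (Num.min 1 (T1 / 2)); first by rewrite lt_min ltr01 divr_gt0 // (cc_T1 CC).
  set h := Num.min _ _; have h1 : h <= 1 by rewrite ge_min lexx.
  have h2 : h <= T1 / 2 by rewrite ge_min lexx orbT.
  have h0 : 0 <= h by rewrite le_min ler01 divr_ge0 // ltW // (cc_T1 CC).
  by have := ler_piMl h0 h1; rewrite -expr2; move: h2 (cc_T1 CC); sclear; lra.
have [E [Edot Ez]] : exists E : 'I_n -> 'rV[R]_n,
    (forall i, edot (E i) (E i) = h ^+ 2) /\ (forall i z, edot z (E i) = h * z 0 i).
  exists (fun i => h *: delta_mx 0 i); split => i => [|z]; rewrite ?edotZl edotZr edotE (bigD1 i) //= big1.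
  - by rewrite !mxE !eqxx mulr1 addr0 mulr1 expr2.
  - by move=> j /negbTE ni; rewrite !mxE ni mulr0.
  - by rewrite !mxE !eqxx mulr1 addr0.
  - by move=> j /negbTE ni; rewrite !mxE ni andbF mulr0.
pose W i := psi b (E i).
(* The point [x0] of the overlap bounds the distance of the centres, so that every [W i] is within
   [3 * r1] of [a], hence in the domain of the law at [a]. *)
have ab : d a b < 2 * r1.
  have := chart_inv_dom a x0c; rewrite /chart_dom /= in x0b *.
  by have := metric_triangle a (psi a x0) b; rewrite (metric_sym (psi a x0) b); move: x0b; sclear; lra.
have bW i : d b (W i) < r1 by apply: chart_inv_dom; rewrite /chart_cod /= Edot.
have aW i : d a (W i) < r.
  by have := metric_triangle a b (W i); move: (bW i) ab (cc_r CC); sclear; lra.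
have ab' : d a b < r by move: ab (cc_r CC) (cc_r1 CC); sclear; lra.
have [bT bE] := phiP ab'; set be := phi a b in bT bE.
pose om i := phi a (W i).
have omP i : edot (om i) (om i) < T /\ psi a (om i) = W i by exact: phiP.
(* With [z] the coordinates at [b], these functions of [x] are [|z| ^ 2 / q z] for [B], [1 / q z]
   for [A], [|z - E i| ^ 2 / q z] for [G i] and [z_i / q z] for [N i]. The coordinates are the
   quotients of [N i] by [A]. *)
pose B x := edot (x - be) (x - be) * ((q x)^-1 * (q be)^-1).
pose A x := 1 - k * B x.
pose G i x := (1 + k * h ^+ 2) * (edot (x - om i) (x - om i) * ((q x)^-1 * (q (om i))^-1)).
pose N i x := (B x + h ^+ 2 * A x - G i x) * (2 * h)^-1.
have keyE x : U x -> let z := phi b (psi a x) in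
    [/\ edot z z < T, A x = (q z)^-1 & forall i, N i x = z 0 i * (q z)^-1].
  move=> [/= xc xb]; have xT := cod_T xc.
  move: (phi b (psi a x)) (phiP (lt_trans xb r1_r)) => z [zT zE] /=.
  have BE : B x = edot z z / q z.
    have e1 := cc_law CC a xT bT; rewrite bE in e1.
    have e2 := cc_law CC b zT (_ : edot 0 0 < T).
    rewrite zE (cc_center CC) edot0l mulr0 addr0 mulr1 subr0 in e2.
    have {}e2 := e2 (lt_trans (cc_T1 CC) (cc_T CC)).
    rewrite /B; move: e1; rewrite e2 => e1; apply: (@mulfI _ 2); first by rewrite pnatr_eq0.
    by rewrite -invfM mulrA -e1 mulrA.
  have AE : A x = (q z)^-1.
    rewrite /A BE; have := q_neq0 zT; set Z := edot z z; sclear => qz; field.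
    exact: qz.
  split=> // i; have [oT oE] := omP i.
  have e1 := cc_law CC a xT oT; rewrite oE in e1.
  have eT : edot (E i) (E i) < T by rewrite Edot; exact: lt_trans hT (cc_T CC).
  have e2 := cc_law CC b zT eT; rewrite zE -/(W i) e1 in e2.
  have GE : G i x = edot (z - E i) (z - E i) / q z.
    rewrite /G -invfM; apply: (@mulfI _ 2); first by rewrite pnatr_eq0.
    rewrite mulrCA [2 * (_ / _)]mulrA e2 Edot.
    have qE : 1 + k * h ^+ 2 != 0 by rewrite -(Edot i) q_neq0.
    have := q_neq0 zT; move: qE; set Q := 1 + k * h ^+ 2; set Q' := q z; set D := edot _ _.
    by sclear => Q0 Q'0; field; rewrite Q0 Q'0.
  rewrite /N BE AE GE !edot_lin (edotC (E i) z) Edot Ez.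
  have := q_neq0 zT; set Z := edot z z; move: h0; sclear => h0 qz; field.
  by rewrite qz gt_eqF.
have qU : ratfun U (fun x => (q x)^-1).
  by apply: ratfun_inv (ratfun_q U) _ => x [/= /cod_T/q_neq0].
have esubU w : ratfun U (fun x => edot (x - w) (x - w)).
  have -> : (fun x : 'rV[R]_n => edot (x - w) (x - w)) = (fun x => edot x x + (- 2 * edot x w + edot w w)).
    by apply/funext => x; rewrite !edot_lin (edotC w x); ring.
  apply: ratfun_add; first exact: ratfun_edotxx.
  apply: ratfun_add; last exact: ratfun_cst.
  by apply: ratfun_mul; [exact: ratfun_cst|exact: ratfun_edot].
have BU : ratfun U B.
  by apply: ratfun_mul => //; apply: ratfun_mul => //; exact: ratfun_cst.
have AU : ratfun U A.
  by apply: ratfun_sub; [exact: ratfun_cst|apply: ratfun_mul => //; exact: ratfun_cst].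
have GU i : ratfun U (G i).
  apply: ratfun_mul; first exact: ratfun_cst.
  by apply: ratfun_mul => //; apply: ratfun_mul => //; exact: ratfun_cst.
have NU i : ratfun U (N i).
  apply: ratfun_mul; last exact: ratfun_cst.
  by apply: ratfun_sub => //; apply: ratfun_add => //; apply: ratfun_mul => //; exact: ratfun_cst.
exists (fun x => \sum_i (N i x * (A x)^-1) *: delta_mx 0 i).
  apply: ratmap_sum => i; apply: ratmap_scale; apply: ratfun_mul => //; apply: ratfun_inv => //.
  by move=> x /keyE[zT -> _]; rewrite invr_eq0 q_neq0.
move=> x Ux; have [zT AE NE] := keyE x Ux; rewrite /transition /=.
rewrite {1}[phi b _]row_sum_delta; apply: eq_bigr => i _; congr (_ *: _).
by rewrite NE AE invrK divfK // q_neq0.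
Qed.

Lemma transition_smooth a b :
  smooth_on (overlap (conf_chart a) (conf_chart b)) (transition (conf_chart a) (conf_chart b)).
Proof.
have [[x0 Ux0]|hU] := pselect (exists x, overlap (conf_chart a) (conf_chart b) x).
  have [g hg gE] := transition_rational Ux0; exact: ratmap_smooth (@overlap_open a b) hg gE.
apply: (ratmap_smooth (g := fun x => 0 *: 0)) (@overlap_open a b) _ _.
  by apply: (@ratmap_scale _ _ _ _ (fun=> 0)); exact: ratfun_cst.
by move=> x Ux; case: hU; exists x.
Qed.

Lemma transition_differentiable a b x : overlap (conf_chart a) (conf_chart b) x ->
  differentiable (transition (conf_chart a) (conf_chart b)) x.
Proof.
move=> Ux; have [g hg gE] := transition_rational Ux.
exact: ratmap_eq_differentiable (@overlap_open a b) hg gE Ux.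
Qed.

End Atlas.

(** * The metric tensor and its curvature *)

Section Curvature.
Variables (R : realType) (Y : metricType R) (n : nat) (r T r1 T1 k : R).
Variables (P : R -> R) (psi : Y -> 'rV[R]_n -> Y).
Hypothesis CC : conformal_charts r T r1 T1 k P psi.
Implicit Types (p a b : Y) (x z u v w : 'rV[R]_n) (t : R) (i j l h : 'I_n).
Local Notation d := (@mdist R Y).
Local Ltac sclear := clear - R Y n r T r1 T1 k P psi CC.
Local Notation q x := (1 + k * edot x x).
Local Notation chart := (conf_chart CC).
Local Notation phi := (phi T psi).
Local Notation fac := (conf_factor k).
Local Notation gm := (conf_metric k).
Local Notation cod := (chart_cod T1).

(** The chordal laws in both charts compute [P] of the same distance. Applied to [x] and
    [t *: u + x], divided by [t ^ 2], their equality becomes the claim as [t] tends to 0. *)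
Lemma transition_isometric a b x u : overlap (chart a) (chart b) x ->
  let tau := transition (chart a) (chart b) in
  fac x * edot u u = fac (tau x) * edot (u *m 'J tau x) (u *m 'J tau x).
Proof.
move=> Ux tau; have dtau := transition_differentiable Ux.
rewrite -deriveEjacobian //; set D := 'D_u tau x.
have tauT z : overlap (chart a) (chart b) z -> edot (tau z) (tau z) < T /\ psi b (tau z) = psi a z.
  by move=> [/= zc zb]; apply: (phiP CC); exact: lt_trans zb (r1_r CC).
have zT z : overlap (chart a) (chart b) z -> edot z z < T by move=> [/= /(cod_T CC)].
pose g t := edot (t^-1 *: (tau (t *: u + x) - tau x)) (t^-1 *: (tau (t *: u + x) - tau x)) * (q x * q (t *: u + x)).
pose g' t := edot u u * (q (tau x) * q (tau (t *: u + x))).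
have cx : (fun t : R => t *: u + x) @ (0 : R)^' --> x.
  apply: cvg_trans (_ : (fun t : R => t *: u + x) @ (0 : R) --> x).
    by apply: cvg_app; exact: nbhs_dnbhs.
  have -> : nbhs x = nbhs ((fun t : R => t *: u + x) 0) by rewrite scale0r add0r.
  apply: (@continuousD _ _ _ (fun t : R => t *: u) (cst x)); last exact: cst_continuous.
  exact: scalel_continuous.
have ctau : (fun t : R => tau (t *: u + x)) @ (0 : R)^' --> tau x.
  exact: cvg_comp cx (differentiable_continuous dtau).
have cq (f : R -> 'rV[R]_n) z : f @ (0 : R)^' --> z -> (fun t => q (f t)) @ (0 : R)^' --> q z.
  move=> fz; have c1 : (fun=> 1 : R) @ (0 : R)^' --> (1 : R) by exact: cvg_cst.
  apply: (cvgD c1); apply: cvgMr; exact: (@cvg_comp _ _ _ f (fun y : 'rV[R]_n => edot y y) _ _ _ fz (@edot_continuous R n z)).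
have cD : (fun t => t^-1 *: (tau (t *: u + x) - tau x)) @ (0 : R)^' --> D.
  exact: (@diff_derivable _ _ _ tau x u dtau).
have cg : g @ (0 : R)^' --> edot D D * (q x * q x).
  apply: cvgM; last by apply: cvgMr; exact: cq.
  exact: (@cvg_comp _ _ _ _ (fun y : 'rV[R]_n => edot y y) _ _ _ cD (@edot_continuous R n D)).
have cg' : g' @ (0 : R)^' --> edot u u * (q (tau x) * q (tau x)).
  by apply: cvgMr; apply: cvgMr; exact: cq.
have E : edot D D * (q x * q x) = edot u u * (q (tau x) * q (tau x)).
  suff cg2 : g @ (0 : R)^' --> edot u u * (q (tau x) * q (tau x)).
    exact: (@cvg_unique _ (@norm_hausdorff R R) _ _ _ _ cg cg2).
  apply: cvg_trans cg'; apply: near_eq_cvg.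
  have Un : \forall t \near (0 : R)^', overlap (chart a) (chart b) (t *: u + x).
    have hU : nbhs x (overlap (chart a) (chart b)).
      by apply: open_nbhs_nbhs; split => //; exact: overlap_open.
    exact: (cx _ hU).
  have t0 : \forall t \near (0 : R)^', t != 0 by exact: nbhs_dnbhs_neq.
  apply: filterS2 Un t0 => t Ut t0; rewrite /g /g'.
  have [h1 E1] := tauT _ Ux; have [h2 E2] := tauT _ Ut.
  have := cc_law CC b h2 h1; rewrite E1 E2 (cc_law CC) ?zT //.
  rewrite addrK !edotZl !edotZr.
  have := q_neq0 CC (zT _ Ux); have := q_neq0 CC (zT _ Ut); have := q_neq0 CC h1; have := q_neq0 CC h2.
  set q1 := q _; set q2 := q _; set q3 := q _; set q4 := q _; set A := edot u u; set B := edot _ _.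
  move=> n1 n2 n3 n4 EE; have BE : B = (2 * B / (q1 * q2)) * (q1 * q2) / 2.
    by move: n1 n2; sclear => n1 n2; field; rewrite n1 n2.
  rewrite -EE in BE; rewrite BE; move: n1 n2 n3 n4 t0; sclear => n1 n2 n3 n4 t0.
  by field; rewrite n3 n4 t0.
rewrite /conf_factor; have := q_neq0 CC (zT _ Ux); have [h1 _] := tauT _ Ux; have := q_neq0 CC h1.
move: E; set q1 := q x; set q2 := q _; set A := edot D D; set B := edot u u.
sclear => E n2 n1; apply: (@mulfI _ ((q1 * q1) * (q2 * q2))); first by rewrite !mulf_neq0.
transitivity (4 * (B * (q2 * q2))); first by field.
by rewrite -E; field.
Qed.

(** Polarization of [transition_isometric], evaluated on basis vectors. *)
Lemma transition_compat a b x : overlap (chart a) (chart b) x ->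
  let tau := transition (chart a) (chart b) in
  gm a x = 'J tau x *m gm b (tau x) *m ('J tau x)^T.
Proof.
move=> Ux tau; set J := 'J tau x.
have pol u v : fac x * edot u v = fac (tau x) * edot (u *m J) (v *m J).
  have h1 := transition_isometric (u + v) Ux; have h2 := transition_isometric u Ux.
  have h3 := transition_isometric v Ux; move: h1 h2 h3; rewrite /= -/tau -/J mulmxDl !edot_lin.
  rewrite (edotC v u) (edotC (v *m J) (u *m J)) !mulrDr; sclear; lra.
apply/matrixP => i j; rewrite mul_mx_scalar -scalemxAl !mxE.
have := pol (delta_mx 0 i) (delta_mx 0 j); rewrite -!rowE [edot (row i J) _]edotE.
rewrite [edot (delta_mx 0 i) _]edotE (bigD1 i) //= big1 => [|l /negbTE ni]; last first.
  by rewrite !mxE ni andbF mul0r.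
rewrite !mxE !eqxx /= mul1r addr0 mulr_natr eq_sym => ->; congr (_ * _).
by apply: eq_bigr => l _; rewrite !mxE.
Qed.

(** The class [is_derive] sealed as in [der1], here along a direction [v]. *)
Definition dirder v x (f : 'rV[R]_n -> R) (l : R) : Prop := is_derive x v f l.

Lemma dirder_eq v x f g (l : R) : (\near x, f x = g x) -> dirder v x g l -> 'D_v f x = l.
Proof. by move=> fg [_ <-]; exact: near_eq_derive. Qed.

Lemma dirder_cst v x (c : R) : dirder v x (fun=> c) 0.
Proof. exact: is_derive_cst. Qed.

Lemma dirderD v x f g (l m : R) : dirder v x f l -> dirder v x g m -> dirder v x (fun z => f z + g z) (l + m).
Proof. by move=> hf hg; apply: (@is_deriveD _ _ _ f g x v l m hf hg). Qed.

Lemma dirderM v x f g (l m : R) : dirder v x f l -> dirder v x g m ->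
  dirder v x (fun z => f z * g z) (f x * m + g x * l).
Proof. by move=> hf hg; apply: (@is_deriveM _ _ f g x v l m hf hg). Qed.

Lemma dirderZ v x f c (l : R) : dirder v x f l -> dirder v x (fun z => c * f z) (c * l).
Proof. by move=> hf; have := dirderM (dirder_cst v x c) hf; rewrite mulr0 addr0. Qed.

Lemma dirderN v x f (l : R) : dirder v x f l -> dirder v x (fun z => - f z) (- l).
Proof. by move=> hf; apply: (@is_deriveN _ _ _ f x v l hf). Qed.

Lemma dirderV v x f (l : R) : f x != 0 -> dirder v x f l -> dirder v x (fun z => (f z)^-1) (- l / (f x * f x)).
Proof.
move=> f0 [df dl]; split; first exact: derivableV.
by rewrite deriveV // dl /GRing.scale /= expr2 !mulNr mulrC.
Qed.

Lemma dirder_coord v x i : dirder v x (fun z => z 0 i) (v 0 i).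
Proof.
split; last exact: derive_coord.
by apply: diff_derivable; exact: differentiable_coord.
Qed.

Lemma dirder_edot v x : dirder v x (fun z => edot z z) (2 * edot x v).
Proof.
have -> : (fun z : 'rV[R]_n => edot z z) = \sum_i (fun z : 'rV[R]_n => z 0 i * z 0 i).
  by apply/funext => z; rewrite edotE fct_sumE.
have -> : 2 * edot x v = \sum_i (x 0 i * v 0 i + x 0 i * v 0 i).
  by rewrite edotE mulr_sumr; apply: eq_bigr => i _; ring.
apply: is_derive_sum => i; apply: dirderM; exact: dirder_coord.
Qed.

(** The partial derivative of half the logarithm of the conformal factor, in terms of which the
    Christoffel symbols and the curvature of a conformally flat metric are expressed. *)
Definition conf_grad x i : R := - (2 * k) * (x 0 i * (q x)^-1).

Local Notation dlt i j := ((i == j)%:R : R).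

Lemma edot_basis x i : edot x (basis_vec R i) = x 0 i.
Proof.
rewrite edotE (bigD1 i) //= big1 => [|j /negbTE ni]; rewrite !mxE ?eqxx /= ?ni ?mulr0 ?mulr1 ?addr0 //.
Qed.

Lemma basis_coord i j : basis_vec R i 0 j = dlt i j.
Proof. by rewrite /basis_vec mxE eqxx eq_sym. Qed.

Lemma dirder_q i x : dirder (basis_vec R i) x (fun z => q z) (2 * k * x 0 i).
Proof.
have := dirderD (dirder_cst (basis_vec R i) x 1) (dirderZ k (dirder_edot (basis_vec R i) x)).
by rewrite edot_basis add0r mulrCA mulrA.
Qed.

Lemma dirder_conf_factor i x : cod x -> dirder (basis_vec R i) x fac (2 * fac x * conf_grad x i).
Proof.
move=> /(cod_T CC) /(q_neq0 CC) q0.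
have := dirderZ 4 (dirderV (mulf_neq0 q0 q0) (dirderM (dirder_q i x) (dirder_q i x))).
rewrite (_ : 4 * _ = 2 * fac x * conf_grad x i) //.
by rewrite /conf_factor /conf_grad; move: q0; set Q := q x; sclear => q0; field.
Qed.

Lemma dirder_conf_grad i j x : cod x ->
  dirder (basis_vec R i) x (fun z => conf_grad z j)
    (conf_grad x i * conf_grad x j - 2 * k / q x * dlt i j).
Proof.
move=> /(cod_T CC) /(q_neq0 CC) q0.
have := dirderZ (- (2 * k)) (dirderM (dirder_coord (basis_vec R i) x j) (dirderV q0 (dirder_q i x))).
rewrite basis_coord (_ : - (2 * k) * _ = conf_grad x i * conf_grad x j - 2 * k / q x * dlt i j) //.
by rewrite /conf_grad; move: q0; set Q := q x; set D := dlt i j; sclear => q0; field.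
Qed.

Lemma sum_dlt l (f : 'I_n -> R) : \sum_h dlt h l * f h = f l.
Proof. by rewrite (bigD1 l) //= big1 => [|h /negbTE ->]; rewrite ?eqxx ?mul1r ?addr0 ?mul0r. Qed.

Lemma cod_near x f g : cod x -> (forall z, cod z -> f z = g z :> R) -> \near x, f x = g x.
Proof. by move=> cx; apply: near_open_eq => //; exact: chart_cod_open. Qed.

Lemma pderiv_conf_metric p i j l x : cod x ->
  pderiv i (fun z => gm p z j l) x = 2 * fac x * conf_grad x i * dlt j l.
Proof.
move=> cx; apply: (@dirder_eq _ _ _ (fun z => fac z * dlt j l)).
  by apply: cod_near cx _ => z _; rewrite /conf_metric mxE mulr_natr.
have := dirderM (dirder_conf_factor i cx) (dirder_cst (basis_vec R i) x (dlt j l)).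
by rewrite mulr0 add0r mulrC.
Qed.

Lemma christoffel_conf p l i j x : cod x -> christoffel (gm p) l i j x =
  conf_grad x i * dlt j l + conf_grad x j * dlt i l - conf_grad x l * dlt i j.
Proof.
move=> cx; have f0 := conf_factor_gt0 CC cx.
rewrite /christoffel {1}/conf_metric invmx_scalar.
transitivity (2^-1 * \sum_h dlt h l * ((fac x)^-1 * (2 * fac x * conf_grad x i * dlt j h
    + 2 * fac x * conf_grad x j * dlt i h - 2 * fac x * conf_grad x h * dlt i j))).
  congr (_ * _); apply: eq_bigr => h _; rewrite !pderiv_conf_metric // mxE [l == h]eq_sym.
  by case: (h == l); rewrite ?mulr1n ?mulr0n ?mul1r ?mul0r.
rewrite sum_dlt; move: (lt0r_neq0 f0); set f := fac x.
by set D1 := dlt j l; set D2 := dlt i l; set D3 := dlt i j; sclear => f0; field.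
Qed.

Lemma pderiv_christoffel p h l i j x : cod x ->
  let c := 2 * k / q x in let a := conf_grad x in
  pderiv h (christoffel (gm p) l i j) x =
    (a h * a i - c * dlt h i) * dlt j l + (a h * a j - c * dlt h j) * dlt i l
    - (a h * a l - c * dlt h l) * dlt i j.
Proof.
move=> cx c a; pose e := basis_vec R h.
apply: (@dirder_eq _ _ _ (fun z => (dlt j l * conf_grad z i + dlt i l * conf_grad z j)
    + - (dlt i j * conf_grad z l))).
  by apply: cod_near cx _ => z cz; rewrite christoffel_conf //; ring.
have := dirderD (dirderD (dirderZ (dlt j l) (dirder_conf_grad h i cx))
  (dirderZ (dlt i l) (dirder_conf_grad h j cx))) (dirderN (dirderZ (dlt i j) (dirder_conf_grad h l cx))).
by rewrite ![dlt _ _ * (_ - _)]mulrC.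
Qed.

Lemma riemann_conf p l i j h x : cod x ->
  riemann (gm p) l i j h x = k * fac x * (dlt j h * dlt i l - dlt i h * dlt j l).
Proof.
move=> cx; rewrite /riemann !pderiv_christoffel //.
pose a := conf_grad x; pose S := \sum_m a m * a m.
have quad i' j' : \sum_m christoffel (gm p) l i' m x * christoffel (gm p) m j' h x =
    a i' * (a j' * dlt h l + a h * dlt j' l - a l * dlt j' h)
    + dlt i' l * (2 * a j' * a h - S * dlt j' h)
    - a l * (a j' * dlt h i' + a h * dlt j' i' - a i' * dlt j' h).
  pose G m := a j' * dlt h m + a h * dlt j' m - a m * dlt j' h.
  have -> : 2 * a j' * a h - S * dlt j' h = \sum_m a m * G m.
    transitivity (\sum_m (a j' * (dlt m h * a m) + a h * (dlt m j' * a m) - dlt j' h * (a m * a m))).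
      by rewrite sumrB big_split /= -!mulr_sumr !sum_dlt -/S; ring.
    by apply: eq_bigr => m _; rewrite /G ![m == _]eq_sym; ring.
  transitivity (\sum_m (a i' * (dlt m l * G m) + dlt i' l * (a m * G m) - a l * (dlt m i' * G m))).
    apply: eq_bigr => m _; rewrite !christoffel_conf // -/a -/(G m) [i' == m]eq_sym.
    by rewrite /G; ring.
  by rewrite sumrB big_split /= -!mulr_sumr !sum_dlt.
rewrite sumrB !quad.
have q0 := q_neq0 CC (cod_T CC cx).
have SE : S = 4 * k * k * (q x)^-1 * (q x)^-1 * edot x x.
  rewrite /S /a /conf_grad; set Q := (q x)^-1; rewrite edotE mulr_sumr.
  by apply: eq_bigr => m _; ring.
(* The contribution [4 * k / q] of the second derivatives, less the squared gradient
   [4 * k ^ 2 * |x| ^ 2 / q ^ 2], leaves [4 * k / q ^ 2], because [q - k * |x| ^ 2 = 1]. *)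
have -> : k * fac x = 2 * (2 * k / q x) - S.
  by rewrite SE /conf_factor; move: q0; set X := edot x x; sclear => q0; field.
rewrite -/(a i) -/(a j) -/(a h) -/(a l) [h == i]eq_sym [h == j]eq_sym [j == i]eq_sym.
move: (a i) (a j) (a h) (a l) => ai aj ah al.
by set D1 := dlt j h; set D2 := dlt i h; set D3 := dlt j l; set D4 := dlt i l; set D5 := dlt i j; set D6 := dlt h l; ring.
Qed.

Lemma curvature_op_conf p u v x : cod x ->
  curvature_op (gm p) x u v v = (k * fac x) *: (edot v v *: u - edot u v *: v).
Proof.
move=> cx; apply/rowP => l; rewrite !mxE; set K := k * fac x.
transitivity (\sum_i \sum_j \sum_h (K * (u 0 i * v 0 j) * dlt i l) * (dlt h j * v 0 h)
    - \sum_i \sum_j \sum_h (K * (u 0 i * v 0 j) * dlt j l) * (dlt h i * v 0 h)).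
  rewrite -sumrB; apply: eq_bigr => i _; rewrite -sumrB; apply: eq_bigr => j _.
  rewrite -sumrB; apply: eq_bigr => h _; rewrite riemann_conf // -/K [j == h]eq_sym [i == h]eq_sym.
  ring.
rewrite mulrBr; congr (_ - _).
  under eq_bigr => i _ do under eq_bigr => j _ do rewrite -mulr_sumr sum_dlt.
  transitivity (\sum_i dlt i l * (K * (u 0 i * edot v v))).
    apply: eq_bigr => i _; rewrite edotE !mulr_sumr; apply: eq_bigr => j _; ring.
  by rewrite sum_dlt; ring.
under eq_bigr => i _ do under eq_bigr => j _ do rewrite -mulr_sumr sum_dlt.
transitivity (\sum_i (K * (u 0 i * v 0 i) * v 0 l)).
  apply: eq_bigr => i _; rewrite -(sum_dlt l (fun j => K * (u 0 i * v 0 i) * v 0 j)).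
  by apply: eq_bigr => j _; ring.
by rewrite -mulr_suml -mulr_sumr -edotE; ring.
Qed.

(** The equality case of Cauchy-Schwarz: if the determinant vanished, [|v| ^ 2] times [u] minus
    [edot u v] times [v] would be a vanishing combination with a nonzero coefficient. *)
Lemma gram_neq0 u v : row_free (col_mx u v) -> edot u u * edot v v - edot u v ^+ 2 != 0.
Proof.
move=> fr; have comb (s t : R) : s *: u + t *: v = 0 -> s = 0 /\ t = 0.
  move=> E; have : row_mx (s%:M : 'M[R]_1) (t%:M : 'M[R]_1) *m col_mx u v = 0.
    by rewrite mul_row_col !mul_scalar_mx.
  move=> /eqP; rewrite mulmx_free_eq0 // => /eqP; rewrite -row_mx0 => /eq_row_mx[h1 h2].
  by split; [move/matrixP: h1 => /(_ 0 0)|move/matrixP: h2 => /(_ 0 0)]; rewrite !mxE eqxx mulr1n.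
apply/eqP => G0; have vn : edot v v != 0.
  by apply/eqP => /edot_eq0 v0; have [] := comb 0 1; rewrite ?scale0r ?scale1r ?v0 ?addr0 // => _ /eqP; rewrite oner_eq0.
have w0 : edot v v *: u + (- edot u v) *: v = 0.
  apply: edot_eq0; rewrite !edot_lin (edotC v u).
  transitivity (edot v v * (edot u u * edot v v - edot u v ^+ 2)); last by rewrite G0 mulr0.
  by rewrite expr2; ring.
by have [h _] := comb _ _ w0; move: vn; rewrite h eqxx.
Qed.

Lemma sectional_curvature_conf p u v x : cod x -> row_free (col_mx u v) ->
  sectional_curvature (gm p) x u v = k.
Proof.
move=> cx /gram_neq0; rewrite /sectional_curvature curvature_op_conf // !metric_at_conf.
move: (lt0r_neq0 (conf_factor_gt0 CC cx)); rewrite !edot_lin (edotC v u).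
set f := fac x; set A := edot u u; set B := edot v v; set C := edot u v; rewrite expr2; sclear => f0 G0.
field; apply: contraNN G0 => /eqP h; apply/eqP.
apply: (@mulfI _ (f * f)); first exact: mulf_neq0.
by rewrite mulr0 -h; ring.
Qed.

End Curvature.

(** * Lengths of curves *)

Lemma clamp_lip (R : realType) (s t : R) :
  `|Num.max 0 (Num.min 1 s) - Num.max 0 (Num.min 1 t)| <= `|s - t|.
Proof.
wlog st : s t / t <= s => [hw|].
  have [/hw //|/ltW /hw] := leP t s; by rewrite distrC [in X in _ -> X](distrC s).
rewrite [`|s - t|]ger0_norm ?subr_ge0 // ler_norml.
have m01 : Num.max 0 1 = 1 :> R by apply/max_idPr.
case: (leP 1 s) => h1; case: (leP 1 t) => h2; rewrite ?m01.
- by move: st; clear; lra.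
- by case: (leP 0 t) => h3; move: st h1 h2 h3; clear; lra.
- by move: st h1 h2; clear; lra.
- by case: (leP 0 s) => h3; case: (leP 0 t) => h4; move: st h1 h2 h3 h4; clear; lra.
Qed.

Lemma clamp_id (R : realType) (t : R) : 0 <= t <= 1 -> Num.max 0 (Num.min 1 t) = t.
Proof. by move=> /andP[t0 t1]; rewrite (min_idPr t1) (max_idPr t0). Qed.

Lemma clamp_in (R : realType) (t : R) : 0 <= Num.max 0 (Num.min 1 t) <= 1.
Proof. by rewrite le_max lexx /= ge_max ler01 ge_min lexx. Qed.

Lemma clamp_continuous (R : realType) (v : R -> R) :
  (forall t, 0 <= t <= 1 -> {for t, continuous v}) ->
  continuous (fun t : R => v (Num.max 0 (Num.min 1 t))).
Proof.
move=> cv t; apply/cvgrPdist_lt => e e0.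
have := cv _ (clamp_in t); move/cvgrPdist_lt => /(_ _ e0) /nbhs_ballP[s /= s0 hs].
apply/nbhs_ballP; exists s => // t'; rewrite /ball /= => tt'; apply: hs.
by rewrite /ball /=; apply: le_lt_trans tt'; exact: clamp_lip.
Qed.

(** No derivative of [f] is available, only a bound on its speed, so [f] minus a primitive of [v] is
    handled by [growth_le]. As [v] is controlled on [[0, 1]] only, it is extended by its end
    values. *)
Lemma growth_integral (R : realType) (f v : R -> R) :
  (forall t, 0 <= t <= 1 -> 0 <= v t) -> (forall t, 0 <= t <= 1 -> {for t, continuous v}) ->
  (forall t eta, 0 <= t <= 1 -> 0 < eta -> exists2 s, 0 < s &
    forall t', 0 <= t' <= 1 -> `|t' - t| < s -> `|f t' - f t| <= (v t + eta) * `|t' - t|) ->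
  f 1 - f 0 <= (\int[lebesgue_measure]_(t in `[0%R, 1%R]) v t)%R.
Proof.
move=> v0 cv hf; pose w t := v (Num.max 0 (Num.min 1 t)).
have cw : continuous w by exact: clamp_continuous.
have -> : (\int[lebesgue_measure]_(t in `[0%R, 1%R]) v t = \int[lebesgue_measure]_(t in `[0%R, 1%R]) w t)%R.
  by apply: eq_Rintegral => t; rewrite inE /= in_itv /= => ht; rewrite /w clamp_id.
(* The primitive starts at -1 and is used up to 2, so that it is differentiable at both ends of
   [[0, 1]]. *)
pose F x := (\int[lebesgue_measure]_(t in [set` `[(-1)%R, x]]) w t)%R.
have F' x : -1 < x -> x < 2 -> der1 x F (w x).
  move=> x1 x2; have [|h1 h2] := continuous_FTC1_closed x2 _ x1 (cw x).
    apply: continuous_compact_integrable; first exact: segment_compact.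
    exact: continuous_subspaceT.
  by apply: DeriveDef => //; rewrite -derive1E.
have <- : F 1 - F 0 = (\int[lebesgue_measure]_(t in `[0%R, 1%R]) w t)%R.
  rewrite /Rintegral (@continuous_FTC2 _ w F 0 1) //.
  - exact: continuous_subspaceT.
  - split.
    + by move=> x; rewrite in_itv /= => hx; have [] := F' x ltac:(move: hx; clear; lra) ltac:(move: hx; clear; lra).
    + apply: cvg_at_right_filter; apply: derive_cont; apply: F'; lra.
    + apply: cvg_at_left_filter; apply: derive_cont; apply: F'; lra.
  - move=> x; rewrite in_itv /= => hx.
    by have [_ E] := F' x ltac:(move: hx; clear; lra) ltac:(move: hx; clear; lra); rewrite derive1E.
apply/ler_addgt0Pr => eta eta0; have e2 : 0 < eta / 2 by rewrite divr_gt0.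
suff : f 1 + (-1 * F 1) <= f 0 + (-1 * F 0) + eta * (1 - 0) by lra.
apply: (@growth_le _ _ _ eta (fun t => f t + (-1 * F t))) => //.
  apply: econtD.
    move=> t ht e e0; have [s s0 hs] := hf t 1 ht ltr01.
    have K0 : 0 < v t + 1 by rewrite ltr_wpDl // v0.
    exists (Num.min s (e / (v t + 1))); first by rewrite lt_min s0 divr_gt0.
    move=> t' ht'; rewrite lt_min ltr_pdivlMr // => /andP[h1 h2].
    by apply: le_lt_trans (hs t' ht' h1) _; rewrite mulrC.
  move=> t ht e e0.
  have := derive_cont (F' t ltac:(lra) ltac:(lra)); move/cvgrPdist_lt => /(_ _ e0) /nbhs_ballP[s /= s0 hs].
  exists s => // t' _ tt'; rewrite -mulrBr mulN1r normrN distrC; apply: hs.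
  by rewrite /ball /= distrC.
move=> t ht; have ht' : 0 <= t <= 1 by lra.
have [s s0 hs] := hf t _ ht' e2.
have [s' s'0 hs'] := derive_eps (F' t ltac:(lra) ltac:(lra)) e2.
pose del := Num.min (1 - t) (Num.min (s / 2) (s' / 2)).
have d0 : 0 < del by rewrite !lt_min !divr_gt0 // subr_gt0; lra.
have d1 : del <= 1 - t by rewrite ge_min lexx.
have d2 : del <= s / 2 by rewrite !ge_min lexx orbT.
have d3 : del <= s' / 2 by rewrite !ge_min lexx !orbT.
exists (t + del); first lra.
have := hs (t + del) ltac:(lra); have := hs' (t + del).
rewrite addrAC subrr add0r gtr0_norm // => /(_ ltac:(lra)); rewrite ler_norml => /andP[g1 _].
move=> /(_ ltac:(lra)); rewrite ler_norml => /andP[_ g2].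
move: g1; rewrite /w clamp_id // => g1; move: g1 g2; clear; lra.
Qed.

Section Lengths.
Variables (R : realType) (Y : metricType R) (n : nat) (r T r1 T1 k : R).
Variables (P : R -> R) (psi : Y -> 'rV[R]_n -> Y).
Hypothesis CC : conformal_charts r T r1 T1 k P psi.
Hypothesis hlength : complete_length_space Y.
Hypothesis Y_second_countable : @second_countable Y.
Implicit Types (p a b : Y) (x z u : 'rV[R]_n) (t : R).
Local Notation d := (@mdist R Y).
Local Notation q x := (1 + k * edot x x).
Local Notation fac := (conf_factor k).
Local Notation cod := (chart_cod T1).
Local Ltac sclear := clear - R Y n r T r1 T1 k P psi CC hlength Y_second_countable.

Lemma conf_cover p : exists a, cdom (conf_chart CC a) p.
Proof. by exists p; rewrite /= /chart_dom /= mdistxx (cc_r1 CC). Qed.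

Lemma conf_metric_sym (a : Y) x : cod x -> (conf_metric k a x)^T = conf_metric k a x.
Proof. by move=> _; rewrite tr_scalar_mx. Qed.

Lemma conf_metric_pos (a : Y) x u : cod x -> u != 0 -> 0 < metric_at (conf_metric k a) x u u.
Proof.
move=> cx u0; rewrite metric_at_conf mulr_gt0 ?(conf_factor_gt0 CC) // lt_neqAle edot_ge0 andbT.
by rewrite eq_sym; apply: contraNN u0 => /eqP /edot_eq0 ->.
Qed.

Definition conf_manifold : riemannian_manifold R n :=
  @RiemannianManifold R n Y (@metric_hausdorff R Y) Y_second_countable Y (conf_chart CC)
    conf_cover (@transition_smooth _ _ _ _ _ _ _ _ _ _ CC) (conf_metric k)
    (@conf_metric_smooth _ _ _ _ _ _ _ _ _ _ CC) conf_metric_sym conf_metric_pos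
    (@transition_compat _ _ _ _ _ _ _ _ _ _ CC).

Local Notation M := conf_manifold.

Definition speed (c : R -> 'rV[R]_n) t : R := Num.sqrt (fac (c t) * edot (derive1 c t) (derive1 c t)).

Lemma speed_sqr c t : cod (c t) ->
  speed c t ^+ 2 = 4 * edot (derive1 c t) (derive1 c t) / (q (c t) * q (c t)).
Proof.
move=> ct; rewrite sqr_sqrtr; first by rewrite /conf_factor mulrAC.
by rewrite mulr_ge0 ?edot_ge0 // ltW // (conf_factor_gt0 CC).
Qed.

Lemma derivable_shift_cvg (c : R -> 'rV[R]_n) t : derivable c t 1 ->
  (fun h : R => h^-1 *: (c (h + t) - c t)) @ (0 : R)^' --> derive1 c t /\
  (fun h : R => c (h + t)) @ (0 : R)^' --> c t.
Proof.
move=> dc; have E : (fun h : R => h^-1 *: ((c \o shift t) (h *: 1) - c t)) =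
    (fun h : R => h^-1 *: (c (h + t) - c t)).
  by apply/funext => h /=; rewrite [h *: 1]/GRing.scale /= mulr1.
split; first by rewrite derive1E -E; exact: dc.
have cc : {for t, continuous c} by apply: differentiable_continuous; apply/derivable1_diffP.
have ch : (fun h : R => h + t) @ (0 : R)^' --> t.
  apply: cvg_trans (_ : (fun h : R => h + t) @ (0 : R) --> t).
    by apply: cvg_app; exact: nbhs_dnbhs.
  have -> : nbhs t = nbhs ((fun h : R => h + t) 0) by rewrite add0r.
  by apply: (@continuousD _ _ _ (fun h : R => h) (cst t)); [exact: cvg_id|exact: cst_continuous].
exact: (@cvg_comp _ _ _ (fun h : R => h + t) c _ _ _ ch cc).
Qed.

(** The conformal factor is the infinitesimal form of the chordal law: [P] is close to half the
    square of small distances, so the squared distance over the squared increment of the parameter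
    tends to the squared speed. *)
Lemma speed_bound p (c : R -> 'rV[R]_n) t eta : derivable c t 1 -> cod (c t) -> 0 < eta ->
  exists2 s, 0 < s & forall t', cod (c t') -> `|t' - t| < s ->
    d (psi p (c t)) (psi p (c t')) <= (speed c t + eta) * `|t' - t|.
Proof.
move=> dc ct eta0; have [cD cc] := derivable_shift_cvg dc.
set D := derive1 c t in cD; set v := speed c t.
have v0 : 0 <= v by exact: sqrtr_ge0.
have vE : v ^+ 2 = 4 * edot D D / (q (c t) * q (c t)) by exact: speed_sqr.
have cT := cod_T CC ct; have q0 := q_neq0 CC cT.
pose G h := 4 * edot (h^-1 *: (c (h + t) - c t)) (h^-1 *: (c (h + t) - c t)) * (q (c t) * q (c (h + t)))^-1.
have cq : (fun h => q (c (h + t))) @ (0 : R)^' --> q (c t).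
  have c1 : (fun=> 1 : R) @ (0 : R)^' --> (1 : R) by exact: cvg_cst.
  apply: (cvgD c1); apply: cvgMr.
  exact: (@cvg_comp _ _ _ _ (fun y : 'rV[R]_n => edot y y) _ _ _ cc (@edot_continuous R n (c t))).
have cG : G @ (0 : R)^' --> v ^+ 2.
  rewrite vE; apply: cvgM.
    apply: cvgMr.
    exact: (@cvg_comp _ _ _ _ (fun y : 'rV[R]_n => edot y y) _ _ _ cD (@edot_continuous R n D)).
  by apply: cvgV; [rewrite mulf_neq0|exact: cvgMr].
have veta : 0 < (v + eta) ^+ 2 - v ^+ 2.
  have := mulr_gt0 eta0 eta0; have := mulr_ge0 v0 (ltW eta0).
  by rewrite subr_gt0 !expr2; sclear; lra.
set K := ((v + eta) ^+ 2 + v ^+ 2) / 2.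
have GK : \forall h \near (0 : R)^', G h < K.
  have hK : v ^+ 2 < K by rewrite /K; move: veta; sclear; lra.
  exact: cvgr_lt cG _ hK.
have ve0 : 0 < (v + eta) ^+ 2 by apply: lt_le_trans veta _; rewrite gerBl sqr_ge0.
(* [K] is the mean of [v ^ 2] and [(v + eta) ^ 2]. Its relative gap to the latter is [2 * e1], which
   absorbs the error of replacing [P] by half the square. *)
pose e1 := ((v + eta) ^+ 2 - v ^+ 2) / (4 * (v + eta) ^+ 2).
have e10 : 0 < e1 by rewrite divr_gt0 // mulr_gt0.
have Ke : K = (v + eta) ^+ 2 * (1 - 2 * e1).
  by rewrite /K /e1; move: (lt0r_neq0 ve0); set A := (v + eta) ^+ 2; set B := v ^+ 2; sclear => A0; field.
have K0 : 0 < K by rewrite /K; have := sqr_ge0 v; move: ve0; sclear; lra.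
have ee : 0 < 1 - 2 * e1 by move: K0; rewrite Ke pmulr_rgt0.
have [d1 d10 hd1] := cc_asym CC e10.
have near_d : \forall h \near (0 : R)^', edot (c (h + t)) (c (h + t)) < T -> d (psi p (c t)) (psi p (c (h + t))) < d1.
  exact: (cc _ (psi_cont CC p cT d10)).
have : \forall h \near (0 : R)^', cod (c (h + t)) -> d (psi p (c t)) (psi p (c (h + t))) <= (v + eta) * `|h|.
  have h0 : \forall h \near (0 : R)^', h != 0 by exact: nbhs_dnbhs_neq.
  apply: filterS3 GK near_d h0 => h Gh dh h0 ch; have {}dh := dh (cod_T CC ch).
  set s := d _ _ in dh *; have s0 : 0 <= s by exact: mdist_ge0.
  have ve : 0 <= v + eta by rewrite addr_ge0 // ltW.
  rewrite -(@ler_pXn2r _ 2) ?nnegrE ?mulr_ge0 // exprMn real_normK ?num_real //.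
  move: s0; rewrite le_eqVlt => /orP[/eqP <-|s0].
    by rewrite expr0n mulr_ge0 ?sqr_ge0.
  have := hd1 s; rewrite s0 dh => /(_ isT); rewrite ler_norml => /andP[PL _].
  have PG : 2 * P s = G h * h ^+ 2.
    rewrite /s (cc_law CC) //; last exact: (cod_T CC ch).
    rewrite /G -[c t - c (h + t)]opprB !edotNl !edotNr opprK !edotZl !edotZr.
    have := q_neq0 CC (cod_T CC ch); move: q0 h0; set q1 := q _; set q2 := q _; set B := edot _ _.
    by sclear => n1 n2 n3; field; rewrite n1 n2 n3.
  have h20 : 0 < h ^+ 2 by rewrite exprn_even_gt0.
  have : s ^+ 2 * (1 - 2 * e1) <= 2 * P s by move: PL; sclear; lra.
  rewrite PG => sG; rewrite -(ler_pM2r ee); apply: le_trans sG _.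
  have : G h * h ^+ 2 <= K * h ^+ 2 by rewrite ler_pM2r // ltW.
  by rewrite Ke; sclear; lra.
move/nbhs_ballP => [s /= s0 hs]; exists s => // t' ct' tt'.
have [->|ne] := eqVneq t' t; first by rewrite mdistxx subrr normr0 mulr0.
have := hs (t' - t); rewrite /ball /= sub0r normrN subrK subr_eq0.
by move=> /(_ tt' ne ct').
Qed.

Lemma speed_continuous (c : R -> 'rV[R]_n) t : (forall t, derivable c t 1) ->
  continuous (derive1 c) -> cod (c t) -> {for t, continuous (speed c)}.
Proof.
move=> dc cc' ct; have cc : {for t, continuous c}.
  by apply: differentiable_continuous; apply/derivable1_diffP.
have cf : {for c t, continuous fac}.
  apply: differentiable_continuous; exact: (ratfun_differentiable (ratfun_conf_factor CC)).
have c1 : {for t, continuous (fun t => fac (c t))} by exact: (continuous_comp cc cf).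
have c2 : {for t, continuous (fun t => edot (derive1 c t) (derive1 c t))}.
  exact: (@continuous_comp _ _ _ (derive1 c) (fun z : 'rV[R]_n => edot z z) t (cc' t) (@edot_continuous R n _)).
have c3 : {for t, continuous (fun t => fac (c t) * edot (derive1 c t) (derive1 c t))} by exact: continuousM.
exact: (@continuous_comp _ _ _ (fun t => fac (c t) * edot (derive1 c t) (derive1 c t)) Num.sqrt t c3 (@sqrt_continuous R _)).
Qed.

Lemma chart_curve_lengthE (a : Y) c :
  @chart_curve_length _ _ M a c = (\int[lebesgue_measure]_(t in `[0%R, 1%R]) speed c t)%R.
Proof. by apply: eq_Rintegral => t _; rewrite /= metric_at_conf. Qed.

Lemma chart_curve_ge (a : Y) c : @chart_curve _ _ M a c ->
  d (psi a (c 0)) (psi a (c 1)) <= @chart_curve_length _ _ M a c.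
Proof.
move=> [dc cc' cT]; rewrite chart_curve_lengthE.
rewrite -[X in X <= _]subr0 -[X in _ - X](mdistxx (psi a (c 0))).
apply: (@growth_integral _ (fun t => d (psi a (c 0)) (psi a (c t))) (speed c)).
- by move=> t _; exact: sqrtr_ge0.
- by move=> t ht; apply: speed_continuous => //; exact: cT.
move=> t eta ht eta0; have [s s0 hs] := speed_bound a (dc t) (cT t ht) eta0.
exists s => // t' ht' tt'; apply: le_trans (dist_lip _ _ _) _.
by rewrite metric_sym; apply: hs => //; exact: cT.
Qed.

Lemma curve_of_length_ge (p p' : M) L : curve_of_length p p' L -> d p p' <= L.
Proof.
elim=> {p p' L} [p|a c p' L hc _ IH]; first by rewrite mdistxx.
apply: le_trans (metric_triangle _ (psi a (c 1)) _) _.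
by apply: lerD IH; exact: chart_curve_ge.
Qed.

Lemma curve_cat (p1 p2 p3 : M) L L' : curve_of_length p1 p2 L -> curve_of_length p2 p3 L' ->
  curve_of_length p1 p3 (L + L').
Proof.
elim=> {p1 p2 L} [p|a c p' L hc _ IH] h; first by rewrite add0r.
by rewrite -addrA; apply: curve_cons => //; exact: IH.
Qed.

Lemma segment_curve (p : M) x : cod x -> exists2 L, curve_of_length p (psi p x : M) L &
  L <= 2 * enorm x / (1 - `|k| * edot x x).
Proof.
move=> cx; pose c (t : R) : 'rV[R]_n := t *: x.
have dcl t : is_derive t 1 c x.
  have did : differentiable (fun s : R => s) t by apply/derivable1_diffP; exact: derivable_id.
  have dd : differentiable c t by exact: differentiableZl.
  split; first exact: diff_derivable.
  by rewrite deriveE // /c diffZl // -deriveE // derive_id scale1r.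
have dc1 : derive1 c = cst x by apply/funext => t; rewrite derive1E; case: (dcl t).
have X0 := edot_ge0 x; have kT := cc_kT CC.
have kx1 : `|k| * edot x x < 1.
  by apply: le_lt_trans kT; rewrite ler_wpM2l // ltW // (cod_T CC).
have inT t : 0 <= t <= 1 -> edot (c t) (c t) <= edot x x.
  by move=> /andP[t0 t1]; rewrite /c !edot_lin mulrA ler_piMl ?mulr_ile1.
have hc : @chart_curve _ _ M p c.
  split; [by move=> t; case: (dcl t)|by rewrite dc1; exact: cst_continuous|].
  by move=> t /inT h; apply: le_lt_trans h cx.
exists (@chart_curve_length _ _ M p c + 0).
  have h : @curve_of_length _ _ M (psi p (c 0)) (psi p (c 1)) (@chart_curve_length _ _ M p c + 0).
    exact: (@curve_cons _ _ M p c _ _ hc (@curve_nil _ _ M (psi p (c 1)))).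
  have E0 : psi p (c 0) = p by rewrite /c scale0r (cc_center CC).
  have E1 : psi p (c 1) = psi p x by rewrite /c scale1r.
  by rewrite E0 E1 in h.
rewrite addr0 chart_curve_lengthE.
set B := 2 * enorm x / _.
have B0 : 0 <= B by rewrite divr_ge0 ?mulr_ge0 ?enorm_ge0 // subr_ge0 ltW.
have mI : measurable (`[0%R, 1%R]%classic : set R) by exact: measurable_itv.
have -> : B = (\int[lebesgue_measure]_(t in `[0%R, 1%R]) (cst B t))%R.
  rewrite Rintegral_cst //=; have -> : lebesgue_measure (`[0%R, 1%R]%classic : set R) = (1 : \bar R)%E.
    by rewrite lebesgue_measure_itv /= lte_fin ltr01 oppr0 adde0.
  by rewrite mulr1.
apply: le_Rintegral => //.
- have -> : EFin \o speed c = EFin \o (speed c : measurableTypeR R -> R^o) by [].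
  apply: continuous_compact_integrable; first exact: segment_compact.
  apply: continuous_in_subspaceT => t; rewrite inE /= in_itv /= => ht.
  case: hc => h1 h2 h3; apply: speed_continuous => //; exact: h3.
- apply: continuous_compact_integrable; first exact: segment_compact.
  by apply: continuous_subspaceT; exact: cst_continuous.
move=> t; rewrite /= in_itv /= => ht; have ct := inT t ht.
have codt : cod (c t) by apply: le_lt_trans ct cx.
rewrite -(@ler_pXn2r _ 2) ?nnegrE ?sqrtr_ge0 // speed_sqr // dc1 /B expr_div_n exprMn sqr_enorm.
have qt : 1 - `|k| * edot x x <= q (c t).
  have : `|k * edot (c t) (c t)| <= `|k| * edot x x.
    by rewrite normrM [`|edot _ _|]ger0_norm ?edot_ge0 // ler_wpM2l.
  by rewrite ler_norml; sclear; lra.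
have D0 : 0 < 1 - `|k| * edot x x by rewrite subr_gt0.
have Q0 : 0 < q (c t) by apply: lt_le_trans D0 qt.
rewrite (_ : 2 ^+ 2 = 4 :> R) -?natrX // ler_wpM2l ?mulr_ge0 // lef_pV2 ?posrE ?exprn_gt0 ?mulr_gt0 //.
by rewrite expr2 ler_pM // ltW.
Qed.

(** The coordinate segment from the centre of the chart at [p] is nearly minimizing: its length is
    about [2 * enorm x] at most, and the asymptotics of [P] identify this with the distance. The
    errors [eps / 8] of [P], of [q] and of the denominator together stay below the factor
    [1 + eps]. *)
Lemma short_curve eps : 0 < eps <= 1 -> exists2 del, 0 < del & forall (p y : M), d p y < del ->
  exists2 L, curve_of_length p y L & L <= (1 + eps) * d p y.
Proof.
move=> /andP[e0 e1]; have e8 : 0 < eps / 8 by rewrite divr_gt0.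
have k10 : 0 < `|k| + 1 by rewrite ltr_wpDl.
have [s s0 hs] := cc_asym CC e8.
have [s' s'0 hs'] := cc_cont CC (divr_gt0 e8 k10).
exists (Num.min r1 (Num.min s s')); first by rewrite !lt_min (cc_r1 CC) s0.
move=> p y; rewrite !lt_min => /and3P[py1 pys pys'].
have [x xT xE] := cc_onto CC (lt_trans py1 (r1_r CC)).
have cx : cod x by rewrite /chart_cod /= -(cc_in1 CC p xT) xE.
have [L hL LB] := segment_curve p cx; exists L; first by rewrite -xE.
apply: le_trans LB _; set X := edot x x in xT *; have X0 : 0 <= X := edot_ge0 x.
set t := d p y; have t0 : 0 <= t by exact: mdist_ge0.
have PE : P t = 2 * X / q x.
  have := cc_law CC p (_ : edot 0 0 < T) xT; rewrite (cc_center CC) xE edot0l mulr0 addr0 mul1r sub0r edotNl edotNr opprK.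
  by apply; apply: lt_trans (cc_T1 CC) (cc_T CC).
have /andP[q1 q2] := q_bounds CC xT; have q0 := q_gt0 CC xT.
have PX : 2 * X = P t * q x by rewrite PE divfK // gt_eqF.
have Pt8 : P t < eps / 8 / (`|k| + 1) by apply: hs'; rewrite t0.
have P0 : 0 <= P t by rewrite PE divr_ge0 ?mulr_ge0 // ltW.
have XP : X <= P t by have : P t * q x <= P t * 2 := ler_wpM2l P0 q2; move: PX; sclear; lra.
have kX : `|k| * X <= eps / 8.
  have := le_lt_trans XP Pt8; rewrite ltr_pdivlMr //.
  by move: X0; sclear; lra.
have D0 : 0 < 1 - `|k| * X by move: kX e1; sclear; lra.
have N1 : 0 <= (1 + eps) * t * (1 - `|k| * X).
  by rewrite mulr_ge0 ?(ltW D0) // mulr_ge0 // addr_ge0 // ltW.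
have N2 : 0 <= 2 * enorm x by rewrite mulr_ge0 // enorm_ge0.
rewrite ler_pdivrMr // -(@ler_pXn2r _ 2) ?nnegrE //.
rewrite !exprMn sqr_enorm -/X.
have asy : P t <= (1 / 2 + eps / 8) * t ^+ 2.
  move: t0; rewrite le_eqVlt => /orP[/eqP <-|t0]; first by rewrite (cc_P0 CC) expr0n mulr0.
  have := hs t; rewrite t0 pys => /(_ isT); rewrite ler_norml => /andP[_].
  by sclear; lra.
have qk : q x <= 1 + eps / 8.
  have : k * X <= `|k| * X by rewrite ler_wpM2r // ler_norm.
  by rewrite -/X; move: kX; sclear; lra.
have t20 : 0 <= t ^+ 2 by exact: sqr_ge0.
have h1 : 2 ^+ 2 * X <= 2 * ((1 / 2 + eps / 8) * t ^+ 2 * (1 + eps / 8)).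
  have : P t * q x <= (1 / 2 + eps / 8) * t ^+ 2 * (1 + eps / 8) by apply: ler_pM => //; exact: ltW.
  by rewrite -PX; sclear; lra.
apply: le_trans h1 _.
have h2 : (1 - eps / 8) ^+ 2 <= (1 - `|k| * X) ^+ 2.
  by rewrite ler_pXn2r ?nnegrE //; move: kX D0 e1; sclear; lra.
have h3 : 2 * ((1 / 2 + eps / 8) * (1 + eps / 8)) <= (1 + eps) ^+ 2 * (1 - eps / 8) ^+ 2.
  rewrite -exprMn expr2; have h : 1 + eps / 2 <= (1 + eps) * (1 - eps / 8).
    by have := mulr_ge0 (ltW e0) (ltW e0); have := ler_wpM2l (ltW e0) e1; sclear; lra.
  have : (1 + eps / 2) * (1 + eps / 2) <= (1 + eps) * (1 - eps / 8) * ((1 + eps) * (1 - eps / 8)).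
    by apply: ler_pM => //; rewrite addr_ge0 // divr_ge0 // ltW.
  apply: le_trans; have := mulr_ge0 (ltW e0) (ltW e0); move: e0; sclear; lra.
have h4 : (1 + eps) ^+ 2 * (1 - eps / 8) ^+ 2 * t ^+ 2 <= (1 + eps) ^+ 2 * (1 - `|k| * X) ^+ 2 * t ^+ 2.
  by rewrite ler_wpM2r // ler_wpM2l // sqr_ge0.
have h5 := ler_wpM2r t20 h3.
move: h4 h5; set A := (1 + eps) ^+ 2 * _; set B := (1 + eps) ^+ 2 * _.
rewrite (_ : (1 + eps) ^+ 2 * t ^+ 2 * (1 - `|k| * X) ^+ 2 = B * t ^+ 2); last by rewrite /B; ring.
by move: A B => A B; sclear; lra.
Qed.

(** A relative error is preserved by concatenation, so midpoints reduce the claim to short pieces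
    without loss in the factor [1 + eps]. *)
Lemma long_curve eps (p y : M) : 0 < eps <= 1 ->
  exists2 L, curve_of_length p y L & L <= (1 + eps) * d p y.
Proof.
move=> he; have [del d0 hd] := short_curve he.
have [N] : exists N : nat, d p y < del * 2 ^+ N.
  have hN : d p y / del < (Num.bound (d p y / del))%:R by apply: archi_boundP; rewrite divr_ge0 ?mdist_ge0 // ltW.
  exists (Num.bound (d p y / del)); rewrite mulrC -ltr_pdivrMr //; apply: lt_le_trans hN _.
  by rewrite -natrX ler_nat ltnW // ltn_expl.
elim: N p y => [|N IH] p y; first by rewrite expr0 mulr1; exact: hd.
have [m [pm my]] := midpoint hlength p y; rewrite exprS => h.
have [|L1 c1 l1] := IH p m; first by rewrite pm; move: h; sclear; lra.
have [|L2 c2 l2] := IH m y; first by rewrite my; move: h; sclear; lra.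
exists (L1 + L2); first exact: curve_cat c1 c2.
by move: l1 l2; rewrite pm my; sclear; lra.
Qed.

Lemma rdist_mdist (p y : M) : rdist p y = (d p y)%:E.
Proof.
apply/eqP; rewrite eq_le; apply/andP; split; last first.
  by apply: le_ereal_inf_tmp => _ [L hL <-]; rewrite lee_fin; exact: curve_of_length_ge.
apply/lee_addgt0Pr => e e0; have K0 : 0 < d p y + 1 by rewrite ltr_wpDl ?mdist_ge0.
have [|L hL LB] := @long_curve (Num.min 1 (e / (d p y + 1))) p y.
  by rewrite lt_min ltr01 divr_gt0 //= ge_min lexx.
apply: le_trans (_ : (L%:E <= _)%E); first by apply: ereal_inf_lbound; exists L.
rewrite -EFinD lee_fin; apply: le_trans LB _; rewrite mulrDl mul1r lerD2l.
have : Num.min 1 (e / (d p y + 1)) <= e / (d p y + 1) by rewrite ge_min lexx orbT.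
rewrite ler_pdivlMr // => h; apply: le_trans h; rewrite ler_wpM2l ?lerDl //.
by rewrite le_min ler01 divr_ge0 ?ltW.
Qed.

End Lengths.

(** * Completeness and countability *)

Section Global.
Variables (R : realType) (Y : metricType R) (n : nat) (r T r1 T1 k : R).
Variables (P : R -> R) (psi : Y -> 'rV[R]_n -> Y).
Hypothesis CC : conformal_charts r T r1 T1 k P psi.
Hypothesis hlength : complete_length_space Y.
Implicit Types (p : Y) (x : 'rV[R]_n).
Local Notation d := (@mdist R Y).
Local Ltac sclear := clear - R Y n r T r1 T1 k P psi CC hlength.

Lemma nbhs_rational x (U : set 'rV[R]_n) : nbhs x U ->
  exists w : 'rV[rat]_n, U (map_mx (@ratr R) w).
Proof.
move=> /nbhs_ballP[e /= e0 he].
have h i : exists w : rat, x 0 i < ratr w < x 0 i + e.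
  by have [|w hw] := @rat_in_itvoo R (x 0 i) (x 0 i + e); [rewrite ltrDl|exists w; rewrite in_itv in hw].
have [w hw] := choice h; exists (\row_i w i); apply: he; split => // i j.
rewrite !mxE (ord1 i) -ball_normE /ball_ /=.
by have := hw j; rewrite ltr_norml; sclear; lra.
Qed.

(** Points reached from [o] by finitely many moves, each to a point with rational coordinates in the
    chart of the previous one. They are countably many, and dense because short steps link [o] to
    every point. *)
Definition rational_point (o : Y) (l : seq 'rV[rat]_n) : Y :=
  foldl (fun p w => psi p (map_mx (@ratr R) w)) o l.

Lemma rational_point_dense o p e : 0 < e -> exists l, d (rational_point o l) p < e.
Proof.
move: p e; pose Q p := forall e, 0 < e -> exists l, d (rational_point o l) p < e.
move=> p; suff : Q p by [].
apply: (chain_ind hlength (cc_r1 CC) (Q := Q) _ (o := o)); last first.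
  by move=> e e0; exists [::]; rewrite /= mdistxx.
move=> x y Qx xy e e0; have [|l hl] := Qx (r1 - d x y); first by rewrite subr_gt0.
have ly : d (rational_point o l) y < r1.
  by apply: le_lt_trans (metric_triangle _ x _) _; rewrite -ltrBrDr.
set s := rational_point o l in ly.
have zc := chart_map_cod CC ly; have zE := chart_mapK CC ly; set z := phi T psi s y in zc zE.
have hU : nbhs z [set w | chart_cod T1 w /\ d y (psi s w) < e].
  have h1 := psi_cont CC s (cod_T CC zc) e0.
  have h2 : \forall w \near z, chart_cod T1 w.
    by apply: open_nbhs_nbhs; split => //; exact: chart_cod_open.
  apply: filterS2 h1 h2 => w h3 wc; split => //.
  by rewrite -zE; apply: h3; exact: (cod_T CC wc).
have [w [_ hw]] := nbhs_rational hU.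
by exists (rcons l w); rewrite /rational_point foldl_rcons -/(rational_point o l) metric_sym.
Qed.

Lemma conf_second_countable (o : Y) : @second_countable Y.
Proof.
pose B (lm : seq 'rV[rat]_n * nat) := [set y | d (rational_point o lm.1) y < lm.2.+1%:R^-1].
exists (B @` setT).
  by apply: card_le_trans (card_image_le _ _) _; exact: countableP.
split; first by move=> _ [lm _ <-]; exact: open_mdist_ball.
move=> x N /nbhs_ballP[e /= e0 he].
have hm : 2 / e < (Num.bound (2 / e))%:R by apply: archi_boundP; rewrite divr_ge0 // ltW.
set m := Num.bound _ in hm; have m0 : 0 < (m.+1%:R : R) by rewrite ltr0n.
have [|l hl] := @rational_point_dense o x m.+1%:R^-1; first by rewrite invr_gt0.
have me : 2 * m.+1%:R^-1 < e.
  rewrite ltr_pdivrMr // mulrC -ltr_pdivrMr //; apply: lt_le_trans hm _.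
  by rewrite ler_nat.
exists (B (l, m)); first by split; [exists (l, m)|].
move=> y Bly; have ly : d (rational_point o l) y < m.+1%:R^-1 by exact: Bly.
apply: he; rewrite ballEmdist /=.
have := metric_triangle x (rational_point o l) y; rewrite (metric_sym x (rational_point o l)).
by move: me hl ly; set q := m.+1%:R^-1; sclear; lra.
Qed.

Hypothesis Y_second_countable : @second_countable Y.
Local Notation M := (conf_manifold CC Y_second_countable).

(** All charts have the same radius [r1], so the tail of a Cauchy sequence lies in a single chart;
    there the coordinates form a Cauchy sequence by the uniform continuity of [phi]. *)
Lemma conf_complete : complete_manifold M.
Proof.
move=> u hu; have {}hu (e : R) : 0 < e -> exists N : nat, forall i j : nat,
    (N <= i)%N -> (N <= j)%N -> d (u i) (u j) < e.
  move=> /hu[N hN]; exists N => i j iN jN.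
  by have := hN i j iN jN; rewrite (rdist_mdist hlength) lte_fin.
have [N hN] := hu _ (cc_r1 CC); pose p : Y := u N.
have pu i : (N <= i)%N -> d p (u i) < r1 by move=> iN; exact: hN.
pose v i := phi T psi p (u i).
have vT i : (N <= i)%N -> chart_cod T1 (v i) /\ psi p (v i) = u i.
  by move=> /pu h; split; [exact: (chart_map_cod CC h)|exact: (chart_mapK CC h)].
have cv : cvg (v @ \oo).
  apply: cauchy_cvg; apply: cauchy_exP => e e0.
  have [|s s0 hs] := @phi_ucont _ _ _ _ _ _ _ _ _ _ CC (e ^+ 2); first by rewrite exprn_gt0.
  have [N' hN'] := hu _ s0; pose K := maxn N N'.
  exists (v K); exists K => // i /= Ki; apply: ball_edot => //; apply: hs.
  - by apply: lt_trans (r1_r CC); apply: pu; exact: leq_maxl.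
  - by apply: lt_trans (r1_r CC); apply: pu; apply: leq_trans Ki; exact: leq_maxl.
  by apply: hN'; [exact: leq_maxr|apply: leq_trans Ki; exact: leq_maxr].
set x := lim (v @ \oo) in cv.
have geN : \forall i \near \oo, (N <= i)%N by exists N.
(* The limit may lie on the boundary of the coordinate ball of the chart, but [T1 < T] keeps it
   where the law holds. *)
have xT : edot x x < T.
  rewrite ltNge; apply/negP => Tx; have T1x : T1 < edot x x by apply: lt_le_trans (cc_T CC) Tx.
  have h1 : \forall z \near x, T1 < edot z z by exact: cvgr_gt (@edot_continuous R n x) _ T1x.
  have h2 : \forall i \near \oo, T1 < edot (v i) (v i) by exact: (cv _ h1).
  have [i [iN]] := filter_ex (filterI geN h2); have [h _] := vT i iN.
  by move=> h'; have := lt_trans h h'; rewrite ltxx.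
exists (psi p x); apply/cvg_ballP => e e0.
have h1 : \forall i \near \oo, edot (v i) (v i) < T -> d (psi p x) (psi p (v i)) < e.
  exact: (cv _ (psi_cont CC p xT e0)).
apply: filterS2 geN h1 => i iN hi; have [ci E] := vT i iN.
by rewrite ballEmdist /= -E; apply: hi; exact: (cod_T CC ci).
Qed.

End Global.

Lemma conformal_manifold_ex (R : realType) (Y : metricType R) n r T r1 T1 k P
    (psi : Y -> 'rV[R]_n -> Y) (o : Y) : conformal_charts r T r1 T1 k P psi ->
  complete_length_space Y ->
  exists (m : nat) (M : riemannian_manifold R m),
    [/\ complete_manifold M, constant_sectional_curvature M & isometric_to_manifold Y M].
Proof.
move=> CC hlength; have sc := conf_second_countable CC hlength o.
exists n, (conf_manifold CC sc); split; first exact: conf_complete.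
  exists k => a x u v cx fr; exact: (sectional_curvature_conf CC a cx fr).
exists id; split; first by exists id.
by move=> x y; exact: (rdist_mdist hlength).
Qed.

Theorem corollary1p2 (R : realType) (Y : metricType R) (E : exp_structure Y)
    (hlength : complete_length_space Y) (hiso : locally_isotropic E) :
  exists (m : nat) (M : riemannian_manifold R m),
    [/\ complete_manifold M, constant_sectional_curvature M &
        isometric_to_manifold Y M].
Proof.
case: hiso => r [r0 hr /choice[F hF]].
(* The infimum of the empty set is 0 by convention, so [r < inf] with [r] positive forces a point to
   exist. *)
have [p _] : exists p : Y, True.
  apply: contrapT => noY; move: hr; rewrite (_ : range _ = set0) ?inf0.
    by rewrite ltNge (ltW r0).
  by apply/seteqP; split => // t [y _ _]; case: noY; exists y.
have [n0|n0] := posnP (edim E); last first.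
  have [F' [e H]] := isotropic_space_ex hlength r0 hr hF n0 p.
  have [r1 [k [P [s [r10 r1r C]]]]] := cosine_law_ex p H (divr_gt0 r0 (ltr0Sn R 1)) n0.
  have [r2 [T [r3 [T1 [P' [psi CC]]]]]] := conformal_charts_ex H C r10 r1r n0.
  exact: conformal_manifold_ex p CC hlength.
(* In dimension 0 the Euclidean ball has one vector, so the exponential map covers the ball about
   [x] by a single point. *)
apply: (conformal_manifold_ex p (conformal_charts_dim0 r0 _) hlength) => x y xy.
have [_ _ h] := expo_bij E x; have xr := rad_gt hr x.
have [|u _ uE] := h x; first by rewrite ballEmdist /= mdistxx; exact: lt_trans xr.
have [|u' _ u'E] := h y; first by rewrite ballEmdist /=; exact: lt_trans xr.
rewrite -uE -u'E; congr (expo E x _); apply/rowP => i.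
by exfalso; have := ltn_ord i; move: (i : nat) => j; rewrite n0.
Qed.
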